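(* Let $d\ge 4$ and let $\Delta$ be a balanced normal $(d-1)$-pseudomanifold. Then $\overline{g}_2(\Delta)=0$ if and only if $\Delta$ is a stacked cross-polytopal sphere.
   Context: Balanced: the vertex set is partitioned into $d$ color classes with no face containing two vertices of the same color. Normal $(d-1)$-pseudomanifold: connected, pure, every $(d-2)$-face in exactly two facets, links of faces of dimension $\le d-3$ connected. $\overline{g}_2(\Delta)=2h_2(\Delta)-(d-1)h_1(\Delta)$ with $h_j(\Delta)=\sum_{i=0}^{j}(-1)^{j-i}\binom{d-i}{d-j}f_{i-1}(\Delta)$ ($f_{i-1}$ the number of $(i-1)$-faces, $f_{-1}=1$). $\mathcal{C}^*_d$ denotes the boundary complex of the $d$-dimensional cross-polytope: the $d$-fold join of $\mathbb{S}^0$, with vertices $u_i,v_i$ of color $i$ and faces all sets containing at most one of $u_i,v_i$ for each $i$. The balanced connected sum of two balanced pure $(d-1)$-complexes on disjoint vertex sets identifies a facet of one with a facet of the other via a color-preserving bijection and removes the identified facet. A stacked cross-polytopal sphere is a balanced connected sum of finitely many (at least one) copies of $\mathcal{C}^*_d$ (a single copy of $\mathcal{C}^*_d$ included). *)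

(* Defs.v *)
From mathcomp Require Import all_boot all_order all_algebra.

Set Implicit Arguments.
Unset Strict Implicit.
Unset Printing Implicit Defensive.

Import GRing.Theory.

(* A complex is a finite family of subsets of a finite type V.  Its vertices
   are the x with [set x] a face; V may contain elements that are not
   vertices. *)
Section Complexes.
Variable V : finType.
Implicit Types (D : {set {set V}}) (F G : {set V}).

Definition simplicial_complex D : Prop :=
  set0 \in D /\ forall F G, F \in D -> G \subset F -> G \in D.

Definition vertex D : pred V := fun x => [set x] \in D.

Definition facet D : pred {set V} := maxset (fun F => F \in D).

Definition adjacent D : rel V :=
  fun x y => (x != y) && ([set x; y] \in D).

Definition connected_complex D : Prop :=
  forall x y, vertex D x -> vertex D y -> connect (adjacent D) x y.

Definition link D F : {set {set V}} :=
  [set G in D | [disjoint G & F] && (G :|: F \in D)].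

(* Faces are measured by cardinality: dim F = #|F| - 1. *)
Definition pure (d : nat) D : Prop := forall F, facet D F -> #|F| = d.

Definition normal_pseudomanifold (d : nat) D : Prop :=
  [/\ connected_complex D,
      pure d D,
      (forall F, F \in D -> #|F| = d.-1 ->
         #|[set G | facet D G && (F \subset G)]| = 2) &
      (forall F, F \in D -> #|F| + 2 <= d -> connected_complex (link D F))].

Definition balanced (d : nat) (kappa : V -> 'I_d) D : Prop :=
  forall F x y, F \in D -> x \in F -> y \in F -> kappa x = kappa y -> x = y.

(* The number of faces with i vertices, i.e. f_(i-1). *)
Definition fnum D (i : nat) : nat := #|[set F in D | #|F| == i]|.

Definition hnum (d : nat) D (j : nat) : int :=
  (\sum_(i < j.+1)
     (-1) ^+ (j - i) * ('C(d - i, d - j))%:Z * (fnum D i)%:Z)%R.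

Definition gbar2 (d : nat) D : int :=
  (2%:Z * hnum d D 2 - (d%:Z - 1) * hnum d D 1)%R.

End Complexes.

(* A family of sets with a d-colouring; being a balanced simplicial complex is
   a separate property. *)
Record colored_complex (d : nat) := ColoredComplex {
  vtype : finType;
  faces : {set {set vtype}};
  color : vtype -> 'I_d
}.

Arguments ColoredComplex {d vtype} faces color.

(* Colour-preserving isomorphism; the conditions on f concern vertices only. *)
Definition colored_iso (d : nat) (A B : colored_complex d) : Prop :=
  exists f : vtype A -> vtype B,
    [/\ {in vertex (faces A) &, injective f},
        {in vertex (faces A), forall x, color (f x) = color x} &
        [set f @: (F : {set vtype A}) | F in faces A] = faces B].

(* The vertices are u_i = (i, true) and v_i = (i, false). *)
Definition cross_polytope (d : nat) : colored_complex d :=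
  ColoredComplex
    [set F : {set 'I_d * bool} |
       [forall i : 'I_d, ~~ (((i, true) \in F) && ((i, false) \in F))]]
    (fun x : 'I_d * bool => x.1).

Section ConnectedSum.
Variables (d : nat) (A B : colored_complex d).

(* The inclusion of the vertices of B into the glued vertex set: a vertex x of
   the facet FB of B is replaced by its partner phi x in A.  The elements
   inr x with x in FB are then not vertices of the sum. *)
Definition glue (FB : {set vtype B}) (phi : vtype B -> vtype A)
    (x : vtype B) : vtype A + vtype B :=
  if x \in FB then inl (phi x) else inr x.

Definition connected_sum (FA : {set vtype A}) (FB : {set vtype B})
    (phi : vtype B -> vtype A) : colored_complex d :=
  ColoredComplex
    (([set inl @: (F : {set vtype A}) | F in faces A]
      :|: [set glue FB phi @: (F : {set vtype B}) | F in faces B])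
     :\ (inl @: FA))
    (fun z : vtype A + vtype B =>
       match z with inl x => color x | inr y => color y end).

(* phi matters on FB only, where it is a colour-preserving bijection onto FA. *)
Definition gluing_map (FA : {set vtype A}) (FB : {set vtype B})
    (phi : vtype B -> vtype A) : Prop :=
  [/\ {in FB &, injective phi}, phi @: FB = FA &
      {in FB, forall x, color (phi x) = color x}].

Definition is_balanced_connected_sum (C : colored_complex d) : Prop :=
  exists (FA : {set vtype A}) (FB : {set vtype B}) (phi : vtype B -> vtype A),
    [/\ facet (faces A) FA, facet (faces B) FB, gluing_map FA FB phi &
        colored_iso (connected_sum FA FB phi) C].

End ConnectedSum.

Inductive stacked_cross_polytopal (d : nat) : colored_complex d -> Prop :=
| stacked_cross A :
    colored_iso (cross_polytope d) A -> stacked_cross_polytopal A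
| stacked_sum A B C :
    stacked_cross_polytopal A -> stacked_cross_polytopal B ->
    is_balanced_connected_sum A B C -> stacked_cross_polytopal C.

(* Main.v *)
Require Import Defs.
From mathcomp Require Import all_boot all_order all_algebra zify lra.

(** For three colours T let Delta_T be the subcomplex on the vertices with
    colours in T.  It is a union of closed surfaces (links of faces of colour
    T^c) glued along triangles.  In a closed surface a vertex set A that misses
    a triangle meets at least 3|A| edges: up to counting triangles this is the
    Euler inequality |A| - e + t <= 1 over F_2.  This "Gromov rigidity" survives
    gluing along a triangle, so e(Delta_T) >= 3 n(Delta_T) - 6.  Summing over T
    gives gbar_2 >= 0, and gbar_2 = 0 forces equality for every T and for every
    link, and forces every clique with fewer than d vertices to be a face.

    If some d-clique tau is missing, the facets can be 2-coloured so that the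
    colour changes exactly across the ridges contained in tau.  For
    2-dimensional links this is a Jordan curve theorem read off from the
    equality case; passing from the links of G + x to the link of G, a failure
    would yield a connected double cover with twice as many vertices and edges,
    against the lower bound.  The two colour classes, capped by tau, are smaller
    complexes of the same kind whose balanced connected sum is Delta.

    If there is no missing d-clique, a vertex of degree 4 in a 2-dimensional
    link produces two vertices of the same colour whose links meet in too many
    edges unless they coincide; hence each colour class has two vertices and
    Delta is the cross-polytope. *)

Set Implicit Arguments.
Unset Strict Implicit.
Unset Printing Implicit Defensive.

(** * Surfaces *)

(** Everything is done with families of facets [Phi], and connectivity enters only through [pseudo]:
    any two facets over a common face are joined by ridge steps over that face. This is what
    normality provides; it passes to links and turns every propagation argument into an induction
    along ridges. The constants come from e = 3n - 6 for triangulated spheres. Let n_T and e_T count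
    vertices and edges of Delta_T. A vertex lies in C(d-1,2) of these complexes and an edge in d-2
    of them, so the sum of e_T - 3 n_T + 6 over all T is (d-2)/2 times gbar_2. The surfaces that
    occur may a priori have any genus; the F_2 rank bound is an inequality valid for all of them.
    The main obstacle is that the separation by a missing facet is visible only in surfaces and has
    to be lifted to larger links without homology theory. Hence the potentials: functions on facets
    with prescribed changes across ridges, whose failure to exist is a connected double cover. *)

Section F2Rank.
Import GRing.Theory.
Local Open Scope ring_scope.

Lemma natr_F2_eq0 (n : nat) : (n%:R == 0 :> 'F_2) = ~~ odd n.
Proof.
by rewrite -(@dvdn_pcharf _ 2 (pchar_Fp (isT : prime 2))) dvdn2.
Qed.

Lemma F2_bool (x : 'F_2) : x = (x != 0)%:R.
Proof. by case: x => [[|[|m]] Hm]; apply/val_inj. Qed.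

Lemma natr_card_set (K : finType) (A : {set K}) (P : pred K) :
  (#|[set k in A | P k]|)%:R = \sum_(k in A) (P k)%:R :> 'F_2.
Proof.
rewrite -sum1_card natr_sum (eq_bigl (fun k => (k \in A) && P k)).
  by rewrite big_mkcondr; apply: eq_bigr => k _; case: (P k).
by move=> k; rewrite !inE.
Qed.

(* Rank-nullity for two composable incidence matrices over F_2, with the
   vectors of F_2 written as sets. *)
Lemma F2_rank_bound (I J K : finType) (T : {set I}) (E : {set J})
    (A : {set K}) (r : I -> J -> bool) (q : J -> K -> bool) :
  (forall i k, i \in T -> k \in A ->
     ~~ odd #|[set j in E | r i j && q j k]|) ->
  (forall Y : {set I}, Y \subset T ->
     (forall j, j \in E -> ~~ odd #|[set i in Y | r i j]|) ->
     Y = set0 \/ Y = T) ->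
  (forall Z : {set K}, Z \subset A ->
     (forall j, j \in E -> ~~ odd #|[set k in Z | q j k]|) -> Z = set0) ->
  (#|T| + #|A| <= #|E| + 1)%N.
Proof.
move=> Hprod HY HZ.
pose D2 : 'M['F_2]_(#|T|, #|E|) := \matrix_(i, j) (r (enum_val i) (enum_val j))%:R.
pose D1 : 'M['F_2]_(#|E|, #|A|) := \matrix_(j, k) (q (enum_val j) (enum_val k))%:R.
have D21 : D2 *m D1 = 0.
  apply/matrixP=> i k; rewrite !mxE.
  transitivity ((#|[set j in E | r (enum_val i) j && q j (enum_val k)]|)%:R : 'F_2).
    rewrite natr_card_set [RHS]big_enum_val; apply: eq_bigr => j _.
    by rewrite !mxE -natrM mulnb.
  by apply/eqP; rewrite natr_F2_eq0 Hprod // enum_valP.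
(* The hypothesis on [Z] says that no nonempty set of columns of [D1] sums to zero, which is full
   column rank. *)
have R1 : \rank D1 = #|A|.
  rewrite -mxrank_tr; apply/eqP; apply: inj_row_free => v Hv.
  pose Z := [set enum_val k | k in [set k | v 0 k != 0]].
  have ZA : Z \subset A by apply/subsetP=> _ /imsetP[k _ ->]; exact: enum_valP.
  have Z0 : Z = set0.
    apply: HZ => // j jE; rewrite -natr_F2_eq0; apply/eqP.
    have := congr1 (fun M : 'rV_#|E| => M 0 (enum_rank_in jE j)) Hv.
    rewrite !mxE => <-.
    rewrite natr_card_set big_imset /=; last by move=> a b _ _; exact: enum_val_inj.
    rewrite big_mkcond; apply: eq_bigr => k _.
    rewrite !mxE enum_rankK_in // inE {2}(F2_bool (v 0 k)).
    by case: (v 0 k != 0); case: (q _ _); rewrite ?mulr1 ?mulr0 ?mul0r.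
  apply/rowP=> k; rewrite mxE; apply/eqP; case: eqP => // /eqP nz.
  have : enum_val k \in Z by apply: imset_f; rewrite inE.
  by rewrite Z0 inE.
(* The only possible nontrivial relation between the rows of [D2] is the sum of all of them, so the
   left kernel has dimension at most 1. *)
have R2 : (#|T| <= \rank D2 + 1)%N.
  suff: (\rank (kermx D2) <= 1)%N by rewrite mxrank_ker; lia.
  apply: leq_trans (rank_leq_row (const_mx 1 : 'rV['F_2]_#|T|)).
  apply/mxrankS/rV_subP => v /sub_kermxP Hv.
  pose Y := [set enum_val k | k in [set k | v 0 k != 0]].
  have YT : Y \subset T by apply/subsetP=> _ /imsetP[k _ ->]; exact: enum_valP.
  have [Y0|Y1] : Y = set0 \/ Y = T.
  - apply: HY => // j jE; rewrite -natr_F2_eq0; apply/eqP.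
    have := congr1 (fun M : 'rV_#|E| => M 0 (enum_rank_in jE j)) Hv.
    rewrite !mxE => <-.
    rewrite natr_card_set big_imset /=; last by move=> a b _ _; exact: enum_val_inj.
    rewrite big_mkcond; apply: eq_bigr => k _.
    rewrite !mxE enum_rankK_in // inE {2}(F2_bool (v 0 k)).
    by case: (v 0 k != 0); case: (r _ _); rewrite ?mulr1 ?mulr0 ?mul0r.
  - suff -> : v = 0 by exact: sub0mx.
    apply/rowP=> k; rewrite mxE; apply/eqP; case: eqP => // /eqP nz.
    have : enum_val k \in Y by apply: imset_f; rewrite inE.
    by rewrite Y0 inE.
  - suff -> : v = const_mx 1 by exact: submx_refl.
    apply/rowP=> k; rewrite mxE (F2_bool (v 0 k)).
    have : enum_val k \in Y by rewrite Y1 enum_valP.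
    by case/imsetP=> k'; rewrite inE => nz /enum_val_inj ->; rewrite nz.
have := mulmx0_rank_max D21; rewrite R1; move: R2; lia.
Qed.

End F2Rank.

(* Connectedness of S under r, stated as an induction principle. *)
Definition linked (X : finType) (S : {set X}) (r : rel X) : Prop :=
  forall P : pred X,
    {in S &, forall x y, r x y -> P x -> P y} ->
    {in S &, forall x y, P x -> P y}.

(** * Pseudomanifolds as families of facets, and the Euler inequality for surfaces *)

Section Pseudo.
Variable V : finType.
Implicit Types (Phi S : {set {set V}}) (A B F G R Z s t e : {set V}).

Definition star Phi G : {set {set V}} := [set s in Phi | G \subset s].

Definition ridge_adj (d : nat) : rel {set V} := fun s t => #|s :&: t| == d.-1.

(** Only facets are recorded. The last condition is normality in its strong form: the star of every
    face is connected through ridges containing that face. For a set that is not a face the star is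
    empty and the condition is void. *)
Definition pseudo (d : nat) Phi : Prop :=
  [/\ forall s, s \in Phi -> #|s| = d,
      forall s R, s \in Phi -> R \subset s -> #|R| = d.-1 -> #|star Phi R| = 2 &
      forall G, linked (star Phi G) (ridge_adj d)].

Definition pairs S : {set {set V}} :=
  [set e : {set V} | (#|e| == 2) && [exists t in S, e \subset t]].

Definition meeting A S : {set {set V}} := [set t in S | 0 < #|t :&: A|].
Definition meeting1 A S : {set {set V}} := [set t in S | #|t :&: A| == 1].

Lemma pairsP S e :
  reflect (#|e| = 2 /\ exists2 t, t \in S & e \subset t) (e \in pairs S).
Proof.
rewrite inE; apply: (iffP andP) => [[/eqP-> /existsP[t /andP[tS et]]]|[-> [t tS et]]].
  by split=> //; exists t.
by split=> //; apply/existsP; exists t; rewrite tS.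
Qed.

Lemma coverP S x : reflect (exists2 t, t \in S & x \in t) (x \in cover S).
Proof. by apply: (iffP bigcupP) => [[t ? ?]|[t ? ?]]; exists t. Qed.

Lemma ridge_adj_sym d s t : ridge_adj d s t = ridge_adj d t s.
Proof. by rewrite /ridge_adj setIC. Qed.

Lemma pseudo_across d Phi s R : pseudo d Phi ->
  s \in Phi -> R \subset s -> #|R| = d.-1 ->
  exists s', [/\ s' \in Phi, s' != s, R \subset s' & star Phi R = [set s; s']].
Proof.
move=> [_ H2 _] sP Rs cR; have /eqP/cards2P[a [b [ab E]]] := H2 s R sP Rs cR.
have: s \in star Phi R by rewrite inE sP Rs.
have: a \in star Phi R by rewrite E !inE eqxx.
have: b \in star Phi R by rewrite E !inE eqxx orbT.
rewrite !inE => /andP[bP Rb] /andP[aP Ra]; rewrite -/(star _ _) => _.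
have: s \in [set a; b] by rewrite -E inE sP Rs.
rewrite !inE => /orP[]/eqP ->.
  by exists b; split; rewrite // eq_sym.
by exists a; split=> //; rewrite setUC.
Qed.

Lemma pseudo_adjI d Phi s s' : pseudo d Phi -> s \in Phi -> s' \in Phi ->
  ridge_adj d s s' -> 0 < d -> star Phi (s :&: s') = [set s; s'] /\ s' != s.
Proof.
move=> HP sP s'P /eqP a d0.
have n : s' != s.
  apply/eqP=> E; move: a; rewrite E setIid; case: HP => H _ _; rewrite H //; lia.
split=> //.
have [u [uP us Ru E]] := pseudo_across HP sP (subsetIl s s') a.
have: s' \in star Phi (s :&: s') by rewrite inE s'P subsetIr.
by rewrite E !inE (negPf n) /= => /eqP ->.
Qed.

Lemma adj_ridge d Phi s s' R : pseudo d Phi -> s \in Phi -> s' \in Phi ->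
  s' != s -> R \subset s -> R \subset s' -> #|R| = d.-1 -> s :&: s' = R.
Proof.
move=> [H _ _] sP s'P n Rs Rs' cR; apply/esym/eqP.
rewrite eqEcard subsetI Rs Rs' /= cR.
rewrite -ltnS; apply: leq_trans (leqSpred d).
rewrite -(H _ sP); apply: proper_card; rewrite properEneq subsetIl andbT.
apply/eqP => E; have ss : s \subset s' by rewrite -E subsetIr.
by move/negP: n; apply; rewrite eq_sym eqEcard ss !H //=.
Qed.

Lemma linked_eq (X : finType) (S : {set X}) (r : rel X) (P : pred X) :
  symmetric r -> linked S r ->
  {in S &, forall x y, r x y -> P x = P y} -> {in S &, forall x y, P x = P y}.
Proof.
move=> sr L H x y xS yS; apply/idP/idP.
  by apply: (L P) => // u v uS vS uv; rewrite (H u v).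
by apply: (L P) => // u v uS vS uv; rewrite (H u v).
Qed.

Lemma closed_adj_eq (X : finType) (S : {set X}) (r : rel X) (P : pred X) :
  symmetric r -> {in S &, forall x y, r x y -> P x -> P y} ->
  {in S &, forall x y, r x y -> P x = P y}.
Proof.
move=> sr H x y xS yS xy; apply/idP/idP; first exact: H.
by apply: H => //; rewrite sr.
Qed.

Section Surface.
Variable S : {set {set V}}.
Hypothesis surfS : pseudo 3 S.

Let card3 t : t \in S -> #|t| = 3. Proof. by case: surfS => H _ _; exact: H. Qed.

Let star_pair e : e \in pairs S -> #|star S e| = 2.
Proof. by case: surfS => _ H _ /pairsP[ce [t tS et]]; apply: (H t). Qed.

(** Double counting of incidences between triangles and edges meeting [A]. Each edge lies in two
    triangles; a triangle with exactly one vertex in [A] has two such edges, one with two or three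
    vertices in [A] has three. *)
Lemma surface_count A :
  2 * #|meeting A (pairs S)| + #|meeting1 A S| = 3 * #|meeting A S|.
Proof.
have loc t : t \in S ->
    #|[set e in meeting A (pairs S) | e \subset t]| + (#|t :&: A| == 1)
    = 3 * (0 < #|t :&: A|).
  move=> tS.
  have -> : [set e in meeting A (pairs S) | e \subset t] =
     [set e : {set V} | e \subset t & #|e| == 2]
       :\: [set e : {set V} | e \subset t :\: A & #|e| == 2].
    apply/setP=> e; rewrite !inE subsetD.
    case et: (e \subset t); rewrite ?andbF ?andbT //=.
    have -> : [exists u in S, e \subset u] by apply/existsP; exists t; rewrite tS.
    by case: (#|e| == 2); rewrite ?andbT ?andbF //= card_gt0 setI_eq0.
  rewrite cardsD (setIidPr _); last first.
    apply/subsetP=> e; rewrite !inE => /andP[H ->]; rewrite andbT.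
    exact: subset_trans H (subsetDl _ _).
  rewrite !cards_draws (card3 tS).
  have sum3 := cardsID A t; rewrite (card3 tS) in sum3.
  have le3 : #|t :&: A| <= 3 by rewrite -sum3 leq_addr.
  have -> : #|t :\: A| = 3 - #|t :&: A| by rewrite -sum3 addKn.
  by move: le3; case: #|t :&: A| => [|[|[|[|n]]]].
transitivity (\sum_(t in S) (#|[set e in meeting A (pairs S) | e \subset t]|
   + (#|t :&: A| == 1))).
  rewrite big_split /=; congr (_ + _); last first.
    rewrite -[LHS]sum1_card [LHS](eq_bigl (fun t => (t \in S) && (#|t :&: A| == 1))).
      by rewrite [LHS]big_mkcondr; apply: eq_bigr => t _; case: eqP.
    by move=> t; rewrite !inE.
  transitivity (\sum_(e in meeting A (pairs S)) #|star S e|).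
    rewrite (eq_bigr (fun=> 2)) ?sum_nat_const 1?mulnC //.
    by move=> e; rewrite inE => /andP[/star_pair].
  under eq_bigr => e _ do rewrite -sum1_card.
  under [RHS]eq_bigr => e _ do rewrite -sum1_card.
  rewrite (exchange_big_dep (fun t => t \in S)) /=; last first.
    by move=> e t _; rewrite inE => /andP[].
  apply: eq_bigr => t tS; apply: eq_bigl => e; rewrite !inE tS.
  by [].
rewrite (eq_bigr _ loc) -big_distrr /=; congr (3 * _).
rewrite -[RHS]sum1_card [RHS](eq_bigl (fun t => (t \in S) && (0 < #|t :&: A|))).
  by rewrite [RHS]big_mkcondr; apply: eq_bigr => t _; case: (0 < _).
by move=> t; rewrite !inE.
Qed.

(** Connectedness of the graph that the edges of [S] induce on [A], in the form in which a failure
    yields a splitting of [A] usable for induction. *)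
Definition unsplittable A := forall Z, Z \subset A ->
  (forall e, e \in pairs S -> 0 < #|e :&: Z| -> #|e :&: (A :\: Z)| = 0) ->
  Z = set0 \/ Z = A.

(** The rank bound applied to the F_2 chain complex of [S] relative to the part that avoids [A]:
    triangles meeting [A], edges meeting [A], vertices of [A]. Connectedness leaves only the full
    sum of triangles as a possible 2-cycle; together with the edge [e0] leaving [A] it kills the
    relation between the vertices. *)
Lemma surface_euler A e0 : A \subset cover S -> unsplittable A ->
  e0 \in pairs S -> #|e0 :&: A| = 1 ->
  #|meeting A S| + #|A| <= #|meeting A (pairs S)| + 1.
Proof.
move=> AS unA e0S e0A.
apply: (@F2_rank_bound _ _ _ _ _ _ (fun t e => e \subset t) (fun e a => a \in e)).
- move=> t a; rewrite inE => /andP[tS tA] aA.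
  have -> : [set e in meeting A (pairs S) | (e \subset t) && (a \in e)] =
     [set e : {set V} | e \subset t & #|e| == 2]
       :\: [set e : {set V} | e \subset t :\ a & #|e| == 2].
    apply/setP=> e; rewrite !inE subsetD1.
    case et: (e \subset t); rewrite ?andbF //=.
    have -> : [exists u in S, e \subset u] by apply/existsP; exists t; rewrite tS.
    case: (#|e| == 2); rewrite ?andbT ?andbF //=; rewrite negbK.
    case ae: (a \in e); rewrite ?andbF // andbT.
    by rewrite card_gt0; apply/set0Pn; exists a; rewrite inE ae.
  rewrite cardsD (setIidPr _); last first.
    apply/subsetP=> e; rewrite !inE => /andP[H ->]; rewrite andbT.
    exact: subset_trans H (subsetDl _ _).
  rewrite !cards_draws (card3 tS).
  have := cardsD1 a t; rewrite (card3 tS).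
  by case: (a \in t); [rewrite add1n => -[<-] | rewrite add0n => <-].
- move=> Y YT Yev.
  (* The common edge lies in these two triangles only, so the parity condition at it puts both or
     neither into [Y]. *)
  have Yadj t t' : t \in S -> t' \in S -> ridge_adj 3 t t' ->
      0 < #|t :&: t' :&: A| -> (t \in Y) = (t' \in Y).
    move=> tS t'S tt' mA.
    have [E n] := pseudo_adjI surfS tS t'S tt' isT.
    have eM : t :&: t' \in meeting A (pairs S).
      rewrite inE mA andbT; apply/pairsP; split; first exact/eqP.
      by exists t => //; exact: subsetIl.
    have := Yev _ eM.
    have -> : [set i in Y | t :&: t' \subset i] = [set t; t'] :&: Y.
      rewrite -E; apply/setP=> u; rewrite !inE.
      case uY: (u \in Y); rewrite ?andbF ?andbT //=.
      by have := subsetP YT u uY; rewrite inE => /andP[-> _].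
    case tY: (t \in Y); case t'Y: (t' \in Y) => //.
      have -> : [set t; t'] :&: Y = [set t].
        apply/setP=> u; rewrite !inE; case: eqP => [->|] //=.
        by case: eqP => [->|].
      by rewrite cards1.
    have -> : [set t; t'] :&: Y = [set t'].
      apply/setP=> u; rewrite !inE; case: (u =P t) => [->|] //=.
        by rewrite tY eq_sym (negPf n).
      by case: eqP => [->|].
    by rewrite cards1.
  have Ya a t t' : a \in A -> t \in star S [set a] -> t' \in star S [set a] ->
      (t \in Y) = (t' \in Y).
    move=> aA; case: surfS => _ _ /(_ [set a]) L tS t'S.
    apply: (linked_eq (P := fun t => t \in Y) (@ridge_adj_sym 3) L) => // u v.
    rewrite !inE !sub1set => /andP[uS au] /andP[vS av] uv; apply: Yadj => //.
    by rewrite card_gt0; apply/set0Pn; exists a; rewrite !inE au av.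
  (* By [Ya] a star at a vertex of [A] lies inside [Y] or avoids it, so any single triangle at [a]
     decides whether [a] is in [Z]; hence no edge joins [Z] to the rest of [A]. *)
  pose Z := [set a in A | star S [set a] \subset Y].
  have ZA : Z \subset A by apply/subsetP=> a; rewrite inE => /andP[].
  have inZ a t : a \in A -> t \in S -> a \in t -> (a \in Z) = (t \in Y).
    move=> aA tS at_; have st : t \in star S [set a] by rewrite inE tS sub1set.
    rewrite inE aA; apply/idP/idP => [/subsetP|tY]; first exact.
    by apply/subsetP=> u uS; rewrite -(Ya a t u).
  have [Z0|Z1] : Z = set0 \/ Z = A.
    apply: unA => // e /pairsP[ce [t tS et]] eZ; apply/eqP; rewrite cards_eq0.
    apply/eqP/setP=> b; rewrite !inE; apply/negP => /andP[be /andP[nb bA]].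
    move: eZ; rewrite card_gt0 => /set0Pn[a]; rewrite inE => /andP[ae aZ].
    have aA := subsetP ZA a aZ.
    case/negP: nb; move: aZ; rewrite (inZ a t) ?(subsetP et) // => tY.
    by have := inZ b t bA tS (subsetP et _ be); rewrite tY !inE.
  + left; apply/eqP; rewrite -subset0; apply/subsetP=> t tY.
    have := subsetP YT t tY; rewrite inE => /andP[tS]; rewrite card_gt0.
    case/set0Pn=> a; rewrite inE => /andP[at_ aA].
    by have := inZ a t aA tS at_; rewrite tY Z0 inE.
  + right; apply/eqP; rewrite eqEsubset YT; apply/subsetP=> t.
    rewrite inE => /andP[tS]; rewrite card_gt0.
    case/set0Pn=> a; rewrite inE => /andP[at_ aA].
    by rewrite -(inZ a t) // Z1.
- move=> Z ZA Zev.
  have Zadj e : e \in meeting A (pairs S) -> ~~ odd #|e :&: Z|.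
    by move/Zev; congr (~~ odd _); apply: eq_card => k; rewrite !inE andbC.
  have [//|E] : Z = set0 \/ Z = A.
    apply: unA => // e eS eZ.
    have eA : e \in meeting A (pairs S).
      by rewrite inE eS (leq_trans eZ) // subset_leq_card // setIS.
    have ev := Zadj e eA.
    have [ce _] := pairsP _ _ eS.
    have := cardsID Z e; rewrite ce.
    have : #|e :&: (A :\: Z)| <= #|e :\: Z|.
      by apply: subset_leq_card; rewrite setIDA; apply: setSD; exact: subsetIl.
    by move: eZ ev; case: #|e :&: Z| => [|[|[|n]]] //; lia.
  have e0M : e0 \in meeting A (pairs S) by rewrite inE e0S e0A.
  by have := Zadj e0 e0M; rewrite E e0A.
Qed.

End Surface.
End Pseudo.

(** * Rigidity of closed surfaces and its cases of equality *)

Section SurfaceRigidity.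
Variable V : finType.
Implicit Types (S U P : {set {set V}}) (A B Z s t e f tau : {set V}).

(** Avoiding some [t] is essential: a triangulated sphere has only 3n - 6 edges in all, so the full
    vertex set violates the bound. *)
Definition rigid U : Prop := forall A t, A \subset cover U -> t \in U ->
  #|t :&: A| = 0 -> 3 * #|A| <= #|meeting A (pairs U)|.

Lemma card_meetD A Z e : Z \subset A ->
  #|e :&: A| = #|e :&: Z| + #|e :&: (A :\: Z)|.
Proof.
move=> ZA; rewrite -(cardsID Z (e :&: A)) -setIA (setIidPr ZA).
by congr (_ + #|_|); rewrite setIDA.
Qed.

Lemma meeting_split A Z P : Z \subset A ->
  (forall e, e \in P -> 0 < #|e :&: Z| -> #|e :&: (A :\: Z)| = 0) ->
  #|meeting A P| = #|meeting Z P| + #|meeting (A :\: Z) P|.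
Proof.
move=> ZA H; rewrite -(cardsID (meeting Z P)); congr (_ + _).
  apply: eq_card => e; rewrite !inE; case eP: (e \in P) => //=.
  by rewrite (card_meetD _ ZA); lia.
apply: eq_card => e; rewrite !inE; case eP: (e \in P); rewrite ?andbF //=.
by have := H e eP; rewrite (card_meetD _ ZA); lia.
Qed.

Lemma meeting1_split A Z P : Z \subset A ->
  (forall e, e \in P -> 0 < #|e :&: Z| -> #|e :&: (A :\: Z)| = 0) ->
  #|meeting1 A P| = #|meeting1 Z P| + #|meeting1 (A :\: Z) P|.
Proof.
move=> ZA H; rewrite -(cardsID (meeting1 Z P)); congr (_ + _).
  apply: eq_card => e; rewrite !inE; case eP: (e \in P) => //=.
  by have := H e eP; rewrite (card_meetD _ ZA); lia.
apply: eq_card => e; rewrite !inE; case eP: (e \in P); rewrite ?andbF //=.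
by have := H e eP; rewrite (card_meetD _ ZA); lia.
Qed.

Lemma unsplittable_or_split S A : unsplittable S A \/ exists Z,
  [/\ Z \subset A, Z != set0, Z != A &
      forall e, e \in pairs S -> 0 < #|e :&: Z| -> #|e :&: (A :\: Z)| = 0].
Proof.
pose ok Z := (Z \subset A) &&
  [forall e in pairs S, (0 < #|e :&: Z|) ==> (#|e :&: (A :\: Z)| == 0)].
have okP Z : reflect ((Z \subset A) /\ forall e, e \in pairs S ->
    0 < #|e :&: Z| -> #|e :&: (A :\: Z)| = 0) (ok Z).
  apply: (iffP andP) => [[ZA /forallP H]|[ZA H]]; split=> //.
    by move=> e eS eZ; have := H e; rewrite eS eZ => /eqP.
  by apply/forallP=> e; apply/implyP => eS; apply/implyP => eZ; rewrite H.
case: (boolP [exists Z, ok Z && (Z != set0) && (Z != A)]) => [/existsP[Z]|N].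
  by case/andP=> /andP[/okP[ZA H] Z0 ZnA]; right; exists Z.
left=> Z ZA H; have okZ : ok Z by apply/okP.
move/existsPn/(_ Z): N; rewrite okZ /=.
by case: eqP => [|_]; [left | case: eqP => [|_] //; right].
Qed.

Section OneSurface.
Variable S : {set {set V}}.
Hypothesis surfS : pseudo 3 S.

Let card3 t : t \in S -> #|t| = 3. Proof. by case: surfS => H _ _; exact: H. Qed.

Let star_pair2 e : e \in pairs S -> #|star S e| = 2.
Proof. by case: surfS => _ H _ /pairsP[ce [t tS et]]; apply: (H t). Qed.

Lemma card_diff2 t A : t \in S -> #|t :&: A| = 1 -> #|t :\: A| = 2.
Proof. by move=> tS H; have := cardsID A t; rewrite H (card3 tS) add1n => -[]. Qed.

(** The sum of |t :&: A| over the triangles [t] at [b] counts, for each [a] in [A], the triangles on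
    the edge ab, which are none or two. The sum is therefore even, and since [b] is off [A] each
    term is 0, 1 or 2; the terms equal to 1 are even in number. *)
Lemma meeting1_parity A b :
  b \notin A -> ~~ odd #|[set t in meeting1 A S | b \in t]|.
Proof.
move=> bA.
have bound t : t \in star S [set b] ->
    #|t :&: A| = (#|t :&: A| == 1) + 2 * (#|t :&: A| == 2).
  rewrite inE sub1set => /andP[tS bt].
  have : #|t :&: A| <= #|t :\ b|.
    apply: subset_leq_card; rewrite subsetD1 subsetIl /=.
    by rewrite inE (negPf bA) andbF.
  have := cardsD1 b t; rewrite bt (card3 tS) add1n => -[<-].
  by case: #|t :&: A| => [|[|[|n]]].
have E1 : #|[set t in meeting1 A S | b \in t]| =
    \sum_(t in star S [set b]) (#|t :&: A| == 1).
  rewrite -sum1_card [LHS](eq_bigl (fun t => (t \in star S [set b]) && (#|t :&: A| == 1))).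
    by rewrite [LHS]big_mkcondr; apply: eq_bigr => t _; case: eqP.
  by move=> t; rewrite !inE sub1set -andbA [in RHS]andbAC andbA.
have E2 : \sum_(t in star S [set b]) #|t :&: A| =
    \sum_(a in A) #|[set t in star S [set b] | a \in t]|.
  under eq_bigr => t _ do rewrite -sum1_card.
  under [RHS]eq_bigr => t _ do rewrite -sum1_card.
  rewrite (exchange_big_dep (fun a => a \in A)) /=; last first.
    by move=> t a _; rewrite inE => /andP[].
  apply: eq_bigr => a aA; apply: eq_bigl => t.
  by rewrite [in RHS]inE [a \in _ :&: _]inE aA andbT.
have E3 : ~~ odd (\sum_(a in A) #|[set t in star S [set b] | a \in t]|).
  apply: (big_ind (fun n => ~~ odd n)) => // [m n|a aA].
    by rewrite oddD => /negPf-> /negPf->.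
  have -> : [set t in star S [set b] | a \in t] = star S [set a; b].
    by apply/setP=> t; rewrite !inE subUset !sub1set -andbA [(b \in t) && _]andbC.
  have [->|[t]] := set_0Vmem (star S [set a; b]); first by rewrite cards0.
  rewrite inE => /andP[tS abt]; case: surfS => _ H2 _; rewrite (H2 t) //.
  by rewrite cards2; case: eqP bA aA => // <- /negPf->.
move: E3; rewrite -E2 (eq_bigr _ bound) big_split /= -E1 -big_distrr /=.
by rewrite oddD oddM addbF.
Qed.

Lemma card_meet_le1 A t u : t \in S -> u \in S -> ridge_adj 3 t u ->
  #|t :&: A| = 0 -> #|u :&: A| <= 1.
Proof.
move=> tS uS tu tA.
have : #|u :&: A| <= #|u :\: t|.
  apply: subset_leq_card; apply/subsetP=> x; rewrite !inE => /andP[xu xA].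
  rewrite xu andbT; apply/negP => xt.
  by move/eqP: tA; rewrite cards_eq0 => /eqP/setP/(_ x); rewrite !inE xt xA.
by have := cardsID t u; rewrite (card3 uS) setIC (eqP tu); lia.
Qed.

(** On a walk through edges from [t0] to [t1], the first triangle that meets [A] shares two vertices
    with one that does not, so it meets [A] exactly once. *)
Lemma frontier A t0 t1 : t0 \in S -> #|t0 :&: A| = 0 -> t1 \in meeting A S ->
  exists s f, [/\ s \in meeting1 A S, f \in S, #|f :&: A| = 0 & ridge_adj 3 s f].
Proof.
move=> t0S t0A; rewrite inE => /andP[t1S t1A].
case: (boolP [exists s in meeting1 A S,
   [exists f in S, (#|f :&: A| == 0) && ridge_adj 3 s f]]).
  case/existsP=> s /andP[sM /existsP[f /and3P[fS /eqP fA sf]]].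
  by exists s, f.
move=> N; case: surfS => _ _ /(_ set0)/(_ (fun t => #|t :&: A| == 0)) L.
have {}L : #|t1 :&: A| == 0.
  apply: (L _ t0 t1); rewrite ?inE ?t0S ?t1S ?sub0set ?t0A //.
  move=> t u; rewrite !inE !sub0set !andbT => tS uS tu tA.
  have := card_meet_le1 tS uS tu (eqP tA).
  rewrite leq_eqVlt ltnS leqn0 => /orP[uA|//].
  case/existsPn/(_ u)/negP: N; rewrite inE uS uA /=.
  by apply/existsP; exists t; rewrite tS tA /= ridge_adj_sym.
by move: t1A; rewrite (eqP L).
Qed.

(** The edge b1b2 of [s0] opposite to [A] also lies on [f], which avoids [A]. By parity there is a
    second frontier triangle at [b1] and one at [b2]; were they equal, the edge b1b2 would lie in a
    third triangle. The full configuration is kept for the equality case in [surface_strict]. *)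
Lemma frontier3 A t0 t1 :
  t0 \in S -> #|t0 :&: A| = 0 -> t1 \in meeting A S ->
  exists s0 s1 s2 f b1 b2,
   [/\ [/\ s0 \in meeting1 A S, s1 \in meeting1 A S, s2 \in meeting1 A S & f \in S],
       #|f :&: A| = 0,
       [/\ s0 :\: A = [set b1; b2], s0 :&: f = [set b1; b2], b1 != b2 &
           star S [set b1; b2] = [set s0; f]],
       b1 \in s1 /\ b2 \in s2 & [/\ s1 != s0, s2 != s0 & s1 != s2]].
Proof.
move=> t0S t0A t1M; have [s [f [sM fS fA sf]]] := frontier t0S t0A t1M.
have := sM; rewrite inE => /andP[sS sA].
have sub : s :&: f \subset s :\: A.
  apply/subsetP=> x; rewrite !inE => /andP[xs xf]; rewrite xs andbT.
  apply/negP => xA; move/eqP: fA; rewrite cards_eq0 => /eqP/setP/(_ x).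
  by rewrite !inE xf xA.
have E : s :&: f = s :\: A.
  by apply/eqP; rewrite eqEcard sub (card_diff2 sS (eqP sA)) (eqP sf).
have /eqP/cards2P[b1 [b2 [b12 Eb]]] := card_diff2 sS (eqP sA).
have bnA b : b \in [set b1; b2] -> [/\ b \in s, b \in f & b \notin A].
  move=> H; have : b \in s :&: f by rewrite E Eb.
  have : b \in s :\: A by rewrite Eb.
  by rewrite in_setD in_setI => /andP[bA bs] /andP[_ bf].
have other b : b \in [set b1; b2] ->
    exists2 s', s' \in meeting1 A S & (b \in s') && (s' != s).
  case/bnA=> bs _ bA; have := meeting1_parity bA.
  rewrite (cardsD1 s) inE sM bs add1n /= negbK => o.
  have : 0 < #|[set t in meeting1 A S | b \in t] :\ s| by case: #|_| o.
  rewrite card_gt0 => /set0Pn[s']; rewrite in_setD1 => /andP[n]; rewrite inE => /andP[H1 H2].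
  by exists s' => //; rewrite H2.
have b1i : b1 \in [set b1; b2] by rewrite !inE eqxx.
have b2i : b2 \in [set b1; b2] by rewrite !inE eqxx orbT.
have [s1 s1M /andP[b1s1 s1s]] := other _ b1i.
have [s2 s2M /andP[b2s2 s2s]] := other _ b2i.
have [St _] := pseudo_adjI surfS sS fS sf isT.
exists s, s1, s2, f, b1, b2; split=> //.
  by split=> //; [rewrite E | rewrite -Eb -E].
split=> //; apply/eqP=> s12.
have : s1 \in star S (s :&: f).
  have := s1M; rewrite inE => /andP[s1S _].
  by rewrite E Eb inE s1S subUset !sub1set b1s1 s12 b2s2.
rewrite St !inE (negPf s1s) => /eqP sf1.
by move: s1M; rewrite sf1 inE fA andbF.
Qed.

Lemma meeting1_ge3 A t0 t1 :
  t0 \in S -> #|t0 :&: A| = 0 -> t1 \in meeting A S -> 3 <= #|meeting1 A S|.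
Proof.
move=> t0S t0A t1M.
have [s0 [s1 [s2 [f [b1 [b2 [[m0 m1 m2 _] _ _ _ [n1 n2 n12]]]]]]]] :=
  frontier3 t0S t0A t1M.
have <- : #|s0 |: [set s1; s2]| = 3.
  by rewrite cardsU1 cards2 in_set2 n12 negb_or ![s0 == _]eq_sym n1 n2.
by apply: subset_leq_card; rewrite !subUset !sub1set m0 m1.
Qed.

(** Three times the Euler inequality, with 3t replaced by 2e + t_1 from [surface_count], where t_1
    counts the frontier triangles. With t_1 at least 3 this is rigidity; any excess over 3 improves
    the bound. *)
Lemma surface_bound A e0 : A \subset cover S -> unsplittable S A ->
  e0 \in pairs S -> #|e0 :&: A| = 1 ->
  3 * #|A| + #|meeting1 A S| <= #|meeting A (pairs S)| + 3.
Proof.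
move=> AS uA e0S e0A.
by have := surface_euler surfS AS uA e0S e0A; have := surface_count surfS A; lia.
Qed.

Lemma crossing_pair A t : t \in meeting1 A S ->
  exists2 e, e \in pairs S & #|e :&: A| = 1.
Proof.
rewrite inE => /andP[tS /eqP tA].
have /eqP/cards1P[a Ea] := tA.
have /eqP/cards2P[b [c [bc Eb]]] := card_diff2 tS tA.
have : b \in t :\: A by rewrite Eb !inE eqxx.
have : a \in t :&: A by rewrite Ea inE.
rewrite !inE => /andP[at_ aA] /andP[bA bt].
exists [set a; b].
  apply/pairsP; split; last by exists t => //; rewrite subUset !sub1set at_.
  by rewrite cards2; case: eqP bA aA => // -> /negPf->.
have -> : [set a; b] :&: A = [set a].
  apply/setP=> x; rewrite !inE; case: eqP => [->|_] //=.
  by case: eqP => [->|]; rewrite ?(negPf bA).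
by rewrite cards1.
Qed.

Lemma cover_meeting A a : A \subset cover S -> a \in A ->
  exists2 t, t \in meeting A S & a \in t.
Proof.
move=> /subsetP AS aA; have /coverP[t tS at_] := AS _ aA.
exists t => //; rewrite inE tS card_gt0; apply/set0Pn; exists a.
by rewrite inE at_.
Qed.

Lemma surface_rigid : rigid S.
Proof.
move=> A t0; have [n] := ubnP #|A|; elim: n A => // n IH A An AS t0S t0A.
have [->|[a aA]] := set_0Vmem A; first by rewrite cards0.
have [t1 t1M _] := cover_meeting AS aA.
have [uA|[Z [ZA Z0 ZnA H]]] := unsplittable_or_split S A.
  have [s [f [sM _ _ _]]] := frontier t0S t0A t1M.
  have [e eS eA] := crossing_pair sM.
  by have := surface_bound AS uA eS eA; have := meeting1_ge3 t0S t0A t1M; lia.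
have cZ : 0 < #|Z| by rewrite card_gt0.
have pZ : #|Z| < #|A| by rewrite proper_card // properEneq ZnA.
have cA : #|A| = #|Z| + #|A :\: Z| by rewrite -(cardsID Z) (setIidPr ZA).
have := card_meetD t0 ZA; rewrite t0A (meeting_split ZA H) => /esym/eqP.
rewrite addn_eq0 => /andP[/eqP t0Z /eqP t0D].
have := IH Z (leq_trans pZ An) (subset_trans ZA AS) t0S t0Z.
have pD : #|A :\: Z| < n by lia.
have := IH _ pD (subset_trans (subsetDl _ _) AS) t0S t0D.
by lia.
Qed.

Lemma pair_with (E : {set V}) b :
  #|E| = 2 -> b \in E -> exists2 x, x != b & E = [set b; x].
Proof.
move=> /eqP/cards2P[u [v [uv ->]]]; rewrite !inE => /orP[]/eqP ->.
  by exists v; rewrite // eq_sym.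
by exists u => //; rewrite setUC.
Qed.

(** If a connected [A] gave equality, it would have just three frontier triangles, and their edges
    off [A] would form a triangle. That triangle is not missing, so it is the only one off [A] and
    equals [t0]. Then every edge at [b] already meets [A], so adding [b] gains no edge, and rigidity
    of [b |: A] gives the strict bound. For a disconnected [A] one strict part suffices. *)
Lemma surface_strict A t0 b :
  (forall t, #|t| = 3 -> (forall e, e \subset t -> #|e| = 2 -> e \in pairs S) ->
     t \in S) ->
  A \subset cover S -> A != set0 -> t0 \in S -> #|t0 :&: A| = 0 ->
  b \in cover S -> b \notin A -> b \notin t0 ->
  3 * #|A| < #|meeting A (pairs S)|.
Proof.
move=> noMiss; have [n] := ubnP #|A|.
elim: n A => // n IH A An AS A0 t0S t0A bS bA bt0.
have /set0Pn[a aA] := A0.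
have [t1 t1M _] := cover_meeting AS aA.
have [uA|[Z [ZA Z0 ZnA H]]] := unsplittable_or_split S A; last first.
  have cZ : 0 < #|Z| by rewrite card_gt0.
  have pZ : #|Z| < #|A| by rewrite proper_card // properEneq ZnA.
  have cA : #|A| = #|Z| + #|A :\: Z| by rewrite -(cardsID Z) (setIidPr ZA).
  have := card_meetD t0 ZA; rewrite t0A (meeting_split ZA H) => /esym/eqP.
  rewrite addn_eq0 => /andP[/eqP t0Z /eqP t0D].
  have := surface_rigid (subset_trans (subsetDl A Z) AS) t0S t0D.
  have bZ : b \notin Z by apply: contra bA; exact: (subsetP ZA).
  have := IH Z (leq_trans pZ An) (subset_trans ZA AS) Z0 t0S t0Z bS bZ bt0.
  by rewrite cA mulnDr -addSn => h1 h2; exact: leq_add.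
have [s0 [s1 [s2 [f [b1 [b2 [[m0 m1 m2 fS] fA [D0 I0 b12 St] [b1s1 b2s2] [n1 n2 n12]]]]]]]] :=
  frontier3 t0S t0A t1M.
have [e eS eA] := crossing_pair m0.
have bd := surface_bound AS uA eS eA.
have ge3 := meeting1_ge3 t0S t0A t1M.
(* A fourth frontier triangle already makes [surface_bound] strict. *)
have [|le3] := ltnP 3 #|meeting1 A S|; first by move: bd; clear; lia.
have M1E : meeting1 A S = s0 |: [set s1; s2].
  apply/esym/eqP; rewrite eqEcard !subUset !sub1set m0 m1 m2 /=.
  by rewrite cardsU1 cards2 in_set2 n12 negb_or ![s0 == _]eq_sym n1 n2.
have M1P s : s \in meeting1 A S -> s \in S /\ #|s :&: A| = 1.
  by rewrite inE => /andP[-> /eqP].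
have M1f : f \notin meeting1 A S by rewrite inE fA andbF.
have nA z : z \in [set b1; b2] -> z \notin A by rewrite -D0 inE => /andP[].
have b1A : b1 \notin A by apply: nA; rewrite !inE eqxx.
have b2A : b2 \notin A by apply: nA; rewrite !inE eqxx orbT.
have [s1S s1A] := M1P _ m1; have [s2S s2A] := M1P _ m2.
have [|x xb1 D1] := pair_with (card_diff2 s1S s1A) (_ : b1 \in _).
  by rewrite inE b1A.
have : x \in s1 :\: A by rewrite D1 !inE eqxx orbT.
rewrite inE => /andP[xA xs1].
have xb2 : x != b2.
  apply/eqP=> xb2; have : s1 \in star S [set b1; b2].
    by rewrite inE s1S subUset !sub1set b1s1 -xb2.
  rewrite St !inE (negPf n1) => /eqP s1f.
  by rewrite -s1f m1 in M1f.
(* Parity at [x] calls for another frontier triangle besides [s1]; [s0] does not contain [x], so it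
   is [s2]. *)
have xs2 : x \in s2.
  have := meeting1_parity xA; rewrite (cardsD1 s1) inE m1 xs1 add1n /= negbK => o.
  have : 0 < #|[set t in meeting1 A S | x \in t] :\ s1| by case: #|_| o.
  rewrite card_gt0 => /set0Pn[s']; rewrite in_setD1 inE M1E in_setU1 in_set2.
  case/and3P=> s's1 /or3P[]/eqP E; rewrite E ?eqxx in s's1 * => //.
  move=> xs0; have : x \in s0 :\: A by rewrite inE xs0 xA.
  by rewrite D0 !inE (negPf xb1) (negPf xb2).
pose tri := x |: [set b1; b2].
have triE e' : e' \subset tri -> #|e'| = 2 ->
    (exists2 s, s \in meeting1 A S & e' \subset s).
  move=> e't ce; have [z zt ze] : exists2 z, z \in tri & z \notin e'.
    apply/subsetPn; apply: contraL (eqxx 2) => /subset_leq_card.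
    by rewrite ce cardsU1 cards2 b12 in_set2 negb_or xb1 xb2.
  have sub : e' \subset tri :\ z by rewrite subsetD1 e't.
  move: zt; rewrite !inE => /or3P[]/eqP zE; [exists s0|exists s2|exists s1] => //;
    apply: subset_trans sub _; apply/subsetP=> w; rewrite !inE zE => /andP[/negPf->] /=.
  - move=> wb; have : w \in s0 :\: A by rewrite D0 !inE.
    by rewrite inE => /andP[].
  - by case/orP=> /eqP->.
  - by rewrite orbF => /orP[]/eqP->.
have triS : tri \in S.
  apply: noMiss => [|e' e't ce].
    by rewrite cardsU1 cards2 b12 in_set2 negb_or xb1 xb2.
  have [s sM es] := triE e' e't ce; apply/pairsP; split=> //; exists s => //.
  by case: (M1P s sM).
have fE : f = tri.
  have : tri \in star S [set b1; b2] by rewrite inE triS subsetUr.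
  rewrite St !inE => /orP[]/eqP // E0.
  have [_ s0A] := M1P _ m0; move: s0A; rewrite -E0.
  have -> : tri :&: A = set0.
    apply/setP=> w; rewrite !inE; apply/negP => /andP[/or3P[]/eqP->];
    by apply/negP.
  by rewrite cards0.
have M1D s : s \in meeting1 A S -> s :\: A \subset f.
  rewrite fE M1E in_setU1 in_set2 => /or3P[]/eqP ->.
  - by rewrite D0 subsetUr.
  - by rewrite D1 subUset !sub1set !inE !eqxx !orbT.
  - have [|z zx D2] := pair_with (card_diff2 s2S s2A) (_ : x \in _).
      by rewrite inE xA.
    have : b2 \in s2 :\: A by rewrite inE b2A.
    rewrite D2 !inE eq_sym (negPf xb2) => /eqP <-.
    by rewrite subUset !sub1set !inE !eqxx !orbT.
have starS t u : t \in S -> u \in S -> ridge_adj 3 t u -> star S (t :&: u) = [set t; u].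
  by move=> tS uS tu; case: (pseudo_adjI surfS tS uS tu isT).
(* From a triangle off [A] other than [f], no step can reach a frontier triangle, whose edge off [A]
   already lies on [f], nor [f] itself, all of whose edges lie on frontier triangles. Connectedness
   excludes such a triangle. *)
have uniq t : t \in S -> #|t :&: A| = 0 -> t = f.
  move=> tS tA; apply/eqP; apply/negPn/negP => tf.
  case: surfS => _ _ /(_ set0)/(_ (fun t => (#|t :&: A| == 0) && (t != f))) L.
  suff: (#|f :&: A| == 0) && (f != f) by rewrite eqxx andbF.
  apply: (L _ t f); rewrite ?inE ?tS ?fS ?sub0set ?tA ?tf //.
  move=> {tS tA tf}t u; rewrite !inE !sub0set !andbT => tS uS tu /andP[/eqP tA tf].
  have := card_meet_le1 tS uS tu tA; rewrite leq_eqVlt ltnS leqn0 => /orP[uA1|uA0].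
    have uM : u \in meeting1 A S by rewrite inE uS uA1.
    have sub : t :&: u \subset u :\: A.
      apply/subsetP=> w; rewrite !inE => /andP[wt ->]; rewrite andbT; apply/negP => wA.
      by move/eqP: tA; rewrite cards_eq0 => /eqP/setP/(_ w); rewrite !inE wt wA.
    have : f \in star S (t :&: u) by rewrite inE fS (subset_trans sub (M1D _ uM)).
    rewrite starS // !inE eq_sym (negPf tf) => /eqP fu.
    by rewrite fu uM in M1f.
  rewrite uA0; apply/eqP => uf; subst u.
  have [|//|s sM es] := triE (t :&: f); first by rewrite -fE subsetIr.
    exact/eqP.
  have [sS sA] := M1P _ sM.
  have : s \in star S (t :&: f) by rewrite inE sS.
  rewrite starS // !inE => /orP[]/eqP E; move: sA; rewrite E ?tA //.
  by rewrite (eqP uA0).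
have t0f := uniq t0 t0S t0A; rewrite t0f in bt0.
(* An edge off [A] lies in [f] or is opposite to [A] in a frontier triangle, hence is contained in
   [f] anyway; but [b] is not in [f]. *)
have Eb : meeting (b |: A) (pairs S) = meeting A (pairs S).
  apply/setP=> e'; rewrite in_set [RHS]in_set; case e'S: (e' \in pairs S) => //=.
  apply/idP/idP => [|H]; last first.
    by apply: leq_trans H (subset_leq_card _); rewrite setIS // subsetUr.
  move/pairsP: e'S => [ce [t tS et]].
  rewrite !lt0n => H; apply/negP => e'A.
  have tf : t != f.
    apply/eqP=> tf; case/negP: H; rewrite cards_eq0 setIUr setU_eq0.
    rewrite -cards_eq0 in e'A *; rewrite -[e' :&: A == _]cards_eq0 e'A andbT.
    rewrite cards_eq0; apply/eqP/setP=> w; rewrite !inE; apply/negP=> /andP[we /eqP wb].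
    by case/negP: bt0; rewrite -tf -wb (subsetP et).
  have tA : #|t :&: A| != 0 by apply: contraNN tf => /eqP /(uniq _ tS)->.
  have etA : e' \subset t :\: A.
    apply/subsetP=> w we; rewrite inE (subsetP et) // andbT; apply/negP=> wA.
    by move: e'A; rewrite cards_eq0 => /eqP/setP/(_ w); rewrite !inE we wA.
  have tM : t \in meeting1 A S.
    rewrite inE tS; have := subset_leq_card etA; rewrite ce.
    have := cardsID A t; rewrite (card3 tS).
    by move: tA; clear; case: #|t :&: A| => [|[|k]] //=; lia.
  have ef := subset_trans etA (M1D _ tM).
  case/negP: H; rewrite cards_eq0 setIUr setU_eq0.
  rewrite cards_eq0 in e'A; rewrite e'A andbT.
  apply/eqP/setP=> w; rewrite !inE; apply/negP=> /andP[we /eqP wb].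
  by case/negP: bt0; rewrite -wb (subsetP ef).
have := @surface_rigid (b |: A) f; rewrite Eb cardsU1 bA => rg.
suff: 3 * (true + #|A|) <= #|meeting A (pairs S)| by clear; lia.
apply: rg => //; first by rewrite subUset sub1set bS.
apply/eqP; rewrite cards_eq0 setIUr setU_eq0 -[f :&: A == _]cards_eq0 fA andbT.
by apply/eqP/setP=> w; rewrite !inE; apply/negP=> /andP[wf /eqP wb]; rewrite -wb wf in bt0.
Qed.

(** Let [A] be the set of vertices off [tau]. Tightness leaves at most 3|A| edges meeting [A], while
    [A] has six frontier triangles; [surface_bound] would need 3|A| + 3 edges if [A] were connected.
    So [A] splits, each part has exactly three frontier triangles, and the parts are the two sides
    of [tau]. *)
Lemma surface_jordan tau : #|pairs S| + 6 <= 3 * #|cover S| ->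
  #|tau| = 3 -> (forall e, e \subset tau -> #|e| = 2 -> e \in pairs S) ->
  tau \notin S ->
  exists y : {set V} -> bool, {in S &, forall t t', ridge_adj 3 t t' ->
     y t (+) y t' = (t :&: t' \subset tau)}.
Proof.
move=> tight c3 edg nS.
have tauC : tau \subset cover S.
  apply/subsetP=> x xt.
  have /set0Pn[z] : tau :\ x != set0.
    by rewrite -card_gt0; have := cardsD1 x tau; rewrite xt c3 add1n => -[<-].
  rewrite in_setD1 => /andP[zx zt].
  have /pairsP[_ [t tS /subsetP xzt]] : [set x; z] \in pairs S.
    by apply: edg; rewrite ?subUset ?sub1set ?xt // cards2 eq_sym zx.
  by apply/coverP; exists t => //; apply: xzt; rewrite !inE eqxx.
pose A := cover S :\: tau.
have cA : #|cover S| = 3 + #|A| by rewrite -(cardsID tau) (setIidPr tauC) c3.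
have AC : A \subset cover S by exact: subsetDl.
have tAtau t : t \in S -> #|t :&: A| + #|t :&: tau| = 3.
  move=> tS; rewrite -(card3 tS) -(cardsID tau t) addnC.
  suff -> : t :&: A = t :\: tau by [].
  apply/setP=> x; rewrite !inE; case xt: (x \in t); rewrite ?andbF //= andbT.
  by have -> : x \in cover S; [apply/coverP; exists t | rewrite andbT].
have le2 t : t \in S -> #|t :&: tau| <= 2.
  move=> tS; rewrite leqNgt; apply/negP => H; case/negP: nS.
  suff <- : t = tau by [].
  apply/eqP; rewrite eqEcard (card3 tS) c3 andbT.
  apply/setIidPl/eqP; rewrite eqEcard subsetIl (card3 tS); exact: H.
(* A triangle meets [A] once exactly when it contains an edge of [tau]; each of the three edges lies
   in two triangles. *)
have M6 : #|meeting1 A S| = 6.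
  transitivity (\sum_(t in S) 'C(#|t :&: tau|, 2)).
    rewrite -[LHS]sum1_card [LHS](eq_bigl (fun t => (t \in S) && (#|t :&: A| == 1))).
      rewrite [LHS]big_mkcondr; apply: eq_bigr => t tS.
      have := tAtau t tS; have := le2 t tS.
      by case: #|t :&: tau| => [|[|[|n]]] // _; case: #|t :&: A| => [|[|[|[|k]]]].
    by move=> t; rewrite !inE.
  transitivity (\sum_(e in [set e : {set V} | e \subset tau & #|e| == 2]) #|star S e|).
    under eq_bigr => t _ do rewrite -cards_draws -sum1_card.
    under [RHS]eq_bigr => e _ do rewrite -sum1_card.
    rewrite (exchange_big_dep (fun e : {set V} => (e \subset tau) && (#|e| == 2))) /=.
      rewrite [RHS](eq_bigl (fun e : {set V} => (e \subset tau) && (#|e| == 2))); last first.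
        by move=> e; rewrite inE.
      apply: eq_bigr => e /andP[et ce]; apply: eq_bigl => t.
      by rewrite !inE subsetI et ce !andbT.
    by move=> t e _; rewrite inE subsetI => /andP[/andP[_ ->] ->].
  rewrite (eq_bigr (fun=> 2)) => [|e].
    by rewrite sum_nat_const cards_draws c3.
  by rewrite inE => /andP[et /eqP ce]; apply: star_pair2; exact: edg.
have EA : #|meeting A (pairs S)| + 3 <= #|pairs S|.
  have <- : #|[set e : {set V} | e \subset tau & #|e| == 2]| = 3.
    by rewrite cards_draws c3.
  rewrite -(cardsID [set e : {set V} | e \subset tau & #|e| == 2] (pairs S)).
  rewrite addnC (setIidPr _) ?leq_add2l; last first.
    by apply/subsetP=> e; rewrite inE => /andP[et /eqP]; exact: edg.
  apply: subset_leq_card; apply/subsetP=> e.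
  rewrite inE => /andP[eS eA]; rewrite inE eS andbT inE.
  apply: contraL eA => /andP[et _]; rewrite -eqn0Ngt cards_eq0.
  apply/eqP/setP=> x; rewrite !inE; apply/negP=> /andP[/(subsetP et)->].
  by [].
have /set0Pn[t1 t1M] : meeting1 A S != set0 by rewrite -card_gt0 M6.
have [e eS eA] := crossing_pair t1M.
have [uA|[Z [ZA Z0 ZnA H]]] := unsplittable_or_split S A.
  have := surface_bound AC uA eS eA; move: EA tight; rewrite M6 cA; clear; lia.
have HS t : t \in S -> 0 < #|t :&: Z| -> #|t :&: (A :\: Z)| = 0.
  move=> tS; rewrite card_gt0 => /set0Pn[a]; rewrite inE => /andP[at_ aZ].
  apply/eqP; rewrite cards_eq0; apply/eqP/setP=> b; rewrite !inE.
  apply/negP => /andP[bt /andP[bZ bA]].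
  have abS : [set a; b] \in pairs S.
    apply/pairsP; split; last by exists t => //; rewrite subUset !sub1set at_.
    by rewrite cards2; case: eqP bZ => // <-; rewrite aZ.
  have : #|[set a; b] :&: (A :\: Z)| = 0.
    apply: H => //; rewrite card_gt0; apply/set0Pn; exists a.
    by rewrite !inE eqxx aZ.
  move/eqP; rewrite cards_eq0 => /eqP/setP/(_ b).
  by move: bA; rewrite !inE eqxx orbT bZ /= => ->.
have HS' t : t \in S -> 0 < #|t :&: (A :\: Z)| -> #|t :&: Z| = 0.
  move=> tS; case E: #|t :&: Z| => [//|n].
  by rewrite HS ?E.
have /set0Pn[a aZ] := Z0.
have /set0Pn[b bD] : A :\: Z != set0.
  by rewrite -subset0 subDset setU0; apply: contra ZnA => ?; rewrite eqEsubset ZA.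
have [ta] := cover_meeting (subset_trans ZA AC) aZ.
rewrite inE => /andP[taS taZ] _.
have [tb] := cover_meeting (subset_trans (subsetDl A Z) AC) bD.
rewrite inE => /andP[tbS tbD] _.
have gZ : 3 <= #|meeting1 Z S|.
  by apply: (meeting1_ge3 tbS (HS' _ tbS tbD) (_ : ta \in _)); rewrite inE taS.
have gD : 3 <= #|meeting1 (A :\: Z) S|.
  by apply: (meeting1_ge3 taS (HS _ taS taZ) (_ : tb \in _)); rewrite inE tbS.
have := meeting1_split ZA HS; rewrite M6 => sp.
have eZ : #|meeting1 Z S| = 3 by move: sp gZ gD; clear; lia.
have eD : #|meeting1 (A :\: Z) S| = 3 by move: sp gZ gD; clear; lia.
(* The two triangles on an edge of [tau] lie on different sides. Otherwise, by parity at the ends of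
   that edge, the third frontier triangle of the side avoids both ends, yet it has two vertices in
   the three-element set [tau]. *)
have no2 (W : {set V}) t t' : W \subset A -> #|meeting1 W S| = 3 ->
    (forall u, u \in meeting1 W S -> u \in meeting1 A S) ->
    t \in meeting1 W S -> t' \in meeting1 W S -> t != t' ->
    #|t :&: t' :&: tau| = 2 -> False.
  move=> WA cW WM tM t'M tt' c2.
  have [s sM] : exists s, s \in meeting1 W S :\ t :\ t'.
    apply/set0Pn; rewrite -card_gt0.
    have h1 := cardsD1 t (meeting1 W S); have h2 := cardsD1 t' (meeting1 W S :\ t).
    have t'D : t' \in meeting1 W S :\ t by rewrite in_setD1 eq_sym tt'.
    by move: h1; rewrite h2 cW tM t'D; case: #|_|.
  move: sM; rewrite !in_setD1 => /and3P[st' st sM].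
  have WE : meeting1 W S = s |: [set t; t'].
    apply/esym/eqP; rewrite eqEcard !subUset !sub1set sM tM t'M cW /=.
    by rewrite cardsU1 cards2 in_set2 negb_or st st' tt'.
  have out x : x \in t :&: t' :&: tau -> x \notin s.
    rewrite !inE => /andP[/andP[xt xt'] xtau]; apply/negP => xs.
    have xW : x \notin W.
      by apply: contraL xtau => /(subsetP WA); rewrite inE => /andP[].
    have := meeting1_parity xW.
    suff -> : [set u in meeting1 W S | x \in u] = meeting1 W S by rewrite cW.
    apply/setP=> u; rewrite inE; case uM: (u \in meeting1 W S) => //=.
    by move: uM; rewrite WE in_setU1 in_set2 => /or3P[]/eqP->.
  have := WM _ sM; rewrite inE => /andP[sS /eqP sA].
  have := tAtau s sS; rewrite sA add1n => -[c2s].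
  have : #|s :&: tau| + #|t :&: t' :&: tau| <= #|tau|.
    have I0 : s :&: tau :&: (t :&: t' :&: tau) = set0.
      apply/setP=> x; rewrite in_set0 in_setI; apply/negP=> /andP[].
      by rewrite in_setI => /andP[xs _] /out; rewrite xs.
    rewrite -cardsUI I0 cards0 addn0.
    by apply: subset_leq_card; rewrite subUset !subsetIr.
  by rewrite c2s c2 c3.
exists (fun t => 0 < #|t :&: Z|) => t t' tS t'S tt'.
have [_ n] := pseudo_adjI surfS tS t'S tt' isT.
case: (boolP (t :&: t' \subset tau)) => [sub|/subsetPn[x]]; last first.
  rewrite inE => /andP[xt xt'] xtau.
  have xA : x \in A by rewrite inE xtau; apply/coverP; exists t.
  have [xZ|xZ] := boolP (x \in Z).
    have -> : 0 < #|t :&: Z| by rewrite card_gt0; apply/set0Pn; exists x; rewrite inE xt.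
    have -> // : 0 < #|t' :&: Z| by rewrite card_gt0; apply/set0Pn; exists x; rewrite inE xt'.
  by rewrite !HS' // card_gt0; apply/set0Pn; exists x; rewrite in_setI in_setD xA xZ ?xt ?xt'.
have c2 : #|t :&: t' :&: tau| = 2 by rewrite (setIidPl sub); exact/eqP.
have one u : u \in S -> t :&: t' \subset u -> #|u :&: A| = 1.
  move=> uS su; have : #|t :&: t' :&: tau| <= #|u :&: tau|.
    by apply: subset_leq_card; apply: setSI.
  by rewrite c2; have := tAtau u uS; have := le2 u uS; clear; lia.
have tA := one t tS (subsetIl _ _); have t'A := one t' t'S (subsetIr _ _).
have := card_meetD t ZA; have := card_meetD t' ZA; rewrite tA t'A.
have sub1 u : u \in meeting1 Z S -> u \in meeting1 A S.
  rewrite !inE => /andP[uS /eqP uZ]; rewrite uS (card_meetD _ ZA) uZ HS //.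
  by rewrite uZ.
have sub2 u : u \in meeting1 (A :\: Z) S -> u \in meeting1 A S.
  rewrite !inE => /andP[uS /eqP uZ]; rewrite uS (card_meetD _ ZA) uZ HS' //.
  by rewrite uZ.
case Et: #|t :&: Z| => [|k]; case Et': #|t' :&: Z| => [|k'] //= h' h.
  exfalso; apply: (no2 _ t t' (subsetDl A Z) eD sub2) => //.
  - by rewrite inE tS -[#|_|]add0n -h.
  - by rewrite inE t'S -[#|_|]add0n -h'.
  - by rewrite eq_sym.
exfalso; apply: (no2 _ t t' ZA eZ sub1) => //.
- by rewrite inE tS Et; move: h; rewrite addSn => -[/esym/eqP]; rewrite addn_eq0 => /andP[/eqP->].
- by rewrite inE t'S Et'; move: h'; rewrite addSn => -[/esym/eqP]; rewrite addn_eq0 => /andP[/eqP->].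
- by rewrite eq_sym.
Qed.


End OneSurface.
End SurfaceRigidity.

(** * Gluing rigid families along common triangles *)

Section RigidFamilies.
Variable V : finType.
Implicit Types (U Y : {set {set V}}) (A t e : {set V}).

Lemma pairsS U Y : U \subset Y -> pairs U \subset pairs Y.
Proof.
move=> /subsetP UY; apply/subsetP=> e /pairsP[ce [t tU et]].
by apply/pairsP; split=> //; exists t; rewrite ?UY.
Qed.

Lemma coverS U Y : U \subset Y -> cover U \subset cover Y.
Proof.
move=> /subsetP UY; apply/subsetP=> x /coverP[t tU xt].
by apply/coverP; exists t; rewrite ?UY.
Qed.

Lemma cover_setU U Y : cover (U :|: Y) = cover U :|: cover Y.
Proof.
apply/eqP; rewrite eqEsubset; apply/andP; split; last first.
  by rewrite subUset !coverS ?subsetUl ?subsetUr.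
apply/subsetP=> x /coverP[t]; rewrite !inE => /orP[] tU xt; apply/orP.
  by left; apply/coverP; exists t.
by right; apply/coverP; exists t.
Qed.

Lemma sub_cover U t : t \in U -> t \subset cover U.
Proof. by move=> tU; apply/subsetP=> x xt; apply/coverP; exists t. Qed.

Lemma pair_cover U e : e \in pairs U -> e \subset cover U.
Proof. by case/pairsP=> _ [t tU et]; exact: subset_trans et (sub_cover tU). Qed.

Lemma card_meet0 e A : (#|e :&: A| == 0) = [disjoint e & A].
Proof. by rewrite cards_eq0 setI_eq0. Qed.

Lemma card_disjoint_sum (T : finType) (P Q S : {set T}) :
  P \subset S -> Q \subset S -> [disjoint P & Q] -> #|P| + #|Q| <= #|S|.
Proof.
move=> PS QS; rewrite -setI_eq0 => /eqP PQ.
by rewrite -cardsUI PQ cards0 addn0 subset_leq_card // subUset PS.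
Qed.

Lemma meeting_new U Y A : #|pairs U| + #|meeting (A :\: cover U) (pairs Y)|
  <= #|pairs (U :|: Y)|.
Proof.
apply: card_disjoint_sum; first by apply: pairsS; exact: subsetUl.
  apply/subsetP=> e; rewrite inE => /andP[eY _].
  by apply: subsetP eY; apply: pairsS; exact: subsetUr.
rewrite -setI_eq0; apply/eqP/setP=> e; rewrite in_set0 in_setI; apply/negP.
case/andP=> /pair_cover/subsetP eU; rewrite inE card_gt0 => /andP[_ /set0Pn[x]].
by rewrite !inE => /and3P[/eU->].
Qed.

(** By symmetry the avoided triangle is in [U]. The part of [A] in [cover U] is handled by [U]; the
    rest avoids the common triangle [t], so [Y] handles it. No edge is counted twice, since edges of
    [U] have both ends in [cover U]. *)
Lemma rigid_union U Y t : rigid U -> rigid Y -> t \in U -> t \in Y ->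
  rigid (U :|: Y).
Proof.
move=> + + + + A s; wlog sU : U Y / s \in U => [H|] rU rY tU tY.
  move=> AC; rewrite inE => /orP[] sU sA.
    by apply: (H U Y) sA; rewrite // inE sU.
  rewrite setUC in AC *; apply: (H Y U) sA => //.
  by rewrite inE sU.
move=> AC _ sA.
have cA : #|A| = #|A :&: cover U| + #|A :\: cover U| by rewrite cardsID.
have s0 : #|s :&: (A :&: cover U)| = 0.
  by apply/eqP; rewrite -leqn0 -sA subset_leq_card // setIS // subsetIl.
have h1 := rU _ s (subsetIr A (cover U)) sU s0.
have t0 : #|t :&: (A :\: cover U)| = 0.
  apply/eqP; rewrite card_meet0 -setI_eq0; apply/eqP/setP=> x; rewrite !inE.
  apply/negP=> /and3P[xt xU _]; case/negP: xU.
  by apply: subsetP (sub_cover tU) _ xt.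
have AY : A :\: cover U \subset cover Y by rewrite subDset -cover_setU.
have h2 := rY _ t AY tY t0.
rewrite cA mulnDr; apply: leq_trans (leq_add h1 h2) _.
apply: card_disjoint_sum.
- apply/subsetP=> e; rewrite !inE => /andP[eU eA]; apply/andP; split.
    have : e \in pairs (U :|: Y).
      by apply: (subsetP (pairsS (subsetUl U Y))); rewrite inE.
    by rewrite inE.
  by apply: leq_trans eA _; rewrite subset_leq_card // setIS // subsetIl.
- apply/subsetP=> e; rewrite !inE => /andP[eU eA]; apply/andP; split.
    have : e \in pairs (U :|: Y).
      by apply: (subsetP (pairsS (subsetUr U Y))); rewrite inE.
    by rewrite inE.
  by apply: leq_trans eA _; rewrite subset_leq_card // setIS // subsetDl.
rewrite -setI_eq0; apply/eqP/setP=> e; rewrite in_set0 in_setI; apply/negP.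
case/andP; rewrite in_set => /andP[/pair_cover/subsetP eU _].
rewrite in_set card_gt0 => /andP[_ /set0Pn[x]].
by rewrite !inE => /and3P[/eU->].
Qed.

(** Rigidity for all vertices off [t], plus the three edges of [t]: 3(n - 3) + 3 = 3n - 6. *)
Lemma rigid_lower U t : rigid U -> t \in U -> #|t| = 3 ->
  3 * #|cover U| <= #|pairs U| + 6.
Proof.
move=> rU tU c3.
have t0 : #|t :&: (cover U :\: t)| = 0.
  by apply/eqP; rewrite cards_eq0; apply/eqP/setP=> x; rewrite !inE; case: (x \in t).
have h := rU _ t (subsetDl (cover U) t) tU t0.
have cC : #|cover U| = 3 + #|cover U :\: t|.
  by rewrite -(cardsID t (cover U)) (setIidPr (sub_cover tU)) c3.
suff : #|meeting (cover U :\: t) (pairs U)| +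
   #|[set e : {set V} | e \subset t & #|e| == 2]| <= #|pairs U|.
  rewrite cards_draws c3 => h'; move: h h'; rewrite cC.
  by rewrite (_ : 'C(3, 2) = 3) //; clear; lia.
apply: card_disjoint_sum.
- by apply/subsetP=> e; rewrite inE => /andP[].
- apply/subsetP=> e; rewrite inE => /andP[et /eqP ce].
  by apply/pairsP; split=> //; exists t.
rewrite -setI_eq0; apply/eqP/setP=> e; rewrite in_set0 in_setI; apply/negP.
case/andP; rewrite !in_set card_gt0 => /andP[_ /set0Pn[x]].
by rewrite !inE => /and3P[xe xt _] /andP[/subsetP/(_ x xe)]; rewrite (negPf xt).
Qed.

(** The edges of [U] inside [cover Y] number at least 3n - 6 for n = |cover Y|, and those leaving it
    at least three per remaining vertex. Tightness of [U] makes both bounds equalities, so [Y] is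
    tight and contains every edge of [U] between its vertices. *)
Lemma rigid_sub_tight U Y t : rigid U -> rigid Y -> Y \subset U ->
  t \in Y -> #|t| = 3 -> #|pairs U| + 6 <= 3 * #|cover U| ->
  #|pairs Y| + 6 <= 3 * #|cover Y| /\
  forall e, e \in pairs U -> e \subset cover Y -> e \in pairs Y.
Proof.
move=> rU rY YU tY c3 tight.
have tU := subsetP YU t tY.
have t0 : #|t :&: (cover U :\: cover Y)| = 0.
  apply/eqP; rewrite card_meet0 -setI_eq0; apply/eqP/setP=> x; rewrite !inE.
  apply/negP=> /and3P[xt xU _]; case/negP: xU.
  by apply: subsetP (sub_cover tY) _ xt.
have h := rU _ t (subsetDl (cover U) (cover Y)) tU t0.
have cC : #|cover U| = #|cover Y| + #|cover U :\: cover Y|.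
  by rewrite -(cardsID (cover Y) (cover U)) (setIidPr (coverS YU)).
have low := rigid_lower rY tY c3.
pose IY := [set e in pairs U | e \subset cover Y].
have PI : pairs Y \subset IY.
  by apply/subsetP=> e eY; rewrite inE (subsetP (pairsS YU) _ eY) pair_cover.
have sum : #|IY| + #|meeting (cover U :\: cover Y) (pairs U)| <= #|pairs U|.
  apply: card_disjoint_sum.
  - by apply/subsetP=> e; rewrite inE => /andP[].
  - by apply/subsetP=> e; rewrite inE => /andP[].
  rewrite -setI_eq0; apply/eqP/setP=> e; rewrite in_set0 in_setI; apply/negP.
  case/andP; rewrite in_set => /andP[_ /subsetP eY].
  rewrite in_set card_gt0 => /andP[_ /set0Pn[x]].
  by rewrite !inE => /and3P[/eY->].
have PIc := subset_leq_card PI.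
have ar (pU cU cY cD M I pY : nat) : pU + 6 <= 3 * cU -> 3 * cD <= M ->
    cU = cY + cD -> 3 * cY <= pY + 6 -> I + M <= pU -> pY <= I ->
    I <= pY /\ pY + 6 <= 3 * cY by clear; lia.
have [le tY'] := ar _ _ _ _ _ _ _ tight h cC low sum PIc.
have E : pairs Y = IY by apply/eqP; rewrite eqEcard PI.
split=> //.
by move=> e eU eY; rewrite E inE eU.
Qed.

(** The fibres of [m] are rigid, and a step between different fibres keeps the triangle, so
    connectedness allows the fibres to be glued one by one. The indices are abstract because they
    are facets in one use and points of a double cover in the other. *)
Lemma family_rigid (X I : finType) (XS : {set X}) (r : rel X)
    (tr : X -> {set V}) (m : X -> I) :
  linked XS r ->
  {in XS &, forall x y, r x y -> m x = m y \/ tr x = tr y} ->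
  {in XS, forall x0, rigid [set tr x | x in [set x in XS | m x == m x0]]} ->
  rigid [set tr x | x in XS].
Proof.
move=> L step fib.
have [->|[x0 x0S]] := set_0Vmem XS.
  by move=> A t _ /imsetP[x]; rewrite inE.
pose UJ (J : {set I}) := [set tr x | x in [set x in XS | m x \in J]].
(* [J] holds the labels of the fibres glued so far; the induction is on the number of labels left
   out. *)
suff H : forall n (J : {set I}), #|~: J| < n -> m x0 \in J -> rigid (UJ J) ->
    rigid [set tr x | x in XS].
  apply: (H #|~: [set m x0]|.+1 [set m x0]) => //; first by rewrite inE.
  rewrite /UJ; suff -> : [set x in XS | m x \in [set m x0]] =
    [set x in XS | m x == m x0] by exact: fib.
  by apply/setP=> x; rewrite !inE.
elim=> // n IH J Jn x0J rJ.
case: (boolP [exists x in XS, exists y in XS, [&& r x y, m x \in J & m y \notin J]]).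
  case/existsP=> x /andP[xS /existsP[y /and4P[yS xy xJ yJ]]].
  apply: (IH (m y |: J)); last 1 first.
  - have -> : UJ (m y |: J) = UJ J :|: [set tr z | z in [set z in XS | m z == m y]].
      apply/setP=> t; rewrite in_setU; apply/imsetP/orP.
        case=> z; rewrite !inE => /andP[zS /orP[zy|zJ] ->].
          by right; apply: imset_f; rewrite inE zS.
        by left; apply: imset_f; rewrite inE zS.
      case=> /imsetP[z]; rewrite inE => /andP[zS zJ ->]; exists z => //;
        by rewrite !inE zS zJ ?orbT.
    have trE : tr x = tr y.
      by case: (step x y xS yS xy) => // E; rewrite E (negPf yJ) in xJ.
    apply: (rigid_union (t := tr x)) => //; first exact: fib.
      by apply: imset_f; rewrite inE xS.
    by rewrite trE; apply: imset_f; rewrite inE yS /=.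
  - rewrite -ltnS; apply: leq_trans Jn; rewrite ltnS; apply: proper_card.
    by rewrite properC properUr // sub1set.
  - by rewrite in_setU1 x0J orbT.
move=> N; suff <- : UJ J = [set tr x | x in XS] by [].
rewrite /UJ; suff -> : [set x in XS | m x \in J] = XS by [].
apply/setP=> x; rewrite inE; case xS: (x \in XS) => //=.
apply: (L (fun x => m x \in J) _ x0 x) => // u v uS vS uv uJ.
apply/negPn/negP => vJ; case/negP: N; apply/existsP; exists u; rewrite uS.
by apply/existsP; exists v; rewrite vS uv uJ.
Qed.

End RigidFamilies.

(** * Links and relabelling *)

Section Links.
Variable V : finType.
Implicit Types (Phi : {set {set V}}) (F G R s t : {set V}).

Definition lkf Phi F : {set {set V}} :=
  [set t : {set V} | [disjoint t & F] && (t :|: F \in Phi)].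

Lemma card_setU_disjoint s F : [disjoint s & F] -> #|s :|: F| = #|s| + #|F|.
Proof. by rewrite -setI_eq0 => /eqP sF; rewrite -cardsUI sF cards0 addn0. Qed.

Lemma setDUK s F : F \subset s -> s :\: F :|: F = s.
Proof.
move=> /subsetP Fs; apply/setP=> x; rewrite !inE.
by case xF: (x \in F); rewrite ?orbT ?orbF //= Fs.
Qed.

Lemma disjointDl s F : [disjoint s :\: F & F].
Proof.
by rewrite -setI_eq0; apply/eqP/setP=> x; rewrite !inE; case: (x \in F); rewrite ?andbF.
Qed.

Lemma setUDK s F : [disjoint s & F] -> (s :|: F) :\: F = s.
Proof. by rewrite setDUl setDv setU0 => /setDidPl. Qed.

Lemma star_lkf Phi F G t : t \in star (lkf Phi F) G ->
  t :|: F \in star Phi (G :|: F) /\ (t :|: F) :\: F = t.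
Proof.
rewrite !inE => /andP[/andP[tF tP] Gt]; rewrite tP /= setSU //.
by split=> //; exact: setUDK.
Qed.

Lemma star_lkfE Phi F G : [disjoint G & F] ->
  star (lkf Phi F) G = [set s :\: F | s in star Phi (G :|: F)].
Proof.
move=> GF; apply/setP=> t; apply/idP/imsetP => [/star_lkf[h1 h2]|[s]].
  by exists (t :|: F).
rewrite inE subUset => /and3P[sP Gs Fs] ->.
have E := setDUK Fs.
by rewrite inE inE E sP disjointDl subsetD Gs.
Qed.

Lemma lkf_card d Phi F t : pseudo d Phi -> t \in lkf Phi F -> #|t| + #|F| = d.
Proof.
by case=> c _ _; rewrite inE => /andP[tF /c <-]; rewrite card_setU_disjoint.
Qed.

Lemma card_setIU s t F : [disjoint s & F] ->
  #|(s :|: F) :&: (t :|: F)| = #|s :&: t| + #|F|.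
Proof.
move=> sF; rewrite -setUIl card_setU_disjoint //.
by apply: disjointWl sF; exact: subsetIl.
Qed.

Lemma pseudo_lkf d Phi F k : pseudo d Phi -> #|F| + k.+1 = d ->
  pseudo k.+1 (lkf Phi F).
Proof.
move=> HP dE; have [c H2 L] := HP; split.
- by move=> t /(lkf_card HP); rewrite -dE addnC => /addnI.
- move=> t R tL Rt cR.
  have := tL; rewrite inE => /andP[tF tP].
  have RF : [disjoint R & F] by apply: disjointWl tF.
  rewrite star_lkfE // card_in_imset.
    apply: (H2 _ _ tP); first exact: setSU.
    by rewrite card_setU_disjoint // cR -dE addnC addnS.
  move=> s s'; rewrite !inE !subUset => /and3P[_ _ /subsetP Fs] /and3P[_ _ /subsetP Fs'] E.
  apply/setP=> x; case xF: (x \in F); first by rewrite Fs ?Fs'.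
  by have /setP/(_ x) := E; rewrite !inE xF.
- move=> G P HPc x y xS yS.
  have Px := star_lkf xS; have Py := star_lkf yS.
  rewrite -Px.2 -Py.2.
  apply: (L (G :|: F) (fun s => P (s :\: F))) => [s s' sS s'S ss'||]; last 2 first.
  - exact: Px.1.
  - exact: Py.1.
  have GF : [disjoint G & F].
    move: xS; rewrite !inE => /andP[/andP[xF _] Gx].
    by apply: disjointWl xF.
  apply: HPc.
  + by rewrite star_lkfE //; apply: imset_f.
  + by rewrite star_lkfE //; apply: imset_f.
  have FD u : u \in star Phi (G :|: F) -> u = u :\: F :|: F.
    by rewrite inE subUset => /and3P[_ _ Fu]; rewrite setDUK.
  move: ss'; rewrite /ridge_adj {1}(FD _ sS) {1}(FD _ s'S).
  by rewrite card_setIU ?disjointDl // -dE addnS /= addnC eqn_add2l.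
Qed.

(** Needed to place a copy of a surface link in a double cover, whose vertices are pairs of a vertex
    and a sheet. *)
Lemma pseudo_imset (W : finType) (f : V -> W) d Phi :
  injective f -> pseudo d Phi -> pseudo d [set f @: (s : {set V}) | s in Phi].
Proof.
move=> finj [c H2 L].
have preK (G : {set W}) s : G \subset f @: s -> G = f @: (f @^-1: G).
  move=> /subsetP Gs; apply/setP=> x; apply/idP/imsetP => [xG|[z]].
    by have /imsetP[z zs xE] := Gs _ xG; exists z; rewrite // inE -xE.
  by rewrite inE => zG ->.
have subE (G s : {set V}) : (f @: G \subset f @: s) = (G \subset s).
  apply/idP/idP => [/subsetP H|]; last exact: imsetS.
  apply/subsetP=> x xG; have := H _ (imset_f f xG).
  by rewrite mem_imset.
have starE (G : {set V}) :
    star [set f @: (s : {set V}) | s in Phi] (f @: G) =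
    [set f @: (s : {set V}) | s in star Phi G].
  apply/setP=> t; rewrite inE; apply/andP/imsetP => [[/imsetP[s sP ->]]|[s]].
    by rewrite subE => Gs; exists s; rewrite // inE sP.
  by rewrite inE => /andP[sP Gs] ->; rewrite subE imset_f.
split.
- by move=> _ /imsetP[s sP ->]; rewrite card_imset // c.
- move=> _ R /imsetP[s sP ->] Rs; rewrite (preK R s Rs) card_imset // => cR.
  rewrite starE card_imset; last exact: imset_inj.
  by apply: (H2 s) => //; rewrite -subE -(preK R s Rs).
- move=> G P HP x y xS yS.
  have GE : G = f @: (f @^-1: G).
    by move: xS; rewrite inE => /andP[/imsetP[s _ ->]]; exact: preK.
  have inG u : u \in star Phi (f @^-1: G) ->
      f @: u \in star [set f @: (s : {set V}) | s in Phi] G.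
    by move=> uS; rewrite GE starE imset_f.
  move: xS yS; rewrite GE starE => /imsetP[s sS ->] /imsetP[s' s'S ->].
  apply: (L _ (fun u => P (f @: u)) _ _ _ sS s'S) => u v uS vS uv.
  apply: HP; [exact: inG | exact: inG |].
  by rewrite /ridge_adj -imsetI ?card_imset //; move=> ? ? _ _; exact: finj.
Qed.

End Links.

(** * Balanced pseudomanifolds *)

Lemma subset_of_card (T : finType) (A : {set T}) k :
  k <= #|A| -> exists2 B : {set T}, B \subset A & #|B| = k.
Proof.
rewrite -bin_gt0 -cards_draws card_gt0 => /set0Pn[B].
by rewrite inE => /andP[BA /eqP]; exists B.
Qed.

Definition dcl (V : finType) (Phi : {set {set V}}) : {set {set V}} :=
  [set F : {set V} | [exists s in Phi, F \subset s]].

Lemma dclP (V : finType) (Phi : {set {set V}}) (F : {set V}) :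
  reflect (exists2 s, s \in Phi & F \subset s) (F \in dcl Phi).
Proof.
rewrite inE; apply: (iffP existsP) => [[s /andP[? ?]]|[s sP Fs]]; exists s => //.
by rewrite sP.
Qed.

Lemma dclS (V : finType) (Phi : {set {set V}}) (F G : {set V}) :
  G \subset F -> F \in dcl Phi -> G \in dcl Phi.
Proof.
by move=> GF /dclP[s sP Fs]; apply/dclP; exists s => //; exact: subset_trans GF Fs.
Qed.

Section Balanced.
Variables (V : finType) (d : nat) (kappa : V -> 'I_d) (Phi : {set {set V}}).
Implicit Types (F G K R s t e : {set V}) (T : {set 'I_d}).
Hypothesis psP : pseudo d Phi.
Hypothesis rainbow : forall s, s \in Phi -> {in s &, injective kappa}.

Definition colored_in T : {set V} := [set x | kappa x \in T].
(** For three colours avoiding those of [G], the triangles of Delta_T that come from facets over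
    [G]; [G] empty gives all of Delta_T. *)
Definition tris G T : {set {set V}} := [set s :&: colored_in T | s in star Phi G].

(** Only the upper bound is stated; the opposite one is [rigid_lower]. *)
Definition tight : Prop := forall T, #|T| = 3 ->
  #|pairs (tris set0 T)| + 6 <= 3 * #|cover (tris set0 T)|.

Let cardP s : s \in Phi -> #|s| = d. Proof. by case: psP => c _ _; exact: c. Qed.

Lemma rainbow_full s i : s \in Phi -> exists2 x, x \in s & kappa x = i.
Proof.
move=> sP; have /imsetP[x xs ->] : i \in kappa @: s; last by exists x.
suff -> : kappa @: s = [set: 'I_d] by rewrite inE.
have ck : #|kappa @: s| = d by rewrite (card_in_imset (rainbow sP)) cardP.
by apply/eqP; rewrite eqEcard subsetT cardsT card_ord ck /=.
Qed.

Lemma card_colored s T : s \in Phi -> #|s :&: colored_in T| = #|T|.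
Proof.
move=> sP; have inj : {in s :&: colored_in T &, injective kappa}.
  by move=> x y; rewrite !inE => /andP[xs _] /andP[ys _]; exact: (rainbow sP).
rewrite -(card_in_imset inj).
apply: eq_card => i; apply/imsetP/idP => [[x]|iT].
  by rewrite !inE => /andP[_ xT] ->.
by have [x xs xi] := rainbow_full i sP; exists x; rewrite // !inE xs xi.
Qed.

(** Each facet uses every colour once, so the vertex that is exchanged keeps its colour. *)
Lemma adj_witness s s' : 0 < d -> s \in Phi -> s' \in Phi -> ridge_adj d s s' ->
  exists x x', [/\ s :\: s' = [set x], s' :\: s = [set x'] & kappa x = kappa x'].
Proof.
move=> d0 sP s'P ss'.
have one u v : u \in Phi -> v \in Phi -> ridge_adj d u v -> #|u :\: v| == 1.
  move=> uP vP uv; have := cardsID v u; rewrite (cardP uP) (eqP uv).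
  by move: d0; clear; case: d => //= n _ /eqP; rewrite -addn1 eqn_add2l.
have /cards1P[x Ex] := one _ _ sP s'P ss'.
have /cards1P[x' Ex'] : #|s' :\: s| == 1 by apply: one; rewrite // ridge_adj_sym.
exists x, x'; split=> //.
have [z zs zc] := rainbow_full (kappa x') sP.
have : x \in s :\: s' by rewrite Ex inE.
have : x' \in s' :\: s by rewrite Ex' inE.
rewrite !inE => /andP[x's x's'] /andP[xs' xs].
case: (boolP (z \in s')) => zs'.
  by have zx := rainbow s'P zs' x's' zc; rewrite -zx zs in x's.
have : z \in s :\: s' by rewrite inE zs' zs.
by rewrite Ex inE => /eqP <-.
Qed.

(** A ridge step changes one vertex within its colour; the alternative is whether that colour is in
    [T]. This is the step condition of [family_rigid]. *)
Lemma adj_colors s s' T : 0 < d -> s \in Phi -> s' \in Phi -> ridge_adj d s s' ->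
  s :\: colored_in T = s' :\: colored_in T \/
  s :&: colored_in T = s' :&: colored_in T.
Proof.
move=> d0 sP s'P ss'; have [x [x' [Ex Ex' xx']]] := adj_witness d0 sP s'P ss'.
have mem u : u != x -> u != x' -> (u \in s) = (u \in s').
  move=> ux ux'; apply/idP/idP => us; apply/negPn/negP => us'.
    have : u \in s :\: s' by rewrite inE us us'.
    by rewrite Ex inE (negPf ux).
  have : u \in s' :\: s by rewrite inE us us'.
  by rewrite Ex' inE (negPf ux').
case xT: (kappa x \in T); [left|right]; apply/setP=> u; rewrite !inE.
  case: (eqVneq u x) => [->|ux]; first by rewrite xT.
  by case: (eqVneq u x') => [->|ux']; [rewrite -xx' xT | rewrite mem].
case: (eqVneq u x) => [->|ux]; first by rewrite xT !andbF.
by case: (eqVneq u x') => [->|ux']; [rewrite -xx' xT !andbF | rewrite mem].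
Qed.

Lemma color_part_lkf G T s0 : #|T| = 3 -> [disjoint G & colored_in T] ->
  s0 \in star Phi G ->
  [/\ G \subset s0 :\: colored_in T, #|s0 :\: colored_in T| + 3 = d &
    forall s, s \in Phi -> s0 :\: colored_in T \subset s ->
      s :\: colored_in T = s0 :\: colored_in T].
Proof.
move=> T3 GT; rewrite inE => /andP[s0P Gs0].
have cD s : s \in Phi -> #|s :\: colored_in T| + 3 = d.
  by move=> sP; rewrite addnC -T3 -(card_colored T sP) cardsID cardP.
split=> //; [by rewrite subsetD Gs0 | exact: cD |].
move=> s sP sub; apply/esym/eqP; rewrite eqEcard subsetD sub disjointDl /=.
by rewrite -(leq_add2r 3) !cD.
Qed.

(** The facets with a prescribed part off [T] cut out the link of that part, a closed surface. This
    identifies the fibres for [family_rigid]. *)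
Lemma lkf_color_part G T s0 : #|T| = 3 -> [disjoint G & colored_in T] ->
  s0 \in star Phi G ->
  lkf Phi (s0 :\: colored_in T) =
  [set s :&: colored_in T | s in
     [set s in star Phi G | s :\: colored_in T == s0 :\: colored_in T]].
Proof.
move=> T3 GT s0S; have [GF cF FE] := color_part_lkf T3 GT s0S.
apply/setP=> t; apply/idP/imsetP => [|[s]].
  rewrite inE => /andP[tF tP]; exists (t :|: s0 :\: colored_in T).
    by rewrite !inE tP (subset_trans GF) ?subsetUr //= FE ?subsetUr.
  have E := FE _ tP (subsetUr _ _).
  have := setUDK tF; rewrite -[in X in _ :\: X]E => <-.
  by apply/setP=> x; rewrite !inE; case: (x \in t); case: (x \in s0);
     case: (kappa x \in T).
rewrite !inE => /andP[/andP[sP Gs] /eqP E] ->.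
rewrite -E setID sP andbT -setI_eq0; apply/eqP/setP=> x; rewrite !inE.
by case: (kappa x \in T); rewrite !andbF.
Qed.

Lemma rigid_tris G T : #|T| = 3 -> [disjoint G & colored_in T] -> rigid (tris G T).
Proof.
move=> T3 GT; have [L d0] : linked (star Phi G) (ridge_adj d) /\ 0 < d.
  split; first by case: psP.
  by have := max_card T; rewrite card_ord T3; apply: leq_trans.
apply: (family_rigid (m := fun s => s :\: colored_in T) L).
  move=> s s'; rewrite !inE => /andP[sP _] /andP[s'P _]; exact: adj_colors.
move=> s0 s0S; rewrite -(lkf_color_part T3 GT s0S); apply: surface_rigid.
by have [_ c _] := color_part_lkf T3 GT s0S; exact: pseudo_lkf psP c.
Qed.

Lemma tris_sub G T : tris G T \subset tris set0 T.
Proof.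
by apply: imsetS; apply/subsetP=> s; rewrite !inE => /andP[->]; rewrite sub0set.
Qed.

Lemma disjoint0_colored T : [disjoint set0 & colored_in T].
Proof. by rewrite -setI_eq0 set0I. Qed.

Lemma coverT G T x : reflect (exists2 s, s \in star Phi G & x \in s /\ kappa x \in T)
  (x \in cover (tris G T)).
Proof.
apply: (iffP (coverP _ _)) => [[_ /imsetP[s sS ->]]|[s sS [xs xT]]].
  by rewrite !inE => /andP[xs xT]; exists s.
by exists (s :&: colored_in T); [apply: imset_f | rewrite !inE xs].
Qed.

Lemma pairsT G T e : reflect (#|e| = 2 /\
    exists2 s, s \in star Phi G & e \subset s :&: colored_in T)
  (e \in pairs (tris G T)).
Proof.
apply: (iffP (pairsP _ _)) => [[ce [_ /imsetP[s sS ->] es]]|[ce [s sS es]]].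
  by split=> //; exists s.
by split=> //; exists (s :&: colored_in T); [apply: imset_f|].
Qed.

Lemma tris_codim3 G : G \in dcl Phi -> #|G| + 3 = d ->
  [/\ #|~: (kappa @: G)| = 3, [disjoint G & colored_in (~: (kappa @: G))] &
      tris G (~: (kappa @: G)) = lkf Phi G].
Proof.
move=> /dclP[s0 s0P Gs0] cG; pose T := ~: (kappa @: G); pose C := colored_in T.
have injG : {in G &, injective kappa}.
  by move=> x y xG yG; apply: (rainbow s0P); apply: (subsetP Gs0).
have T3 : #|T| = 3.
  have := cardsC (kappa @: G); rewrite (card_in_imset injG) card_ord -[in RHS]cG.
  by move/addnI.
have GT : [disjoint G & C].
  rewrite -setI_eq0; apply/eqP/setP=> x; rewrite !inE; apply/negP=> /andP[xG].
  by rewrite imset_f.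
have DC s : s \in star Phi G -> s :\: C = G.
  move=> sS; have [h1 h2 _] := color_part_lkf T3 GT sS.
  apply/esym/eqP; rewrite eqEcard h1 -(leq_add2r 3) /=.
  by rewrite [leqLHS]h2 [leqRHS]cG.
have s0S : s0 \in star Phi G by rewrite inE s0P.
have -> : lkf Phi G = lkf Phi (s0 :\: C) by rewrite DC.
split=> //; rewrite (lkf_color_part T3 GT s0S) -/T -/C DC //.
suff -> : [set s in star Phi G | s :\: C == G] = star Phi G by [].
by apply/setP=> s; rewrite in_set; case sS: (s \in star Phi G); rewrite //= DC // eqxx.
Qed.

Section Tight.
Hypothesis tightP : tight.

Lemma tight_star G T : #|T| = 3 -> [disjoint G & colored_in T] -> G \in dcl Phi ->
  #|pairs (tris G T)| + 6 <= 3 * #|cover (tris G T)| /\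
  forall e, e \in pairs (tris set0 T) -> e \subset cover (tris G T) ->
    e \in pairs (tris G T).
Proof.
move=> T3 GT /dclP[s sP Gs].
have sS : s \in star Phi G by rewrite inE sP.
apply: (@rigid_sub_tight _ (tris set0 T) (tris G T) (s :&: colored_in T)).
- exact: rigid_tris (disjoint0_colored T).
- exact: rigid_tris.
- exact: tris_sub.
- exact: imset_f.
- by rewrite card_colored.
- exact: tightP.
Qed.

(** Remove [x] and [y] from [K] to get [G]. By induction [K :\ y] and [K :\ x] are faces, so [x] and
    [y] are vertices over [G]; inducedness puts the edge xy over [G] as well, and a facet over [G]
    containing it contains [K]. *)
Lemma clique_face K : #|K| < d ->
  (forall x y, x \in K -> y \in K -> [set x; y] \in dcl Phi) ->
  Phi != set0 -> K \in dcl Phi.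
Proof.
have [n] := ubnP #|K|; elim: n K => // n IH K Kn Kd cl ne.
have [->|[x xK]] := set_0Vmem K.
  by have /set0Pn[s sP] := ne; apply/dclP; exists s; rewrite ?sub0set.
have [E|[y]] := set_0Vmem (K :\ x).
  suff -> : K = [set x; x] by exact: cl.
  by rewrite setUid -(setD1K xK) E setU0.
rewrite in_setD1 => /andP[yx yK].
have sub z : z \in K -> K :\ z \in dcl Phi.
  move=> zK; have := cardsD1 z K; rewrite zK add1n => cK.
  apply: IH => //; [by rewrite -ltnS -cK| by rewrite ltnW // -cK|].
  by move=> u v; rewrite !in_setD1 => /andP[_ uK] /andP[_ vK]; exact: cl.
have kinj u v : u \in K -> v \in K -> kappa u = kappa v -> u = v.
  move=> uK vK; have /dclP[s sP] := cl u v uK vK; rewrite subUset !sub1set => /andP[us vs].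
  exact: (rainbow sP).
(* A third colour, to complete those of [x] and [y] to a triple disjoint from the colours of [G]; it
   exists because [K] has fewer than [d] vertices. *)
have [m mK] : exists m, m \notin kappa @: K.
  have : 0 < #|~: (kappa @: K)|.
    have := cardsC (kappa @: K); rewrite card_ord.
    by rewrite card_in_imset // => E; move: Kd; rewrite -[X in _ < X]E -[X in X < _]addn0 ltn_add2l.
  by rewrite card_gt0 => /set0Pn[m]; rewrite inE; exists m.
have kx : kappa x \in kappa @: K by exact: imset_f.
have ky : kappa y \in kappa @: K by exact: imset_f.
pose T := m |: [set kappa x; kappa y].
have kxy : kappa x != kappa y by apply: contraNneq yx => /kinj -> //.
have T3 : #|T| = 3.
  rewrite cardsU1 cards2 kxy in_set2 negb_or.
  by rewrite (contraNneq _ mK) => [|->//]; rewrite (contraNneq _ mK) => [|->].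
pose G := K :\ x :\ y.
have GT : [disjoint G & colored_in T].
  rewrite -setI_eq0; apply/eqP/setP=> z; rewrite !inE; apply/negP.
  case/andP=> /and3P[zy zx zK] /or3P[]/eqP E.
  - by rewrite -E imset_f in mK.
  - by rewrite (kinj z x) ?eqxx in zx.
  - by rewrite (kinj z y) ?eqxx in zy.
have Gd : G \in dcl Phi by apply: dclS (sub x xK); exact: subsetDl.
have [_ ind] := tight_star T3 GT Gd.
have cov z w : z \in K -> kappa z \in T -> z != w -> w \in K -> G \subset K :\ w ->
    z \in cover (tris G T).
  move=> zK zT zw wK GK; have /dclP[s sP Ks] := sub w wK.
  apply/coverT; exists s; first by rewrite inE sP (subset_trans GK).
  by split=> //; apply: (subsetP Ks); rewrite !inE zw.
have e0 : [set x; y] \in pairs (tris set0 T).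
  apply/pairsT; split; first by rewrite cards2 eq_sym yx.
  have /dclP[s sP xys] := cl x y xK yK; exists s; first by rewrite inE sP sub0set.
  by rewrite subsetI xys subUset !sub1set !inE !eqxx !orbT.
have /pairsT[_ [s]] : [set x; y] \in pairs (tris G T).
  apply: ind => //; rewrite subUset !sub1set; apply/andP; split.
    apply: (cov x y) => //; rewrite ?inE ?eqxx ?orbT // 1?eq_sym //.
    by apply: setSD; exact: subsetDl.
  apply: (cov y x) => //; rewrite ?inE ?eqxx ?orbT //.
  exact: subsetDl.
rewrite inE => /andP[sP Gs].
rewrite subsetI subUset !sub1set => /andP[/andP[xs ys] _].
apply/dclP; exists s => //; apply/subsetP=> z zK.
case: (eqVneq z x) => [->//|zx]; case: (eqVneq z y) => [->//|zy].
by apply: (subsetP Gs); rewrite !inE zx zy.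
Qed.

End Tight.
End Balanced.

(** * Potentials on facets *)

Section Potentials.
Variables (V : finType) (d : nat) (kappa : V -> 'I_d) (Phi : {set {set V}}).
Implicit Types (F G H K R s t e : {set V}) (T : {set 'I_d}).
Hypothesis psP : pseudo d Phi.
Hypothesis rainbow : forall s, s \in Phi -> {in s &, injective kappa}.
Hypothesis tightP : tight kappa Phi.

(** A primitive over the star of [G] of the F_2-valued cochain [j] on the dual graph; equivalently a
    section of the double cover defined by [j]. *)
Definition potential (j : rel {set V}) G (y : {set V} -> bool) : Prop :=
  {in star Phi G &, forall s s', ridge_adj d s s' -> y s (+) y s' = j s s'}.

Lemma potentialS j G H y : G \subset H -> potential j G y -> potential j H y.
Proof.
move=> GH p s s' sS s'S; apply: p.
  by move: sS; rewrite !inE => /andP[-> /(subset_trans GH)].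
by move: s'S; rewrite !inE => /andP[-> /(subset_trans GH)].
Qed.

Lemma potential_diff j G y z : potential j G y -> potential j G z ->
  {in star Phi G &, forall s s', y s (+) z s = y s' (+) z s'}.
Proof.
move=> py pz; have [_ _ L] := psP.
apply: (linked_eq (P := fun s => y s (+) z s) (@ridge_adj_sym _ d) (L G)).
move=> s s' sS s'S ss'; have := py s s' sS s'S ss'; have := pz s s' sS s'S ss'.
by case: (y s); case: (y s'); case: (z s); case: (z s'); case: (j s s').
Qed.

(** * The double cover of the dual graph *)

Section Cover.
Variables (j : rel {set V}) (G : {set V}).
Hypothesis jsym : symmetric j.

(** A point is a facet over [G] with a sheet; a ridge step with [j] true changes the sheet. *)
Let X : {set {set V} * bool} := [set p | p.1 \in star Phi G].
Let r : rel ({set V} * bool) :=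
  fun p q => ridge_adj d p.1 q.1 && (q.2 == p.2 (+) j p.1 q.1).

Let inX p : (p \in X) = (p.1 \in star Phi G). Proof. by rewrite in_set. Qed.

(** If one facet can be reached from the base point on both sheets, then every facet can and the
    cover is connected. Otherwise the sheet on which a facet is reached is a potential. *)
Lemma cover_linked_or_potential : linked X r \/ exists y, potential j G y.
Proof.
have [E|[s0 s0S]] := set_0Vmem (star Phi G).
  by right; exists (fun=> false) => s s'; rewrite E inE.
pose r' := [rel p q | [&& p \in X, q \in X & r p q]].
have rsym : symmetric r'.
  move=> p q /=; rewrite /r ridge_adj_sym jsym andbCA; congr [&& _, _, _ & _].
  by case: p.2; case: q.2; case: (j _ _).
pose c s b := connect r' (s0, false) (s, b).
have [_ _ L] := psP.
have cstep s s' b : s \in star Phi G -> s' \in star Phi G -> ridge_adj d s s' ->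
    c s b -> c s' (b (+) j s s').
  move=> sS s'S ss' cs; apply: connect_trans cs _; apply: connect1.
  by rewrite /= !inX sS s'S /r ss' /=.
have one s : s \in star Phi G -> c s false || c s true.
  move=> sS; apply: (L G (fun s => c s false || c s true) _ s0 s) => //.
    move=> u v uS vS uv /orP[] /(cstep _ _ _ uS vS uv); case: (j u v) => /= ->;
    by rewrite ?orbT.
  by rewrite /c connect0.
case: (boolP [exists s in star Phi G, c s false && c s true]); last first.
  move/existsPn => N; right; exists (fun s => c s true).
  move=> s s' sS s'S ss'.
  have one' u : u \in star Phi G -> c u false = ~~ c u true.
    move=> uS; have := N u; have := one u uS; rewrite uS /=.
    by case: (c u false); case: (c u true).
  have st b := cstep s s' b sS s'S ss'.
  have := st true; have := st false; rewrite (one' s sS).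
  case: (j s s') => /=; rewrite ?(one' s' s'S);
  by case: (c s true); case: (c s' true) => //= h1 h2;
     first [have := h1 isT | have := h2 isT].
case/existsP=> s1 /andP[s1S both]; left.
have all s b : s \in star Phi G -> c s b.
  move=> sS; suff /andP[] : c s false && c s true by case: b.
  apply: (L G (fun s => c s false && c s true) _ s1 s) => // u v uS vS uv /andP[h1 h2].
  have := cstep u v false uS vS uv h1; have := cstep u v true uS vS uv h2.
  by case: (j u v) => /= -> ->.
move=> P clP [s b] [s' b']; rewrite !inX /= => sS s'S.
have con : connect r' (s, b) (s', b').
  apply: connect_trans (all s' b' s'S); rewrite (sym_connect_sym rsym).
  exact: all.
have cl : closed r' P.
  move=> p q /and3P[pX qX pq]; apply/idP/idP; first exact: clP.
  apply: clP => //; rewrite /r ridge_adj_sym jsym.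
  by case/andP: pq => -> /eqP->; case: p.2; case: (j _ _).
by have := closed_connect cl con; rewrite !unfold_in => ->.
Qed.

Variable ys : V -> {set V} -> bool.
Hypothesis ysP : forall x, x \notin G -> potential j (x |: G) (ys x).
Hypothesis Gdim : #|G| + 4 <= d.
Hypothesis GP : G \in dcl Phi.

(** The vertices of the cover are pairs (x, c): along a step over [x] the sheet and [ys x] both
    change by [j], so c = sheet (+) [ys x] is constant. The lifted triangles form one rigid family,
    as the cover is connected. *)
Lemma cover_not_linked : linked X r -> False.
Proof.
move=> LX.
have d0 : 0 < d by apply: leq_trans Gdim; rewrite addnS.
have [T TG T3] : exists2 T : {set 'I_d}, T \subset ~: (kappa @: G) & #|T| = 3.
  apply: subset_of_card; have := cardsC (kappa @: G); rewrite card_ord.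
  have := leq_imset_card kappa G; move: Gdim; clear.
  by move: #|kappa @: G| => a; move: #|~: _| => b; lia.
have GT : [disjoint G & colored_in kappa T].
  rewrite -setI_eq0; apply/eqP/setP=> x; rewrite !inE; apply/negP=> /andP[xG xT].
  by have := subsetP TG _ xT; rewrite inE imset_f.
pose C := colored_in kappa T.
have outG x : x \in C -> x \notin G.
  by move=> xC; apply/negP => xG; move: GT; rewrite -setI_eq0 => /eqP/setP/(_ x); rewrite in_set0 in_setI xG xC.
pose yF F s := if [pick x in F :\: G] is Some x then ys x s else false.
have yFP F : G \subset F -> #|G| < #|F| -> potential j F (yF F).
  move=> GF cF; rewrite /yF; case: pickP => [x|N].
    rewrite inE => /andP[xG xF]; apply: potentialS (ysP xG).
    by rewrite subUset sub1set xF.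
  have := cardsID G F; rewrite (setIidPr GF) (_ : F :\: G = set0) ?cards0.
    by move=> E; move: cF; rewrite -E addn0 ltnn.
  by apply/setP=> x; rewrite in_set0; exact: N.
pose tr (p : {set V} * bool) := [set (x, p.2 (+) ys x p.1) | x in p.1 :&: C].
pose m (p : {set V} * bool) := (p.1 :\: C, p.2 (+) yF (p.1 :\: C) p.1).
have part s : s \in star Phi G ->
    [/\ G \subset s :\: C, #|s :\: C| + 3 = d, #|G| < #|s :\: C| &
     forall u, u \in Phi -> s :\: C \subset u -> u :\: C = s :\: C].
  move=> sS; have [h1 h2 h3] := color_part_lkf psP rainbow T3 GT sS.
  by split=> //; move: Gdim; rewrite -h2 addnS ltn_add2r.
have rig : rigid [set tr p | p in X].
  apply: (family_rigid (m := m) LX).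
    move=> [s b] [s' b']; rewrite !inX /= => sS s'S; rewrite /r /= => /andP[ss' /eqP ->].
    have sP : s \in Phi by move: sS; rewrite inE => /andP[].
    have s'P : s' \in Phi by move: s'S; rewrite inE => /andP[].
    have [E|E] := adj_colors psP rainbow T d0 sP s'P ss'.
      left; rewrite /m /= -/C; move: E; rewrite -/C => E; rewrite -E; congr (_, _).
      have [h1 h2 h3 _] := part s sS.
      have := yFP _ h1 h3 s s'; rewrite !inE sP s'P subsetDl E subsetDl.
      by move=> /(_ isT isT ss') <-; case: b; case: (yF _ s); case: (yF _ s').
    right; rewrite /tr /=; move: E; rewrite -/C => E; rewrite -E.
    apply: eq_in_imset => x xs; congr (_, _).
    have xs' : x \in s' :&: C by rewrite -E.
    move: (xs) xs'; rewrite !in_setI => /andP[{}xs xC] /andP[xs' _].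
    have := @ysP _ (outG _ xC) s s'.
    rewrite !inE sP s'P !subUset !sub1set xs xs' /=.
    move: sS s'S; rewrite !inE => /andP[_ ->] /andP[_ ->] /(_ isT isT ss') <-.
    by case: b; case: (ys x s); case: (ys x s').
  move=> [s0 b0]; rewrite inX /= => s0S.
  pose F := s0 :\: C; pose r0 := (m (s0, b0)).2.
  have [GF cF cGF FE] := part s0 s0S.
  pose sx x := odflt set0 [pick s in star Phi (x |: F)].
  (* The second coordinate of the lift of [x] in this fibre. On the star of [x |: F] both [yF F] and
     [ys x] are potentials, so their difference is constant and the reference facet [sx x] is
     immaterial. *)
  pose g x := r0 (+) yF F (sx x) (+) ys x (sx x).
  have gE x s : x \in C -> s \in Phi -> x \in s -> F \subset s ->
      g x = r0 (+) yF F s (+) ys x s.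
    move=> xC sP xs Fs.
    have sS : s \in star Phi (x |: F) by rewrite inE sP subUset sub1set xs.
    have sxS : sx x \in star Phi (x |: F).
      by rewrite /sx; case: pickP => [//|/(_ s)]; rewrite sS.
    have p1 : potential j (x |: F) (yF F).
      by apply: potentialS (yFP F GF cGF); exact: subsetUr.
    have p2 : potential j (x |: F) (ys x).
      by apply: potentialS (ysP (outG _ xC)); exact: setUS.
    by have E := potential_diff p1 p2 sxS sS; rewrite /g -addbA E addbA.
  have -> : [set tr p | p in [set p in X | m p == m (s0, b0)]] =
      [set (fun x => (x, g x)) @: (t : {set V}) | t in lkf Phi F].
    rewrite (lkf_color_part psP rainbow T3 GT s0S) -/C.
    have trE s b : s \in star Phi G -> s :\: C = F -> b = r0 (+) yF F s ->
        tr (s, b) = (fun x => (x, g x)) @: (s :&: C).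
      rewrite inE => /andP[sP Gs] sF bE; apply: eq_in_imset => x; rewrite in_setI.
      move=> /andP[xs xC]; congr (_, _); rewrite (gE x s) //= ?bE //.
      by rewrite -sF subsetDl.
    apply/setP=> w; apply/imsetP/imsetP => [[[s b]]|[t /imsetP[s]]].
      rewrite inE inX /= => /andP[sS /eqP E] ->; exists (s :&: C).
        by apply: imset_f; rewrite inE sS; case: E => -> _ /=.
      move: E; rewrite /m /= => -[sF E]; apply: trE => //.
      by rewrite /r0 /m /= -E sF -/F; case: b {E}; case: (yF F s).
    rewrite inE => /andP[sS /eqP sF] -> ->; exists (s, r0 (+) yF F s).
      rewrite inE inX /= sS /m /= sF -/F -/C; apply/eqP; congr (_, _).
      by rewrite /r0 /m /= -/F -addbA addbb addbF.
    by rewrite (trE s (r0 (+) yF F s)).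
  apply: surface_rigid; apply: pseudo_imset; first by move=> x y [].
  by apply: pseudo_lkf psP _; exact: cF.
have [tG _] := tight_star psP rainbow tightP T3 GT GP.
have cov : 2 * #|cover (tris kappa Phi G T)| <= #|cover [set tr p | p in X]|.
  have -> : 2 * #|cover (tris kappa Phi G T)| =
      #|setX (cover (tris kappa Phi G T)) [set: bool]|.
    by rewrite cardsX cardsT card_bool mulnC.
  apply: subset_leq_card; apply/subsetP=> -[x b]; rewrite in_setX in_setT andbT /=.
  case/coverT=> s sS [xs xT]; apply/coverP; exists (tr (s, b (+) ys x s)).
    by apply: imset_f; rewrite inX.
  apply/imsetP; exists x; rewrite ?inE ?xs //=.
  by rewrite -addbA addbb addbF.
(* An edge has at most two lifts: the potentials of its two ends differ by a constant on the star of
   the edge, so the lift of one end determines that of the other. [Lf] normalises lifts at a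
   reference facet [se e]. *)
have prs : #|pairs [set tr p | p in X]| <= 2 * #|pairs (tris kappa Phi G T)|.
  have -> : 2 * #|pairs (tris kappa Phi G T)| =
      #|setX (pairs (tris kappa Phi G T)) [set: bool]|.
    by rewrite cardsX cardsT card_bool mulnC.
  pose se e := odflt set0 [pick s in star Phi (G :|: e)].
  pose Lf (q : {set V} * bool) := [set (z, q.2 (+) ys z (se q.1)) | z in q.1].
  apply: leq_trans (leq_imset_card Lf _); apply: subset_leq_card.
  apply/subsetP=> e' /pairsP[ce' [_ /imsetP[[s b] pX ->] e'tr]].
  move: pX; rewrite inX /= => sS.
  pose e := [set z in s :&: C | (z, b (+) ys z s) \in e'].
  have e'E : e' = [set (z, b (+) ys z s) | z in e].
    apply/setP=> w; apply/idP/imsetP => [we|[z]].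
      have /imsetP[z zs wE] := subsetP e'tr _ we.
      by exists z; rewrite // inE zs -wE.
    by rewrite inE => /andP[_ ze] ->.
  have ce : #|e| = 2 by rewrite -ce' e'E card_imset // => x y [].
  have es : e \subset s :&: C by apply/subsetP=> z; rewrite inE => /andP[].
  have sP : s \in Phi by move: sS; rewrite inE => /andP[].
  have sSe : s \in star Phi (G :|: e).
    move: sS; rewrite !inE => /andP[-> Gs] /=; rewrite subUset Gs /=.
    by apply: subset_trans es _; exact: subsetIl.
  have seS : se e \in star Phi (G :|: e).
    by rewrite /se; case: pickP => [//|/(_ s)]; rewrite sSe.
  have zG z : z \in e -> z \notin G.
    by move=> /(subsetP es); rewrite in_setI => /andP[_ /outG].
  have zpot z : z \in e -> potential j (G :|: e) (ys z).
    move=> ze; apply: potentialS (ysP (zG _ ze)).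
    by rewrite setUC setUS // sub1set.
  have /set0Pn[z0 z0e] : e != set0 by rewrite -card_gt0 ce.
  apply/imsetP; exists (e, b (+) ys z0 s (+) ys z0 (se e)).
    rewrite in_setX in_setT andbT; apply/pairsT; split=> //; exists s => //.
  rewrite e'E /Lf /=; apply: eq_in_imset => z ze; congr (_, _).
  have E := potential_diff (zpot z0 z0e) (zpot z ze) sSe seS.
  by rewrite -[RHS]addbA -E addbA addbK.
have /dclP[s sP Gs] := GP.
have low : 3 * #|cover [set tr p | p in X]| <= #|pairs [set tr p | p in X]| + 6.
  apply: (rigid_lower (t := tr (s, false))) => //.
    by apply: imset_f; rewrite inX inE sP.
  by rewrite card_imset /= ?(card_colored psP rainbow T sP) // => x y [].
(* With n vertices and c edges below, the cover gives 2c >= 6n - 6, whereas tightness gives 2c <= 6n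
   - 12. *)
have ar (a b c e : nat) : 3 * a <= b + 6 -> b <= 2 * c -> 2 * e <= a ->
  c + 6 <= 3 * e -> False by clear; lia.
exact: ar low prs cov tG.
Qed.

End Cover.

(* If no potential existed, the double cover defined by j would be connected;
   it has twice as many vertices and edges as the link, which contradicts
   its own lower bound. *)
Lemma local_to_global_potential (j : rel {set V}) G : symmetric j ->
  G \in dcl Phi -> #|G| + 4 <= d ->
  (forall x, x \notin G -> exists y, potential j (x |: G) y) ->
  exists y, potential j G y.
Proof.
move=> js GP Gd loc.
have [|ys ysP] := fin_all_exists (P := fun x y => x \notin G -> potential j (x |: G) y).
  move=> x; case: (boolP (x \in G)) => xG; first by exists (fun=> false).
  by have [y Hy] := loc x xG; exists y.
case: (cover_linked_or_potential G js) => // L.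
by case: (cover_not_linked ysP Gd GP L).
Qed.

End Potentials.

(** * Cutting along a missing facet *)

Section MissingFacet.
Variables (V : finType) (d : nat) (kappa : V -> 'I_d) (Phi : {set {set V}}).
Implicit Types (F G H K R s t e : {set V}) (T : {set 'I_d}).
Hypothesis psP : pseudo d Phi.
Hypothesis rainbow : forall s, s \in Phi -> {in s &, injective kappa}.
Hypothesis tightP : tight kappa Phi.
Hypothesis d4 : 4 <= d.
Variable tau : {set V}.
Hypothesis tau_card : #|tau| = d.
Hypothesis tau_ridges : forall R, R \subset tau -> #|R| = d.-1 -> R \in dcl Phi.
Hypothesis tau_missing : tau \notin Phi.

Let d0 : 0 < d. Proof. exact: leq_trans d4. Qed.

Let inside : rel {set V} := fun s s' => s :&: s' \subset tau.

Lemma proper_tau_face G : G \subset tau -> #|G| < d ->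
  exists2 R : {set V}, (R \subset tau) && (G \subset R) & #|R| = d.-1.
Proof.
move=> Gt cG; have [x xt xG] : exists2 x, x \in tau & x \notin G.
  by apply/subsetPn; apply: contraL cG => /subset_leq_card; rewrite tau_card -leqNgt.
exists (tau :\ x); first by rewrite subsetDl subsetD1 Gt xG.
by have := cardsD1 x tau; rewrite xt tau_card => ->.
Qed.

Lemma proper_tau_dcl G : G \subset tau -> #|G| < d -> G \in dcl Phi.
Proof.
move=> Gt cG; have [R /andP[Rt GR] cR] := proper_tau_face Gt cG.
exact: dclS GR (tau_ridges Rt cR).
Qed.

Lemma tau_rainbow : {in tau &, injective kappa}.
Proof.
move=> x y xt yt; have /dclP[s sP] : [set x; y] \in dcl Phi.
  apply: proper_tau_dcl; first by rewrite subUset !sub1set xt.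
  by rewrite (leq_ltn_trans _ d4) // cards2; case: (x != y).
by rewrite subUset !sub1set => /andP[xs ys]; exact: (rainbow sP).
Qed.

(** In the tight surface that is the link of [G], the rest of [tau] is a triangle that is missing
    but has all its edges, so [surface_jordan] gives its two sides. *)
Lemma potential_base G : G \subset tau -> #|G| + 3 = d ->
  exists y, potential d Phi inside G y.
Proof.
move=> Gt cG; have Glt : #|G| < d by rewrite -cG -addn1 leq_add2l.
have GP := proper_tau_dcl Gt Glt.
have [T3 GT trE] := tris_codim3 psP rainbow GP cG.
have [tG _] := tight_star psP rainbow tightP T3 GT GP; rewrite trE in tG.
have lkP : pseudo 3 (lkf Phi G) by exact: pseudo_lkf psP cG.
have cD : #|tau :\: G| = 3.
  by have := cardsID G tau; rewrite (setIidPr Gt) tau_card -cG => /addnI.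
have [||y yP] := surface_jordan lkP tG cD.
- move=> e et ce; have [eG et'] : [disjoint e & G] /\ e \subset tau.
    by move: et; rewrite subsetD => /andP[-> ->].
  have /dclP[s sP] : e :|: G \in dcl Phi.
    apply: proper_tau_dcl; first by rewrite subUset et'.
    by rewrite card_setU_disjoint // ce -cG addnC ltn_add2l.
  rewrite subUset => /andP[es Gs]; apply/pairsP; split=> //; exists (s :\: G).
    by rewrite inE disjointDl setDUK.
  by rewrite subsetD es.
- by rewrite inE disjointDl setDUK.
exists (fun s => y (s :\: G)) => s s'; rewrite !inE => /andP[sP Gs] /andP[s'P Gs'] ss'.
rewrite yP ?inE ?disjointDl ?setDUK //.
  rewrite /inside; apply/subsetP/subsetP => [h x|h x].
    rewrite inE => /andP[xs xs']; case: (boolP (x \in G)) => [/(subsetP Gt)//|xG].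
    by have := h x; rewrite !inE xs xs' xG => /(_ isT).
  rewrite !inE => /andP[/andP[xG xs] /andP[_ xs']]; rewrite xG.
  by apply: h; rewrite inE xs.
have := card_setIU (s' :\: G) (disjointDl s G); rewrite !setDUK // (eqP ss').
have -> : d.-1 = 2 + #|G| by rewrite -cG addnC.
by move/addIn; rewrite /ridge_adj => <-.
Qed.

(** Induction on the codimension. No ridge containing a face outside [tau] lies inside [tau], so
    constants serve there; over a set [x |: G] that is not a face the condition is empty. *)
Lemma potential_all n G : G \in dcl Phi -> #|G| + 3 + n = d ->
  exists y, potential d Phi inside G y.
Proof.
elim: n G => [|n IH] G GP cG; (case: (boolP (G \subset tau)) => Gt; last first).
- exists (fun=> false) => s s'; rewrite !inE => /andP[_ Gs] /andP[_ Gs'] _.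
  by apply/esym/negP => st; case/negP: Gt; apply: subset_trans st; rewrite subsetI Gs.
- by apply: potential_base => //; rewrite -[RHS]cG addn0.
- exists (fun=> false) => s s'; rewrite !inE => /andP[_ Gs] /andP[_ Gs'] _.
  by apply/esym/negP => st; case/negP: Gt; apply: subset_trans st; rewrite subsetI Gs.
apply: (local_to_global_potential psP rainbow tightP) => //.
- by move=> s s'; rewrite /inside setIC.
- by rewrite -[leqRHS]cG -addnA leq_add2l addnS.
move=> x xG; case: (boolP (x |: G \in dcl Phi)) => xGP.
  by apply: IH => //; rewrite cardsU1 xG -[RHS]cG !addnS.
exists (fun=> false) => s s'; rewrite inE => /andP[sP Gs].
by case/dclP: xGP; exists s.
Qed.

Lemma global_potential : exists y : {set V} -> bool,
  {in Phi &, forall s s', ridge_adj d s s' -> y s (+) y s' = (s :&: s' \subset tau)}.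
Proof.
have [||y yP] := @potential_all (d - 3) set0.
- by apply: proper_tau_dcl; rewrite ?sub0set // cards0.
- by rewrite cards0 add0n subnKC // ltnW.
by exists y => s s' sP s'P; apply: yP; rewrite inE ?sP ?s'P sub0set.
Qed.

(** * The two capped sides of the missing facet *)

Section Sides.
Variable y : {set V} -> bool.
Hypothesis yP :
  {in Phi &, forall s s', ridge_adj d s s' -> y s (+) y s' = (s :&: s' \subset tau)}.

Definition side (b : bool) : {set {set V}} := tau |: [set s in Phi | y s == b].

Lemma sideP b s : reflect (s = tau \/ s \in Phi /\ y s = b) (s \in side b).
Proof.
rewrite !inE; apply: (iffP orP) => [[/eqP|/andP[sP /eqP]]|[->|[sP /eqP]]].
- by left.
- by right.
- by left.
- by right; rewrite sP.
Qed.

(** Ridges over [H] are not inside [tau], so [y] never changes in the connected star of [H]: away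
    from [tau] the cut does not alter the complex. *)
Lemma side_const H s s' : ~~ (H \subset tau) -> s \in star Phi H ->
  s' \in star Phi H -> y s = y s'.
Proof.
move=> Ht; have [_ _ L] := psP.
apply: (linked_eq (P := y) (@ridge_adj_sym _ d) (L H)) => u v.
rewrite !inE => /andP[uP Hu] /andP[vP Hv] uv.
have := yP uP vP uv; rewrite (_ : u :&: v \subset tau = false).
  by case: (y u); case: (y v).
by apply: contraNF Ht => h; apply: subset_trans h; rewrite subsetI Hu.
Qed.

Lemma ridge_side R b : R \subset tau -> #|R| = d.-1 ->
  exists2 s, s \in Phi /\ y s = b &
  exists2 s', s' \in Phi /\ y s' = ~~ b & star Phi R = [set s; s'].
Proof.
move=> Rt cR; have /dclP[s sP Rs] := tau_ridges Rt cR.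
have [s' [s'P n Rs' E]] := pseudo_across psP sP Rs cR.
have I := adj_ridge psP sP s'P n Rs Rs' cR.
have ss' : ridge_adj d s s' by rewrite /ridge_adj I cR.
have := yP sP s'P ss'; rewrite I Rt => ys.
case: (eqVneq (y s) b) => yb.
  exists s => //; exists s' => //; split=> //.
  by move: ys; rewrite yb; case: b {yb}; case: (y s').
exists s'; [split=> // | exists s; [split=> // | by rewrite setUC]].
  by move: ys yb; case: b; case: (y s); case: (y s').
by move: yb; case: b; case: (y s).
Qed.

Lemma side_rainbow b s : s \in side b -> {in s &, injective kappa}.
Proof. by case/sideP=> [->|[sP _]]; [exact: tau_rainbow | exact: rainbow]. Qed.

(** A ridge inside [tau] keeps one facet of class [b] and gains [tau]; other stars are unchanged.
    For connectedness over a face of [tau], every facet of the class is shown to be joined to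
    [tau]. *)
Lemma side_pseudo b : pseudo d (side b).
Proof.
have [c _ L] := psP.
have cS s : s \in side b -> #|s| = d by case/sideP=> [->//|[/c]].
split=> //.
- move=> s R sS Rs cR; case: (boolP (R \subset tau)) => Rt.
    have [s1 [s1P y1] [s2 [s2P y2] E]] := ridge_side b Rt cR.
    have Rs1 : R \subset s1.
      have : s1 \in star Phi R by rewrite E !inE eqxx.
      by rewrite inE => /andP[].
    suff -> : star (side b) R = [set tau; s1].
      rewrite cards2 (_ : tau != s1) //.
      by apply: contraNneq tau_missing => ->.
    apply/setP=> u; rewrite inE in_set2; apply/andP/orP => [[uS Ru]|].
      case/sideP: uS => [->|[uP yu]]; first by left.
      have : u \in star Phi R by rewrite inE uP.
      rewrite E in_set2 => /orP[/eqP->|/eqP uE]; first by right.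
      by move: yu; rewrite uE y2; case: b {y1 y2 cS sS}.
    case=> /eqP->; first by split=> //; apply/sideP; left.
    by split=> //; apply/sideP; right.
  have sP : s \in Phi.
    by case/sideP: sS Rs => [->|[]//]; rewrite (negPf Rt).
  have ysb : y s = b by case/sideP: sS => [E|[]//]; rewrite E (negPf Rt) in Rs.
  case: psP => _ H2 _; rewrite -(H2 s R sP Rs cR); apply: eq_card => u.
  rewrite [LHS]inE [RHS]inE; case Ru: (R \subset u); rewrite ?andbF ?andbT //.
  apply/sideP/idP => [[E|[]//]|uP].
    by rewrite E (negPf Rt) in Ru.
  right; split=> //; rewrite -ysb.
  by apply: (side_const Rt); rewrite inE ?sP ?uP ?Rs ?Ru.
move=> G P clP; have sym := closed_adj_eq (@ridge_adj_sym _ d) clP.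
case: (boolP (G \subset tau)) => Gt; last first.
  move=> s s' sS s'S.
  have inP u : u \in star (side b) G -> u \in star Phi G /\ y u = b.
    rewrite inE => /andP[/sideP[->|[uP yu]]]; first by rewrite (negPf Gt).
    by move=> Gu; rewrite inE uP.
  have [sP ys] := inP _ sS; have [s'P _] := inP _ s'S.
  apply: (L G P) => // u v uS vS uv; apply: clP => //; rewrite inE.
    move: (uS); rewrite inE => /andP[uP ->]; rewrite andbT; apply/sideP; right.
    by split=> //; rewrite -ys (side_const Gt uS sP).
  move: (vS); rewrite inE => /andP[vP ->]; rewrite andbT; apply/sideP; right.
  by split=> //; rewrite -ys (side_const Gt vS sP).
have tauS : tau \in star (side b) G by rewrite inE Gt andbT; apply/sideP; left.
suff Pt s : s \in star (side b) G -> P s = P tau.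
  by move=> s s' /Pt -> /Pt ->.
rewrite inE => /andP[/sideP[->//|[sP ys]] Gs].
apply/eqP/negPn/negP => nP.
have cG : #|G| < d.
  rewrite -(c _ sP); apply: proper_card; rewrite properEneq Gs andbT.
  apply: contraNneq tau_missing => Gse; rewrite Gse in Gt.
  by rewrite -(_ : s = tau) //; apply/eqP; rewrite eqEcard Gt tau_card (c _ sP) /=.
(* A facet at a ridge inside [tau] is adjacent to [tau]. If [s] were not joined to [tau], its
   component would thus never touch such a ridge, hence would be closed in the whole star of [G];
   yet that star contains a facet of the other class. *)
have Q : {in star Phi G &, forall u v, ridge_adj d u v ->
    (y u == b) && (P u == P s) -> (y v == b) && (P v == P s)}.
  move=> u v; rewrite !inE => /andP[uP Gu] /andP[vP Gv] uv /andP[/eqP yu /eqP Pu].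
  have uS : u \in star (side b) G by rewrite inE Gu andbT; apply/sideP; right.
  have yuv := yP uP vP uv; case: (boolP (u :&: v \subset tau)) yuv => It yuv.
    case/negP: nP; rewrite -Pu; apply/eqP; apply: sym => //.
    rewrite /ridge_adj (_ : u :&: tau = u :&: v) //; apply/esym/eqP.
    rewrite eqEcard subsetI subsetIl It /= (eqP uv) -ltnS prednK //.
    rewrite -(c _ uP); apply: proper_card; rewrite properEneq subsetIl andbT.
    apply: contraNneq tau_missing => /setIidPl ut.
    by rewrite -(_ : u = tau) //; apply/eqP; rewrite eqEcard ut tau_card (c _ uP) /=.
  have yv : y v = b by apply/esym/eqP; rewrite -negb_add -yu yuv.
  have vS : v \in star (side b) G by rewrite inE Gv andbT; apply/sideP; right.
  by rewrite yv eqxx -Pu eq_sym; apply/eqP; apply: sym.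
have [R /andP[Rt GR] cR] := proper_tau_face Gt cG.
have [s1 [s1P y1] [s2 [s2P y2] E]] := ridge_side b Rt cR.
have s2R : s2 \in star Phi R by rewrite E !inE eqxx orbT.
have s2G : s2 \in star Phi G.
  by move: s2R; rewrite !inE => /andP[-> /(subset_trans GR)].
have sG : s \in star Phi G by rewrite inE sP.
have := L G _ Q s s2 sG s2G; rewrite ys !eqxx y2 => /(_ isT).
by rewrite -negb_add addNb addbb.
Qed.

Lemma side_tris_both T b e : e \in pairs (tris kappa (side b) set0 T) ->
  e \in pairs (tris kappa (side (~~ b)) set0 T) -> e \subset tau.
Proof.
case/pairsT=> _ [s]; rewrite inE => /andP[/sideP[->|[sP ys]] _] es.
  by move=> _; apply: subset_trans es (subsetIl _ _).
case/pairsT=> _ [s']; rewrite inE => /andP[/sideP[->|[s'P ys']] _] es'.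
  by apply: subset_trans es' (subsetIl _ _).
apply/negPn/negP => et.
have : y s = y s'.
  apply: (side_const et); rewrite inE ?sP ?s'P.
    exact: subset_trans es (subsetIl _ _).
  exact: subset_trans es' (subsetIl _ _).
by rewrite ys ys'; case: b {ys ys'}.
Qed.

(** The sides share the three vertices and at most the three edges of [tau] in these colours. Hence
    their vertex counts add up to at least n + 3 and their edge counts to at most e + 3 <= 3(n + 3)
    - 12, leaving no slack above the lower bounds 3n_b - 6. *)
Lemma side_tight b : tight kappa (side b).
Proof.
move=> T T3; pose C := colored_in kappa T.
pose c b' := cover (tris kappa (side b') set0 T).
pose p b' := pairs (tris kappa (side b') set0 T).
have tauS b' : tau \in side b' by apply/sideP; left.
have cT : #|tau :&: C| = 3 by rewrite (card_colored (side_pseudo true) (@side_rainbow true)).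
have low b' : 3 * #|c b'| <= #|p b'| + 6.
  apply: (rigid_lower (t := tau :&: C)) => //.
    apply: (rigid_tris (side_pseudo b') (@side_rainbow b') T3).
    exact: disjoint0_colored.
  by apply: imset_f; rewrite inE tauS sub0set.
have hc : #|cover (tris kappa Phi set0 T)| + 3 <= #|c b| + #|c (~~ b)|.
  rewrite -cardsUI -cT; apply: leq_add; apply: subset_leq_card.
    apply/subsetP=> x /coverT[s]; rewrite inE => /andP[sP _] [xs xT].
    rewrite inE; case: (eqVneq (y s) b) => yb; apply/orP; [left|right];
      apply/coverT; exists s => //; rewrite inE sub0set andbT; apply/sideP; right=> //.
    by split=> //; move: yb; case: b; case: (y s).
  apply/subsetP=> x; rewrite !in_setI => /andP[xt xC]; apply/andP; split;
    apply/coverT; (exists tau; first by rewrite in_set tauS sub0set);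
    by split=> //; move: xC; rewrite inE.
have hp : #|p b| + #|p (~~ b)| <= #|pairs (tris kappa Phi set0 T)| + 3.
  rewrite -cardsUI; apply: leq_add.
    apply: subset_leq_card; rewrite subUset; apply/andP; split;
      apply/subsetP=> e /pairsT[ce [s]]; rewrite inE => /andP[/sideP[sE|[sP _]] _] es;
      apply/pairsT; split=> //; try by exists s; rewrite // inE sP sub0set.
    - have /dclP[u uP eu] : e \in dcl Phi.
        apply: proper_tau_dcl; last by rewrite ce (leq_trans _ d4).
        by rewrite -sE; apply: subset_trans es (subsetIl _ _).
      exists u; first by rewrite inE uP sub0set.
      by rewrite subsetI eu; apply: subset_trans es (subsetIr _ _).
    - have /dclP[u uP eu] : e \in dcl Phi.
        apply: proper_tau_dcl; last by rewrite ce (leq_trans _ d4).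
        by rewrite -sE; apply: subset_trans es (subsetIl _ _).
      exists u; first by rewrite inE uP sub0set.
      by rewrite subsetI eu; apply: subset_trans es (subsetIr _ _).
  have <- : #|[set e : {set V} | e \subset tau :&: C & #|e| == 2]| = 3.
    by rewrite cards_draws cT.
  apply: subset_leq_card; apply/subsetP=> e; rewrite inE => /andP[e1 e2].
  have et := side_tris_both e1 e2; case/pairsT: e1 => ce [s _ es].
  by rewrite inE ce subsetI et; apply/andP; split=> //; apply: subset_trans es (subsetIr _ _).
have := low b; have := low (~~ b); have := tightP T3.
rewrite -/(c b) -/(p b); move: hc hp; clear.
move: #|c b| #|p b| #|c _| #|p _| #|cover _| #|pairs _| => a1 a2 a3 a4 a5 a6; lia.
Qed.

(** A facet of the other class has a vertex off [tau], and by [side_const] that vertex is in no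
    facet of class [b]. This makes the decomposition terminate. *)
Lemma side_cover_lt b : #|cover (side b)| < #|cover Phi|.
Proof.
have tauC : tau \subset cover Phi.
  apply/subsetP=> x xt; have /dclP[s sP xs] : [set x] \in dcl Phi.
    by apply: proper_tau_dcl; rewrite ?sub1set // cards1 (leq_trans _ d4).
  by apply/coverP; exists s => //; rewrite -sub1set.
apply: proper_card; apply/properP; split.
  apply/subsetP=> x /coverP[s /sideP[->|[sP _]] xs]; first exact: (subsetP tauC).
  by apply/coverP; exists s.
have c0 : #|set0 : {set V}| < d by rewrite cards0.
have [R /andP[Rt _] cR] := proper_tau_face (sub0set tau) c0.
have [s1 _ [s2 [s2P y2] E]] := ridge_side b Rt cR.
have [z zs zt] : exists2 z, z \in s2 & z \notin tau.
  apply/subsetPn; apply: contraNN tau_missing => st.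
  have [c _ _] := psP.
  by rewrite -(_ : s2 = tau) //; apply/eqP; rewrite eqEcard st tau_card (c _ s2P) /=.
exists z; first by apply/coverP; exists s2.
apply/negP => /coverP[s /sideP[sE|[sP ys]] zs']; first by rewrite -sE zs' in zt.
have : y s = y s2.
  by apply: (@side_const [set z]); rewrite ?inE ?sub1set ?sP ?s2P.
by rewrite ys y2 => /eqP; rewrite -negb_add addbN addbb.
Qed.

End Sides.
End MissingFacet.

(** * The case without missing facets *)

Section Flag.
Variables (V : finType) (d : nat) (kappa : V -> 'I_d) (Phi : {set {set V}}).
Implicit Types (E F G H K R s t e : {set V}) (T : {set 'I_d}) (k l : 'I_d).
Hypothesis psP : pseudo d Phi.
Hypothesis rainbow : forall s, s \in Phi -> {in s &, injective kappa}.
Hypothesis tightP : tight kappa Phi.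
Hypothesis d4 : 4 <= d.
Hypothesis Phi0 : Phi != set0.
Hypothesis no_missing : forall tau : {set V}, #|tau| = d ->
  (forall R, R \subset tau -> #|R| = d.-1 -> R \in dcl Phi) -> tau \in Phi.

Let d0 : 0 < d. Proof. exact: leq_trans d4. Qed.
Let cardP s : s \in Phi -> #|s| = d. Proof. by case: psP => c _ _; exact: c. Qed.

(** Fewer than [d] vertices are covered by [clique_face]. With [d] vertices all ridges are faces and
    [no_missing] applies; the colours, distinct on a clique, exclude more. *)
Lemma flag_face K :
  (forall x y, x \in K -> y \in K -> [set x; y] \in dcl Phi) -> K \in dcl Phi.
Proof.
move=> cl.
have kinj : {in K &, injective kappa}.
  move=> u v uK vK; have /dclP[s sP] := cl u v uK vK.
  by rewrite subUset !sub1set => /andP[us vs]; exact: (rainbow sP).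
have : #|K| <= d by rewrite -(card_in_imset kinj) -[leqRHS]card_ord max_card.
rewrite leq_eqVlt => /orP[/eqP cK|cK]; last exact: (clique_face psP rainbow tightP).
apply/dclP; exists K => //; apply: no_missing => // R RK cR.
apply: (clique_face psP rainbow tightP) => //; first by rewrite cR prednK.
by move=> x y xR yR; apply: cl; apply: (subsetP RK).
Qed.

Definition link_color E k : {set V} :=
  [set x | (kappa x == k) && (x |: E \in dcl Phi)].

Lemma link_colorP E k x : reflect (kappa x = k /\ exists2 s, s \in star Phi E & x \in s)
  (x \in link_color E k).
Proof.
rewrite inE; apply: (iffP andP) => [[/eqP kx /dclP[s sP]]|[kx [s sS xs]]].
  rewrite subUset sub1set => /andP[xs Es]; split=> //; exists s => //.
  by rewrite inE sP.
rewrite kx; split=> //; apply/dclP; exists s; move: sS; rewrite inE => /andP[] //.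
by rewrite subUset sub1set xs.
Qed.

Lemma link_colorS E G k : E \subset G -> link_color G k \subset link_color E k.
Proof.
move=> EG; apply/subsetP=> x /link_colorP[kx [s sS xs]]; apply/link_colorP.
by split=> //; exists s => //; move: sS; rewrite !inE => /andP[-> /(subset_trans EG)].
Qed.

Lemma across_color s k : s \in Phi -> exists s' x x',
  [/\ s' \in Phi, ridge_adj d s s', s :\: s' = [set x], s' :\: s = [set x'] &
      kappa x = k /\ kappa x' = k].
Proof.
move=> sP; have [x xs kx] := rainbow_full psP rainbow k sP.
have cR : #|s :\ x| = d.-1 by have := cardsD1 x s; rewrite xs cardP // => ->.
have [s' [s'P n Rs' _]] := pseudo_across psP sP (subsetDl s [set x]) cR.
have I := adj_ridge psP sP s'P n (subsetDl s [set x]) Rs' cR.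
have ss' : ridge_adj d s s' by rewrite /ridge_adj I cR.
have [u [u' [Eu Eu' ku]]] := adj_witness psP rainbow d0 sP s'P ss'.
have ux : u = x.
  have : u \in s :\: s' by rewrite Eu inE.
  rewrite inE => /andP[us' us]; apply/eqP/negPn/negP => ux.
  by have := subsetP Rs' u; rewrite !inE ux us (negPf us') => /(_ isT).
by exists s', u, u'; split=> //; rewrite -ku ux.
Qed.

Lemma link_color_ge2 E k : E \in dcl Phi -> k \notin kappa @: E ->
  2 <= #|link_color E k|.
Proof.
move=> /dclP[s sP Es] kE; have [s' [x [x' [s'P ss' Ex Ex' [kx kx']]]]] := across_color k sP.
have : x \in s :\: s' by rewrite Ex inE.
have : x' \in s' :\: s by rewrite Ex' inE.
rewrite !inE => /andP[x's x's'] /andP[xs' xs].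
have Es' : E \subset s'.
  apply/subsetP=> z zE; apply/negPn/negP => zs'.
  have : z \in s :\: s' by rewrite inE zs' (subsetP Es).
  by rewrite Ex inE => /eqP zx; case/negP: kE; rewrite -kx -zx imset_f.
have -> : 2 = #|[set x; x']|.
  by rewrite cards2; case: eqP x's => // <-; rewrite xs.
apply: subset_leq_card; rewrite subUset !sub1set; apply/andP; split; apply/link_colorP.
  by split=> //; exists s; rewrite // inE sP.
by split=> //; exists s'; rewrite // inE s'P.
Qed.

(** The link of [G] is a 2-coloured cycle whose edges are the facets over [G], and each edge has one
    end of colour [k]. So both colours occur equally often. *)
Lemma star_codim2 G k : #|G| + 2 = d -> k \notin kappa @: G ->
  #|star Phi G| = 2 * #|link_color G k|.
Proof.
move=> cG kG.
transitivity (\sum_(x in link_color G k) #|star Phi (x |: G)|); last first.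
  rewrite (eq_bigr (fun=> 2)) ?sum_nat_const 1?mulnC // => x /link_colorP[kx [s]].
  rewrite inE => /andP[sP Gs] xs; case: psP => _ H2 _; apply: (H2 s) => //.
    by rewrite subUset sub1set xs.
  rewrite cardsU1; have -> : x \notin G by apply: contra kG => xG; rewrite -kx imset_f.
  by rewrite -cG addn2 add1n.
under [RHS]eq_bigr => x _ do rewrite -sum1_card.
rewrite (exchange_big_dep (fun s => s \in star Phi G)) /=; last first.
  by move=> x s _; rewrite !inE subUset => /and3P[-> _ ->].
rewrite -sum1_card; apply: eq_bigr => s sS.
rewrite sum1_card; have sP : s \in Phi by move: sS; rewrite inE => /andP[].
rewrite -[LHS](cards1 k) -(card_colored psP rainbow [set k] sP); apply: eq_card => x.
have Gs : G \subset s by move: sS; rewrite inE => /andP[].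
rewrite [in RHS]unfold_in in_setI inE in_set1 [s \in _]in_set sP subUset sub1set Gs andbT /=.
case xs: (x \in s); rewrite ?andbF ?andbT //=; case: eqP => kx.
  by apply/esym/link_colorP; split=> //; exists s.
by apply/esym/negP => /link_colorP[].
Qed.

(** In the link of [F] the degrees sum to 2e <= 6n - 12, so some vertex has degree below 6. Its link
    is a cycle with equally many, and at least two, vertices of each of two colours, so the degree
    is 4. *)
Lemma exists_degree4 F : F \in dcl Phi -> #|F| + 3 = d ->
  exists2 c, c \notin F /\ c |: F \in dcl Phi &
    forall k, k \notin kappa @: (c |: F) -> #|link_color (c |: F) k| = 2.
Proof.
move=> FP cF; have [T3 FT trE] := tris_codim3 psP rainbow FP cF.
have [tF _] := tight_star psP rainbow tightP T3 FT FP; rewrite trE in tF.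
have lkP : pseudo 3 (lkf Phi F) by exact: pseudo_lkf psP cF.
set S := lkf Phi F in tF lkP *.
have [c3 _ _] := lkP.
have tC t : t \in S -> t :&: cover S = t by move=> tS; apply/setIidPl; exact: sub_cover.
have := surface_count lkP (cover S).
have -> : meeting (cover S) (pairs S) = pairs S.
  apply/setP=> e; rewrite in_set; case eS: (e \in pairs S) => //=.
  by rewrite (setIidPl (pair_cover eS)); case/pairsP: eS => ->.
have -> : meeting1 (cover S) S = set0.
  by apply/setP=> t; rewrite in_set in_set0; case tS: (t \in S); rewrite //= tC // c3.
have -> : meeting (cover S) S = S.
  by apply/setP=> t; rewrite in_set; case tS: (t \in S); rewrite //= tC // c3.
rewrite cards0 addn0 => eT.
have sumE : \sum_(c in cover S) #|star S [set c]| = 3 * #|S|.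
  under eq_bigr => c _ do rewrite -sum1_card.
  rewrite (exchange_big_dep (fun t => t \in S)) /=; last first.
    by move=> c t _; rewrite inE => /andP[].
  rewrite mulnC -sum_nat_const; apply: eq_bigr => t tS; rewrite sum1_card -(c3 t tS).
  apply: eq_card => c; rewrite unfold_in [t \in _]in_set tS sub1set /=.
  case ct: (c \in t); rewrite ?andbF //= andbT.
  by apply/coverP; exists t.
have [c cC small] : exists2 c, c \in cover S & #|star S [set c]| < 6.
  case: (boolP [exists c in cover S, #|star S [set c]| < 6]) => [/exists_inP//|].
  move/exists_inPn => N; exfalso.
  have : \sum_(c in cover S) 6 <= \sum_(c in cover S) #|star S [set c]|.
    by apply: leq_sum => c /N; rewrite -leqNgt.
  rewrite sumE sum_nat_const; move: eT tF; clear.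
  by move: #|S| #|cover S| #|pairs S| => a b c; lia.
have /coverP[t tS ct] := cC.
have := tS; rewrite inE => /andP[tF' tP].
have cnF : c \notin F.
  by apply/negP => cF'; move: tF'; rewrite -setI_eq0 => /eqP/setP/(_ c); rewrite !inE ct cF'.
have cFP : c |: F \in dcl Phi.
  by apply/dclP; exists (t :|: F) => //; rewrite setSU // sub1set.
exists c => // k kF.
have c2 : #|c |: F| + 2 = d by rewrite cardsU1 cnF -[RHS]cF add1n addSnnS.
have := link_color_ge2 cFP kF; have := star_codim2 c2 kF.
have <- : #|star S [set c]| = #|star Phi (c |: F)|.
  rewrite star_lkfE; last by rewrite disjoints1.
  rewrite card_in_imset // => s s'.
  rewrite !inE !subUset => /and3P[_ _ /subsetP Fs] /and3P[_ _ /subsetP Fs'] E.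
  apply/setP=> x; case xF: (x \in F); first by rewrite Fs ?Fs'.
  by have /setP/(_ x) := E; rewrite !inE xF.
move: small; clear; move: #|star _ _| #|link_color _ _| => a b; lia.
Qed.

(** Surface links have no missing triangle, as [surface_strict] demands. Any two vertices leave out
    a vertex of [t], so they already lie together over an edge of [t]. *)
Lemma lkf_flag F t : #|F| + 3 = d -> #|t| = 3 ->
  (forall e, e \subset t -> #|e| = 2 -> e \in pairs (lkf Phi F)) -> t \in lkf Phi F.
Proof.
move=> cF c3 edg.
have drop z : z \in t -> t :\ z \in pairs (lkf Phi F).
  move=> zt; apply: edg; first exact: subsetDl.
  by have := cardsD1 z t; rewrite zt c3 add1n => -[<-].
have avoid x y : exists2 z, z \in t & z \notin [set x; y].
  apply/subsetPn; apply: contraL (leqnn 3) => /subset_leq_card.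
  by rewrite c3 cards2 -ltnNge; case: (x != y).
have tF : [disjoint t & F].
  rewrite -setI_eq0; apply/eqP/setP=> x; rewrite !inE; apply/negP=> /andP[xt xF].
  have [z zt] := avoid x x; rewrite setUid inE => zx.
  have /pairsP[_ [u]] := drop z zt; rewrite inE => /andP[uF _] /subsetP/(_ x).
  rewrite !inE eq_sym zx xt => /(_ isT) xu.
  by move: uF; rewrite -setI_eq0 => /eqP/setP/(_ x); rewrite !inE xu xF.
have /dclP[s sP ts] : t :|: F \in dcl Phi.
  apply: flag_face => x y xK yK; have [z zt zxy] := avoid x y.
  have /pairsP[_ [u]] := drop z zt; rewrite inE => /andP[_ uP] zu.
  have sub v : v \in [set x; y] -> v \in t :|: F -> v \in u :|: F.
    move=> vxy; rewrite !in_setU => /orP[vt|->]; last by rewrite orbT.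
    rewrite (subsetP zu) // in_setD1 vt andbT.
    by apply: contraNneq zxy => <-.
  apply/dclP; exists (u :|: F) => //; rewrite subUset !sub1set.
  by rewrite !sub // !inE eqxx ?orbT.
rewrite inE tF (_ : t :|: F = s) //; apply/eqP; rewrite eqEcard ts cardP //=.
by rewrite card_setU_disjoint // c3 addnC cF.
Qed.

(** The two facets over [a |: G] have different vertices of colour [k], and only [w] and [w'] are
    available, so both occur. *)
Lemma twin_face G k l w w' a : #|G| + 2 = d -> k \notin kappa @: G ->
  l \notin kappa @: G -> k != l -> link_color G k = [set w; w'] ->
  a \in link_color G l -> w |: (a |: G) \in Phi.
Proof.
move=> cG kG lG kl vkE.
have [kw _] : kappa w = k /\ exists2 s, s \in star Phi G & w \in s.
  by apply/link_colorP; rewrite vkE !inE eqxx.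
move=> /link_colorP[ka [s]]; rewrite inE => /andP[sP Gs] as_.
have [s' [x [x' [s'P ss' Ex Ex' [kx kx']]]]] := across_color k sP.
have sub : a |: G \subset s :&: s'.
  rewrite subsetI subUset sub1set as_ Gs /=; apply/subsetP=> z zG.
  apply/negPn/negP => zs'; have : z \in s :\: s'.
    rewrite inE zs' /=; move: zG; rewrite in_setU1 => /orP[/eqP->//|]; exact: (subsetP Gs).
  rewrite Ex inE => /eqP zx; move: zG; rewrite zx in_setU1 => /orP[/eqP xa|xG].
    by case/negP: kl; rewrite -kx xa ka.
  by case/negP: kG; rewrite -kx imset_f.
have : x \in s :\: s' by rewrite Ex inE.
have : x' \in s' :\: s by rewrite Ex' inE.
rewrite !inE => /andP[x's x's'] /andP[xs' xs].
have inw u z : u \in Phi -> a |: G \subset u -> z \in u -> kappa z = k -> (z == w) || (z == w').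
  move=> uP Gu zu kz; rewrite -in_set2 -vkE; apply/link_colorP; split=> //.
  by exists u => //; rewrite inE uP; apply: subset_trans Gu; exact: subsetUr.
have big u : u \in Phi -> a |: G \subset u -> w \in u -> w |: (a |: G) = u.
  move=> uP Gu wu; apply/eqP; rewrite eqEcard subUset sub1set wu Gu /=.
  have aG : a \notin G by apply: contra lG => aG; rewrite -ka imset_f.
  have waG : w \notin a |: G.
    rewrite in_setU1 negb_or; apply/andP; split.
      by apply: contraNneq kl => wa; rewrite -kw wa ka.
    by apply: contra kG => wG; rewrite -kw imset_f.
  by rewrite !cardsU1 waG aG cardP // -cG addnC.
have subs : a |: G \subset s by apply: subset_trans sub (subsetIl _ _).
have subs' : a |: G \subset s' by apply: subset_trans sub (subsetIr _ _).
case/orP: (inw s x sP subs xs kx) => /eqP xE; first by rewrite (big s) // -xE.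
case/orP: (inw s' x' s'P subs' x's' kx') => /eqP x'E; first by rewrite (big s') // -x'E.
by case/negP: x's; rewrite x'E -xE.
Qed.

(** The link of [G] is a 4-cycle w, a, w', a'. The links of [w |: E] and [w' |: E] are surfaces in
    the same three colours that share the triangles over [a] and [a'], so their union is rigid and
    tight. The vertices of the first link missing from the second meet at most three edges each on
    average; [surface_strict], with [a'] as the extra vertex, demands more unless there are none. *)
Lemma twin_cover E G k w w' : #|E| + 4 = d -> E \subset G -> #|G| + 2 = d ->
  k \notin kappa @: G -> w != w' -> link_color G k = [set w; w'] ->
  cover (lkf Phi (w |: E)) \subset cover (lkf Phi (w' |: E)).
Proof.
move=> cE EG cG kG ww' vk.
have wk : w \in link_color G k by rewrite vk !inE eqxx.
have w'k : w' \in link_color G k by rewrite vk !inE eqxx orbT.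
have [kw [s sS ws]] := link_colorP _ _ _ wk.
have [kw' _] := link_colorP _ _ _ w'k.
have GP : G \in dcl Phi.
  by move: sS; rewrite inE => /andP[sP Gs]; apply/dclP; exists s.
have kinjG : {in G &, injective kappa}.
  move: sS; rewrite inE => /andP[sP /subsetP Gs] x y xG yG.
  by apply: (rainbow sP); exact: Gs.
have [l lG lk] : exists2 l, l \notin kappa @: G & k != l.
  have : 0 < #|~: (k |: kappa @: G)|.
    have := cardsC (k |: kappa @: G); rewrite card_ord cardsU1 kG (card_in_imset kinjG) -[in RHS]cG.
    by move: #|~: _| => b; rewrite add1n -addn1 -addnA => /addnI; case: b.
  rewrite card_gt0 => /set0Pn[l]; rewrite in_setC in_setU1 negb_or => /andP[lk lG].
  by exists l; rewrite // eq_sym.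
have l2 : #|link_color G l| = 2.
  have := star_codim2 cG lG; rewrite (star_codim2 cG kG) vk cards2 ww'.
  by move: #|link_color G l| => b; clear; lia.
have /eqP/cards2P[a [a' [aa' vl]]] := l2.
have al : a \in link_color G l by rewrite vl !inE eqxx.
have a'l : a' \in link_color G l by rewrite vl !inE eqxx orbT.
have w'w : w' != w by rewrite eq_sym.
have vk' : link_color G k = [set w'; w] by rewrite vk setUC.
have kE : k \notin kappa @: E by apply: contra kG; apply: subsetP; exact: imsetS.
have lE : l \notin kappa @: E by apply: contra lG; apply: subsetP; exact: imsetS.
have outE x : kappa x = k -> x \notin E by move=> kx; apply: contra kE => xE; rewrite -kx imset_f.
pose Y x := lkf Phi (x |: E).
have Yt x b : x \in [set w; w'] -> b \in link_color G l -> (b |: G) :\: E \in Y x.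
  move=> xw bl; have kx : kappa x = k by move: xw; rewrite in_set2 => /orP[]/eqP->.
  have fx : x |: (b |: G) \in Phi.
    move: xw; rewrite in_set2 => /orP[]/eqP->.
      exact: (twin_face cG kG lG lk vk bl).
    exact: (twin_face cG kG lG lk vk' bl).
  rewrite inE; apply/andP; split.
    rewrite -setI_eq0; apply/eqP/setP=> z; rewrite !inE; apply/negP.
    case/andP=> /andP[zE zbG]; rewrite (negPf zE) orbF => /eqP zx.
    move: zbG; rewrite zx => /orP[/eqP xb|xG].
      have [kb _] := link_colorP _ _ _ bl.
      by case/negP: lk; rewrite -kx xb kb.
    by case/negP: kG; rewrite -kx imset_f.
  suff -> : (b |: G) :\: E :|: (x |: E) = x |: (b |: G) by [].
  apply/setP=> z; rewrite !inE; case zE: (z \in E) => /=; last by rewrite orbF orbC.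
  by rewrite (subsetP EG _ zE) !orbT.
have wi : w \in [set w; w'] by rewrite !inE eqxx.
have w'i : w' \in [set w; w'] by rewrite !inE eqxx orbT.
have FP x : x \in [set w; w'] -> x |: E \in dcl Phi /\ #|x |: E| + 3 = d.
  move=> xw; have kx : kappa x = k by move: xw; rewrite in_set2 => /orP[]/eqP->.
  split; last by rewrite cardsU1 (outE _ kx) -[RHS]cE add1n addSnnS.
  move: xw; rewrite -vk => /link_colorP[_ [u]]; rewrite inE => /andP[uP Gu] xu.
  by apply/dclP; exists u => //; rewrite subUset sub1set xu (subset_trans EG).
have [w1 w2] := FP _ wi; have [w1' w2'] := FP _ w'i.
have [T3 dT trE] := tris_codim3 psP rainbow w1 w2.
have [_ dT' trE'] := tris_codim3 psP rainbow w1' w2'.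
pose T := ~: (kappa @: (w |: E)).
have TE : ~: (kappa @: (w' |: E)) = T by rewrite /T !imsetU1 kw kw'.
rewrite TE in trE' dT'; rewrite -/T in trE dT T3.
have rw : rigid (Y w) by rewrite /Y -trE; exact: rigid_tris.
have rw' : rigid (Y w') by rewrite /Y -trE'; exact: rigid_tris.
have rU : rigid (tris kappa Phi set0 T).
  by apply: (rigid_tris psP rainbow T3); exact: disjoint0_colored.
pose t0 := (a |: G) :\: E.
have t0w : t0 \in Y w by exact: Yt.
have t0w' : t0 \in Y w' by exact: Yt.
have pw : pseudo 3 (Y w) by exact: pseudo_lkf psP w2.
have [c3 _ _] := pw.
have rY := rigid_union rw' rw t0w' t0w.
have subU : Y w' :|: Y w \subset tris kappa Phi set0 T.
  by rewrite subUset /Y -trE -trE' !tris_sub.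
have t0Y : t0 \in Y w' :|: Y w by rewrite in_setU t0w'.
have [tY _] := rigid_sub_tight rU rY subU t0Y (c3 _ t0w) (tightP T3).
rewrite -setD_eq0; apply/negPn/negP => A0.
have := @surface_strict _ (Y w) pw (cover (Y w) :\: cover (Y w')) t0 a'.
have : ~ 3 * #|cover (Y w) :\: cover (Y w')| <
     #|meeting (cover (Y w) :\: cover (Y w')) (pairs (Y w))|.
  have := meeting_new (Y w') (Y w) (cover (Y w)).
  have := rigid_lower rw' t0w' (c3 _ t0w).
  move: tY; rewrite cover_setU.
  have -> : #|cover (Y w') :|: cover (Y w)| =
      #|cover (Y w) :\: cover (Y w')| + #|cover (Y w')|.
    rewrite -{1}(setDUK (subsetUl (cover (Y w')) (cover (Y w)))).
    by rewrite card_setU_disjoint ?disjointDl // setDUl setDv set0U.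
  clear; move: #|cover (Y w)  :\: _| #|cover _| #|meeting _ _| #|pairs _| #|pairs _|.
  by move=> c1 c2 c3 c4 c5; lia.
move=> nlt strict; apply: nlt; apply: strict => //.
- by move=> t; exact: lkf_flag.
- exact: subsetDl.
- apply/eqP; rewrite card_meet0 -setI_eq0; apply/eqP/setP=> x.
  rewrite in_set0 in_setI in_setD; apply/negP=> /and3P[xt xc _].
  by case/negP: xc; apply: subsetP (sub_cover t0w') _ xt.
- apply/coverP; exists ((a' |: G) :\: E); first exact: Yt.
  rewrite !inE eqxx andbT; have [ka' _] := link_colorP _ _ _ a'l.
  by apply: contra lE => a'E; rewrite -ka' imset_f.
- rewrite in_setD negb_and negbK; apply/orP; left.
  apply/coverP; exists ((a' |: G) :\: E); first exact: Yt.
  rewrite !inE eqxx andbT; have [ka' _] := link_colorP _ _ _ a'l.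
  by apply: contra lE => a'E; rewrite -ka' imset_f.
- rewrite in_setD in_setU1 eq_sym (negPf aa') /= negb_and; apply/orP; right.
  have [ka' _] := link_colorP _ _ _ a'l.
  by apply: contra lG => a'G; rewrite -ka' imset_f.
Qed.

(** Every neighbour of [w] in [s] is a neighbour of [w'], so exchanging them keeps a clique, which
    is a face. *)
Lemma twin_swap E w w' s : cover (lkf Phi (w |: E)) \subset cover (lkf Phi (w' |: E)) ->
  kappa w = kappa w' -> w' |: E \in dcl Phi -> s \in Phi -> w |: E \subset s ->
  w' |: (s :\ w) \in Phi.
Proof.
move=> cov kk w'E sP; rewrite subUset sub1set => /andP[ws Es].
have link z : z \in s :\ w -> [set w'; z] \in dcl Phi.
  rewrite in_setD1 => /andP[zw zs]; case: (boolP (z \in E)) => zE.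
    by apply: dclS w'E; rewrite subUset !sub1set !inE eqxx zE orbT.
  have : z \in cover (lkf Phi (w |: E)).
    apply/coverP; exists (s :\: (w |: E)); last by rewrite !inE negb_or zw zE.
    by rewrite inE disjointDl setDUK // subUset sub1set ws.
  move/(subsetP cov)/coverP=> [t]; rewrite inE => /andP[_ tP] zt.
  by apply/dclP; exists (t :|: (w' |: E)); rewrite // subUset !sub1set !inE zt eqxx !orbT.
have w's : w' \notin s :\ w.
  rewrite in_setD1; apply/negP => /andP[w'w w's].
  by case/negP: w'w; apply/eqP; apply: (rainbow sP).
have /dclP[u uP su] : w' |: (s :\ w) \in dcl Phi.
  apply: flag_face => x y; rewrite !in_setU1 => /orP[/eqP->|xs] /orP[/eqP->|ys].
  - by rewrite setUid; apply: dclS w'E; rewrite sub1set !inE eqxx.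
  - exact: link.
  - by rewrite setUC; exact: link.
  - apply/dclP; exists s => //; rewrite subUset !sub1set.
    by move: xs ys; rewrite !in_setD1 => /andP[_ ->] /andP[_ ->].
rewrite (_ : _ |: _ = u) //; apply/eqP; rewrite eqEcard su cardP //=.
rewrite cardsU1 w's; have := cardsD1 w s; rewrite ws (cardP sP) => <-.
by [].
Qed.

(** A ridge step that drops [w] must arrive at the facet with [w] replaced by [w'], as that is the
    second facet on the ridge. Hence every facet over [E] contains one of the twins, and no other
    vertex of their colour occurs. *)
Lemma twins_only E G k : #|E| + 4 = d -> E \subset G -> #|G| + 2 = d ->
  k \notin kappa @: G -> #|link_color G k| = 2 -> #|link_color E k| <= 2.
Proof.
move=> cE EG cG kG /eqP/cards2P[w [w' [ww' vk]]].
have vk' : link_color G k = [set w'; w] by rewrite vk setUC.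
have w'w : w' != w by rewrite eq_sym.
have wk : w \in link_color G k by rewrite vk !inE eqxx.
have w'k : w' \in link_color G k by rewrite vk !inE eqxx orbT.
have inE' x : x \in link_color G k -> kappa x = k /\ x |: E \in dcl Phi.
  case/link_colorP=> kx [u]; rewrite inE => /andP[uP Gu] xu; split=> //.
  by apply/dclP; exists u => //; rewrite subUset sub1set xu (subset_trans EG).
have [kw wE] := inE' _ wk; have [kw' w'E] := inE' _ w'k.
have c1 := twin_cover cE EG cG kG ww' vk.
have c2 := twin_cover cE EG cG kG w'w vk'.
have step u v s s' : cover (lkf Phi (u |: E)) \subset cover (lkf Phi (v |: E)) ->
    kappa u = k -> kappa v = k -> u != v -> v |: E \in dcl Phi ->
    s \in star Phi E -> s' \in star Phi E -> ridge_adj d s s' -> u \in s ->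
    (u \in s') || (v \in s').
  move=> cuv ku kv uv vE; rewrite !inE => /andP[sP Es] /andP[s'P Es'] ss' us.
  have [//|us'] := boolP (u \in s').
  have [x [x' [Ex _ _]]] := adj_witness psP rainbow d0 sP s'P ss'.
  have : u \in s :\: s' by rewrite inE us us'.
  rewrite Ex inE => /eqP ux; subst x.
  have Rs' : s :\ u \subset s :&: s'.
    rewrite -Ex; apply/subsetP=> z; rewrite !inE negb_and negbK => /andP[/orP[|/negPf->//]].
    by move=> -> ->.
  have vs : v |: (s :\ u) \in Phi.
    apply: (twin_swap cuv) => //; first by rewrite ku.
    by rewrite subUset sub1set us.
  have I : s :&: s' = s :\ u.
    apply/eqP; rewrite eqEsubset Rs' andbT; apply/subsetP=> z; rewrite !inE.
    by move=> /andP[-> zs']; rewrite andbT; apply: contraTneq zs' => ->.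
  have [St n] := pseudo_adjI psP sP s'P ss' d0.
  have : v |: (s :\ u) \in star Phi (s :&: s') by rewrite I inE vs subsetUr.
  rewrite St in_set2 => /orP[/eqP h|/eqP <-]; last by rewrite !inE eqxx.
  have vs' : v \in s by rewrite -h !inE eqxx.
  by case/negP: uv; apply/eqP; apply: (rainbow sP) => //; rewrite ku.
have [_ _ L] := psP.
have Q : {in star Phi E &, forall s s', ridge_adj d s s' ->
    (w \in s) || (w' \in s) -> (w \in s') || (w' \in s')}.
  move=> s s' sS s'S ss' /orP[] h.
    exact: (step w w' s s').
  by rewrite orbC; exact: (step w' w s s').
have [u uS wu] : exists2 u, u \in star Phi E & w \in u.
  have /dclP[u uP] := wE; rewrite subUset sub1set => /andP[wu Eu].
  by exists u; rewrite // inE uP.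
have <- : #|[set w; w']| = 2 by rewrite cards2 ww'.
apply: subset_leq_card; apply/subsetP=> x /link_colorP[kx [s sS xs]].
have := L E _ Q u s uS sS; rewrite wu /= => /(_ isT).
have sP : s \in Phi by move: sS; rewrite inE => /andP[].
by rewrite in_set2 => /orP[] h; apply/orP; [left|right]; apply/eqP;
   apply: (rainbow sP); rewrite // kx.
Qed.

Lemma color_complement_face s k l : s \in Phi -> k != l ->
  #|s :\: colored_in kappa [set k; l]| + 2 = d.
Proof.
move=> sP kl; have := cardsID (colored_in kappa [set k; l]) s.
by rewrite (card_colored psP rainbow _ sP) cards2 kl addnC (cardP sP).
Qed.

Lemma codim4_link_color E k : E \in dcl Phi -> #|E| + 4 = d -> k \notin kappa @: E ->
  #|link_color E k| <= 2.
Proof.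
move=> EP cE kE; have /dclP[s sP Es] := EP.
(* In the cycle left by omitting the colours [k'] and [l] from a facet, two vertices of colour [l]
   force two of colour [k'], to which [twins_only] applies. One degree-4 vertex thus settles all
   colours. *)
have spread l k' : l \notin kappa @: E -> k' \notin kappa @: E ->
    #|link_color E l| <= 2 -> #|link_color E k'| <= 2.
  move=> lE k'E l2; case: (eqVneq k' l) => [->//|k'l].
  pose G := s :\: colored_in kappa [set k'; l].
  have cG : #|G| + 2 = d by exact: color_complement_face.
  have EG : E \subset G.
    rewrite subsetD Es -setI_eq0; apply/eqP/setP=> x; rewrite !inE; apply/negP.
    by case/andP=> xE /orP[]/eqP kx; [case/negP: k'E | case/negP: lE]; rewrite -kx imset_f.
  have nG c : c \in [set k'; l] -> c \notin kappa @: G.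
    by move=> cc; apply/imsetP => -[x]; rewrite !inE -in_set2 => /andP[h _] E'; rewrite -E' cc in h.
  have k'G : k' \notin kappa @: G by apply: nG; rewrite !inE eqxx.
  have lG : l \notin kappa @: G by apply: nG; rewrite !inE eqxx orbT.
  have GP : G \in dcl Phi by apply/dclP; exists s => //; exact: subsetDl.
  apply: (twins_only cE EG cG k'G).
  have h1 := star_codim2 cG k'G; have h2 := star_codim2 cG lG.
  have h3 := link_color_ge2 GP lG.
  have h4 := leq_trans (subset_leq_card (link_colorS l EG)) l2.
  move: h3 h4 h2; rewrite h1; clear.
  by move: #|link_color _ _| #|link_color _ _| => a b; lia.
have [x xs xE] : exists2 x, x \in s & x \notin E.
  apply/subsetPn; apply: contraL (leqnn d) => /subset_leq_card; rewrite cardP // => h.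
  by rewrite -ltnNge -[leqRHS]cE (leq_ltn_trans h) // -[leqLHS]addn1 leq_add2l.
have FP : x |: E \in dcl Phi by apply/dclP; exists s; rewrite // subUset sub1set xs.
have cF : #|x |: E| + 3 = d by rewrite cardsU1 xE -[RHS]cE add1n addSnnS.
have [c [cF' cFP] deg] := exists_degree4 FP cF.
have cG : #|c |: (x |: E)| + 2 = d by rewrite cardsU1 cF' -[RHS]cF add1n addSnnS.
have [l lG] : exists l, l \notin kappa @: (c |: (x |: E)).
  have : 0 < #|~: (kappa @: (c |: (x |: E)))|.
    have := cardsC (kappa @: (c |: (x |: E))); rewrite card_ord.
    have := leq_imset_card kappa (c |: (x |: E)); move: cG; clear.
    by move: #|c |: _| #|kappa @: _| #|~: _| => a b e; lia.
  by rewrite card_gt0 => /set0Pn[l]; rewrite in_setC; exists l.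
have EG : E \subset c |: (x |: E) by rewrite setUA subsetUr.
apply: (spread l k) => //; first by apply: contra lG; apply: subsetP; exact: imsetS.
exact: (twins_only cE EG cG lG (deg l lG)).
Qed.

(** By induction, each vertex [u] of a facet over [E], off [E] and not of colour [k], sees exactly
    two vertices of colour [k]. They are those of the facet and of its neighbour across colour [k],
    so they do not depend on [u]; adjacent facets share such a [u], and the pair is the same
    throughout the star. *)
Lemma link_color_le2 n E k : E \in dcl Phi -> #|E| + 4 + n = d ->
  k \notin kappa @: E -> #|link_color E k| <= 2.
Proof.
elim: n E k => [|n IH] E k EP cE kE.
  by apply: codim4_link_color => //; rewrite -[RHS]cE addn0.
have two s u : s \in star Phi E -> u \in s -> u \notin E -> kappa u != k ->
    #|link_color (u |: E) k| = 2.
  move=> sS us uE uk; apply/eqP; rewrite eqn_leq.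
  move: sS; rewrite inE => /andP[sP Es].
  have uP : u |: E \in dcl Phi by apply/dclP; exists s; rewrite // subUset sub1set us.
  have ku : k \notin kappa @: (u |: E).
    by rewrite imsetU1 in_setU1 negb_or eq_sym uk.
  by rewrite link_color_ge2 // IH // cardsU1 uE -[RHS]cE [RHS]addnS.
have same s u v : s \in star Phi E -> u \in s -> u \notin E -> kappa u != k ->
    v \in s -> v \notin E -> kappa v != k ->
    link_color (u |: E) k = link_color (v |: E) k.
  move=> sS us uE uk vs vE vk.
  have cu := two s u sS us uE uk; have cv := two s v sS vs vE vk.
  move: sS; rewrite inE => /andP[sP Es].
  have [s' [x [x' [s'P ss' Ex Ex' [kx kx']]]]] := across_color k sP.
  have : x \in s :\: s' by rewrite Ex inE.
  have : x' \in s' :\: s by rewrite Ex' inE.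
  rewrite !inE => /andP[x's x's'] /andP[xs' xs].
  have sub z : z \in s -> kappa z != k -> z \in s'.
    move=> zs kz; apply/negPn/negP => zs'; have : z \in s :\: s' by rewrite inE zs' zs.
    by rewrite Ex inE => /eqP zx; rewrite zx kx eqxx in kz.
  have Es' : E \subset s'.
    apply/subsetP=> z zE; apply: sub; first exact: (subsetP Es).
    by apply: contraNneq kE => <-; rewrite imset_f.
  have pr z : z \in s -> kappa z != k -> #|link_color (z |: E) k| = 2 ->
      link_color (z |: E) k = [set x; x'].
    move=> zs kz cz; apply/esym/eqP; rewrite eqEcard cz cards2.
    have -> : x != x' by apply: contraNneq x's => <-.
    rewrite andbT subUset !sub1set; apply/andP; split; apply/link_colorP.
      by split=> //; exists s; rewrite // inE sP subUset sub1set zs.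
    by split=> //; exists s'; rewrite // inE s'P subUset sub1set sub.
  by rewrite (pr u) // (pr v).
have pickc s s' : s \in star Phi E -> s' \in star Phi E -> d.-1 <= #|s :&: s'| ->
    exists2 u, u \in s :&: s' & u \notin E /\ kappa u != k.
  rewrite !inE => /andP[sP Es] /andP[s'P Es'] cI.
  have : 0 < #|(s :&: s') :\: E :\: colored_in kappa [set k]|.
    have h1 := cardsID E (s :&: s').
    have h2 := cardsID (colored_in kappa [set k]) ((s :&: s') :\: E).
    have h3 : #|((s :&: s') :\: E) :&: colored_in kappa [set k]| <= 1.
      rewrite -(cards1 k) -(card_colored psP rainbow [set k] sP).
      apply: subset_leq_card; apply: setSI; apply: subset_trans (subsetDl _ _) _.
      exact: subsetIl.
    have h4 : #|(s :&: s') :&: E| <= #|E| by apply: subset_leq_card; exact: subsetIr.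
    have ar (a b c e f g : nat) : a + b = g -> c + e = b -> c <= 1 -> a <= f ->
        (f + 4 + n.+1).-1 <= g -> 0 < e by clear; lia.
    by rewrite -cE in cI; exact: ar h1 h2 h3 h4 cI.
  rewrite card_gt0 => /set0Pn[u]; rewrite !inE => /and3P[h1 h2 h3].
  by exists u; rewrite // inE.
have /dclP[s0 s0P Es0] := EP.
have s0S : s0 \in star Phi E by rewrite inE s0P.
have cI s : s \in star Phi E -> d.-1 <= #|s :&: s|.
  by rewrite setIid inE => /andP[sP _]; rewrite cardP // leq_pred.
have [u0] := pickc s0 s0 s0S s0S (cI _ s0S); rewrite setIid => u0s [u0E u0k].
pose W := link_color (u0 |: E) k.
pose P s := [exists u in s, [&& u \notin E, kappa u != k & link_color (u |: E) k == W]].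
have Q : {in star Phi E &, forall s s', ridge_adj d s s' -> P s -> P s'}.
  move=> s s' sS s'S ss' /exists_inP[u us /and3P[uE uk /eqP uW]].
  have [|v] := pickc s s' sS s'S; first by rewrite (eqP ss').
  rewrite in_setI => /andP[vs vs'] [vE vk]; apply/exists_inP; exists v => //.
  by rewrite vE vk -uW; apply/eqP; exact: (same s v u).
have Ps0 : P s0 by apply/exists_inP; exists u0; rewrite // u0E u0k eqxx.
rewrite -(two s0 u0 s0S u0s u0E u0k) -/W.
apply: subset_leq_card; apply/subsetP=> x /link_colorP[kx [s sS xs]].
have [_ _ L] := psP.
have /exists_inP[u us /and3P[uE uk /eqP <-]] := L E P Q s0 s s0S sS Ps0.
apply/link_colorP; split=> //; exists s => //.
by move: sS; rewrite !inE => /andP[-> Es]; rewrite subUset sub1set us.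
Qed.

Lemma two_vertices k : #|[set x | (kappa x == k) && ([set x] \in dcl Phi)]| = 2.
Proof.
have E0 : set0 \in dcl Phi.
  by have /set0Pn[s sP] := Phi0; apply/dclP; exists s; rewrite ?sub0set.
have k0 : k \notin kappa @: set0 by rewrite imset0 inE.
have -> : [set x | (kappa x == k) && ([set x] \in dcl Phi)] = link_color set0 k.
  by apply/setP=> x; rewrite !in_set setU0.
apply/eqP; rewrite eqn_leq link_color_ge2 // andbT.
by apply: (@link_color_le2 (d - 4)) => //; rewrite cards0 subnKC.
Qed.

(** A facet is a choice of one of two vertices per colour. Crossing a ridge flips a single choice,
    so from one facet all choices are reached. *)
Lemma flag_cross_polytope :
  colored_iso (cross_polytope d) (ColoredComplex (dcl Phi) kappa).
Proof.
have [|f fP] := fin_all_exists (P := fun k (g : bool -> V) => g true != g false /\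
    [set x | (kappa x == k) && ([set x] \in dcl Phi)] = [set g true; g false]).
  move=> k; have /eqP/cards2P[u [v [uv E]]] := two_vertices k.
  by exists (fun b => if b then u else v).
pose h (p : 'I_d * bool) := f p.1 p.2.
have hk p : kappa (h p) = p.1.
  have [_ /setP/(_ (h p))] := fP p.1; rewrite in_set in_set2.
  by rewrite /h; case: p.2; rewrite eqxx ?orbT => /andP[/eqP].
have hinj : injective h.
  move=> [i b] [i' b'] E; have := hk (i, b); rewrite E hk /= => ii; subst i'.
  move: E; rewrite /h /=; have [n _] := fP i.
  by case: b; case: b' => // E; move: n; rewrite E eqxx.
have hsurj x : [set x] \in dcl Phi -> exists b, x = h (kappa x, b).
  move=> xP; have [_ /setP/(_ x)] := fP (kappa x); rewrite in_set eqxx xP in_set2.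
  by case/esym/orP=> /eqP E; [exists true | exists false].
pose pk (q : {ffun 'I_d -> bool}) := [set h (i, q i) | i : 'I_d].
have vert s x : s \in Phi -> x \in s -> [set x] \in dcl Phi.
  by move=> sP xs; apply/dclP; exists s; rewrite ?sub1set.
have pkP s : s \in Phi -> exists q, s = pk q.
  move=> sP; exists [ffun i => h (i, true) \in s].
  have cpk q : #|pk q| = d.
    by rewrite card_imset ?card_ord // => i i' /hinj[].
  apply/eqP; rewrite eqEcard cpk cardP // leqnn andbT.
  apply/subsetP=> x xs; have [b xE] := hsurj x (vert s x sP xs).
  apply/imsetP; exists (kappa x) => //; rewrite ffunE {1}xE; congr (h (_, _)).
  case: b xE => xE; first by rewrite -xE xs.
  apply/esym/negP => ts.
  have := rainbow sP ts xs; rewrite hk /= => /(_ erefl).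
  by rewrite [RHS]xE => /hinj.
have mempk q i b : (h (i, b) \in pk q) = (q i == b).
  apply/imsetP/eqP => [[i' _ /hinj[-> ->]]|<-] //.
  by exists i.
have flip q i : pk q \in Phi -> pk [ffun i' => (i' == i) (+) q i'] \in Phi.
  move=> qP; have [s' [x [x' [s'P ss' Ex Ex' [kx kx']]]]] := across_color i qP.
  have [q' E'] := pkP s' s'P; rewrite E' in s'P Ex Ex' ss'.
  suff -> : [ffun i' => (i' == i) (+) q i'] = q' by [].
  apply/ffunP=> i'; rewrite ffunE.
  have xs : x \in pk q :\: pk q' by rewrite Ex inE.
  case: (eqVneq i' i) => [->|n] /=.
    move: xs; rewrite inE => /andP[xq' /imsetP[i1 _ xE]].
    move: kx; rewrite xE hk /= => i1E; move: xq'; rewrite xE i1E mempk.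
    by case: (q i); case: (q' i).
  apply/esym/eqP; rewrite -mempk; apply/negPn/negP => nq.
  have : h (i', q i') \in pk q :\: pk q' by rewrite inE nq mempk eqxx.
  by rewrite Ex inE => /eqP E; move: kx; rewrite -E hk /= => /eqP; rewrite (negPf n).
have allpk q : pk q \in Phi.
  have /set0Pn[s sP] := Phi0; have [q0 E0] := pkP s sP; rewrite E0 in sP.
  have [n] := ubnP #|[set i | q0 i != q i]|; elim: n q0 sP {E0} => // n IH q0 q0P le.
  have [E|[i iD]] := set_0Vmem [set i | q0 i != q i].
    suff -> : q = q0 by []; apply/ffunP=> i; apply/esym/eqP/negPn/negP => h'.
    by move/setP/(_ i): E; rewrite !inE h'.
  apply: (IH [ffun i' => (i' == i) (+) q0 i']); first exact: flip.
  rewrite -ltnS; apply: leq_trans le; rewrite ltnS; apply: proper_card.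
  apply/properP; split.
    apply/subsetP=> i'; rewrite !inE ffunE; case: (eqVneq i' i) => [->|] //= _.
    by move: iD; rewrite inE.
  exists i => //; rewrite inE ffunE eqxx /=; move: iD; rewrite inE.
  by case: (q0 i); case: (q i).
exists h; split.
- by move=> x y _ _; exact: hinj.
- by move=> x _; exact: hk.
apply/setP=> H; apply/imsetP/idP => [[F]|/dclP[s sP Hs]].
  rewrite in_set => /forallP cr ->; apply/dclP.
  exists (pk [ffun i => (i, true) \in F]); first exact: allpk.
  apply/subsetP=> _ /imsetP[[i b] iF ->]; rewrite mempk ffunE.
  by have := cr i; move: iF; case: b => [->|->] //; rewrite andbT => /negPf->.
exists [set p | h p \in H].
  rewrite in_set; apply/forallP => i; apply/negP; rewrite !inE => /andP[h1 h2].
  have := rainbow sP (subsetP Hs _ h1) (subsetP Hs _ h2); rewrite !hk => /(_ erefl).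
  by move/hinj.
apply/setP=> x; apply/idP/imsetP => [xH|[p]]; last by rewrite inE => ? ->.
have [b xE] := hsurj x (vert s x sP (subsetP Hs _ xH)).
by exists (kappa x, b); rewrite // inE -xE.
Qed.

End Flag.

(** * Stacked spheres *)

Section Stacking.
Variables (V : finType) (d : nat) (kappa : V -> 'I_d).
Implicit Types (Phi : {set {set V}}) (F G H R s tau : {set V}).
Hypothesis d4 : 4 <= d.

Lemma facet_dcl Phi s : pseudo d Phi -> s \in Phi -> facet (dcl Phi) s.
Proof.
move=> [c _ _] sP; apply/maxsetP; split; first by apply/dclP; exists s.
move=> B /dclP[u uP Bu] sB; have su := subset_trans sB Bu.
have E : s = u by apply/eqP; rewrite eqEcard su !c /=.
by apply/eqP; rewrite eqEsubset sB andbT E.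
Qed.

(** Both sides live on [V] and are glued along [tau] by the identity; the isomorphism folds [V + V]
    back to [V]. *)
Lemma sides_connected_sum Phi tau y :
  pseudo d Phi -> (forall s, s \in Phi -> {in s &, injective kappa}) ->
  #|tau| = d -> (forall R, R \subset tau -> #|R| = d.-1 -> R \in dcl Phi) ->
  tau \notin Phi ->
  {in Phi &, forall s s', ridge_adj d s s' -> y s (+) y s' = (s :&: s' \subset tau)} ->
  is_balanced_connected_sum (ColoredComplex (dcl (side Phi tau y true)) kappa)
    (ColoredComplex (dcl (side Phi tau y false)) kappa)
    (ColoredComplex (dcl Phi) kappa).
Proof.
move=> psP rb tc tr tm yP.
have [c _ _] := psP.
have tauS b : tau \in side Phi tau y b by apply/sideP; left.
have psS b : pseudo d (side Phi tau y b) := side_pseudo psP d4 tc tr tm yP b.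
exists tau, tau, id; split.
- exact: (facet_dcl (psS true)).
- exact: (facet_dcl (psS false)).
- by split=> //; rewrite imset_id.
pose f (z : V + V) := match z with inl x => x | inr x => x end.
pose gl (x : V) : V + V := if x \in tau then inl x else inr x.
have fgl x : f (gl x) = x by rewrite /f /gl; case: (x \in tau).
have fgK F : f @: (gl @: F) = F.
  by rewrite -imset_comp (eq_imset _ (fgl : f \o gl =1 id)) imset_id.
have finlK F : f @: (inl @: F) = F.
  by rewrite -imset_comp -[RHS]imset_id; exact: eq_imset.
have subtau F : F \subset tau -> F <> tau -> F \in dcl Phi.
  move=> Ft Fn; apply: (proper_tau_dcl tc tr) => //.
  by rewrite -tc; apply: proper_card; rewrite properEneq Ft andbT; apply/eqP.
have glt : gl @: tau = inl @: tau.
  by apply: eq_in_imset => x xt; rewrite /gl xt.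
have sideD b F : F \in dcl (side Phi tau y b) -> F <> tau -> F \in dcl Phi.
  case/dclP=> s /sideP[->|[sP _]] Fs Fn; first exact: subtau.
  by apply/dclP; exists s.
have notau H : H \in dcl Phi -> H <> tau.
  case/dclP=> s sP Hs Ht; case/negP: tm; rewrite -(_ : s = tau) //.
  by apply/esym/eqP; rewrite eqEcard -{1}Ht Hs tc (c _ sP) /=.
exists f; split.
- have vl x : inl x \in vertex (faces (connected_sum (A :=
      ColoredComplex (dcl (side Phi tau y true)) kappa) (B :=
      ColoredComplex (dcl (side Phi tau y false)) kappa) tau tau id)) ->
      x \in tau \/ exists2 s, s \in Phi /\ y s = true & x \in s.
    rewrite unfold_in /vertex /= in_setD1 in_setU => /andP[_ /orP[]/imsetP[F FP E]].
      move/setP/(_ (inl x)): E; rewrite in_set1 eqxx => /esym/imsetP[z zF [->]]; case/dclP: FP => s /sideP[sE|sP] Fs.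
        by left; rewrite -sE; exact: (subsetP Fs).
      by right; exists s => //; exact: (subsetP Fs).
    left; move/setP/(_ (inl x)): E; rewrite in_set1 eqxx => /esym/imsetP[z zF].
    by rewrite /glue; case: ifP => // zt [->].
  have vr x : inr x \in vertex (faces (connected_sum (A :=
      ColoredComplex (dcl (side Phi tau y true)) kappa) (B :=
      ColoredComplex (dcl (side Phi tau y false)) kappa) tau tau id)) ->
      x \notin tau /\ exists2 s, s \in Phi /\ y s = false & x \in s.
    rewrite unfold_in /vertex /= in_setD1 in_setU => /andP[_ /orP[]/imsetP[F FP E]].
      by move/setP/(_ (inr x)): E; rewrite in_set1 eqxx => /esym/imsetP[].
    move/setP/(_ (inr x)): E; rewrite in_set1 eqxx => /esym/imsetP[z zF].
    rewrite /glue; case: ifP => // /negbT zt [->]; split=> //.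
    case/dclP: FP => s /sideP[sE|sP] Fs; first by rewrite -sE (subsetP Fs) in zt.
    by exists s => //; exact: (subsetP Fs).
  (* A vertex off [tau] lies in facets of one class only, and vertices in [tau] are already
     identified by the gluing; hence folding is injective on vertices. *)
  have clash x : (x \in tau \/ exists2 s, s \in Phi /\ y s = true & x \in s) ->
      (x \notin tau /\ exists2 s, s \in Phi /\ y s = false & x \in s) -> False.
    move=> h [xt [s [sP ys] xs]]; case: h => [|[s' [s'P ys'] xs']].
      by rewrite (negPf xt).
    have : y s = y s'.
      by apply: (side_const psP yP (H := [set x])); rewrite ?inE ?sub1set ?sP ?s'P.
    by rewrite ys ys'.
  move=> [x|x] [x'|x'] hx hx' /= E; rewrite E // in hx *.
  - by case: (clash x' (vl _ hx) (vr _ hx')).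
  - by case: (clash x' (vl _ hx') (vr _ hx)).
- by move=> [x|x] _.
apply/setP=> H; apply/imsetP/idP => [[K]|HP].
  rewrite /= in_setD1 in_setU => /andP[Kn /orP[]/imsetP[F FP KE]] ->.
    rewrite KE finlK; apply: (sideD true) => // Ft.
    by case/eqP: Kn; rewrite KE Ft.
  rewrite KE -/(gl @: F) fgK; apply: (sideD false) => // Ft.
  by case/eqP: Kn; rewrite KE Ft -glt.
have [s sP Hs] := dclP _ _ HP; have Hn := notau H HP.
case ys: (y s).
  exists (inl @: H); last by rewrite finlK.
  rewrite /= in_setD1 in_setU; apply/andP; split.
    by apply/eqP=> E; apply: Hn; rewrite -(finlK H) -(finlK tau) E.
  apply/orP; left; apply/imsetP; exists H => //; apply/dclP; exists s => //.
  by apply/sideP; right.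
exists (gl @: H); last by rewrite fgK.
rewrite /= in_setD1 in_setU; apply/andP; split.
  by apply/eqP=> E; apply: Hn; rewrite -(fgK H) -(finlK tau) E.
apply/orP; right; apply/imsetP; exists H => //; apply/dclP; exists s => //.
by apply/sideP; right.
Qed.

Lemma tight_stacked Phi : Phi != set0 -> pseudo d Phi ->
  (forall s, s \in Phi -> {in s &, injective kappa}) -> tight kappa Phi ->
  stacked_cross_polytopal (ColoredComplex (dcl Phi) kappa).
Proof.
have [n] := ubnP #|cover Phi|; elim: n Phi => // n IH Phi le ne psP rb ti.
pose mis tau := [&& #|tau| == d,
  [forall R : {set V}, (R \subset tau) && (#|R| == d.-1) ==> (R \in dcl Phi)] &
  tau \notin Phi].
case: (boolP [exists tau, mis tau]) => [/existsP[tau]|/existsPn N]; last first.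
  apply: stacked_cross; apply: flag_cross_polytope => // tau tc tr.
  apply/negPn/negP => tm; case/negP: (N tau); rewrite /mis tc eqxx tm andbT /=.
  by apply/forallP=> R; apply/implyP=> /andP[Rt /eqP]; exact: tr.
case/and3P=> /eqP tc /forallP tr' tm.
have tr R : R \subset tau -> #|R| = d.-1 -> R \in dcl Phi.
  by move=> Rt cR; have := tr' R; rewrite Rt cR eqxx.
have [y yP] := global_potential psP rb ti d4 tc tr tm.
have st b : stacked_cross_polytopal (ColoredComplex (dcl (side Phi tau y b)) kappa).
  apply: IH.
  - by rewrite -ltnS; apply: leq_trans le; rewrite ltnS; exact: (side_cover_lt psP d4 tc tr tm yP).
  - by apply/set0Pn; exists tau; apply/sideP; left.
  - exact: (side_pseudo psP d4 tc tr tm yP).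
  - by move=> s; exact: (side_rainbow rb d4 tc tr).
  - exact: (side_tight psP rb ti d4 tc tr tm yP).
exact: stacked_sum (st true) (st false) (sides_connected_sum psP rb tc tr tm yP).
Qed.

End Stacking.

(** * From a normal pseudomanifold to its family of facets *)

Section FromComplex.
Variables (V : finType) (d : nat) (kappa : V -> 'I_d) (Delta : {set {set V}}).
Hypothesis hcomplex : simplicial_complex Delta.
Hypothesis hbalanced : balanced kappa Delta.
Hypothesis hnormal : normal_pseudomanifold d Delta.
Implicit Types (F G s u v : {set V}).

Definition facets : {set {set V}} := [set s | facet Delta s].

Lemma facets_face s : s \in facets -> s \in Delta.
Proof. by rewrite inE => /maxsetp. Qed.

Lemma face_in_facet F : F \in Delta -> exists2 s, s \in facets & F \subset s.
Proof.
move=> FD; have [s sm Fs] := maxset_exists (P := fun F => F \in Delta) FD.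
by exists s; rewrite // inE.
Qed.

Lemma dcl_facets : dcl facets = Delta.
Proof.
apply/setP=> F; apply/dclP/idP => [[s /facets_face sD Fs]|/face_in_facet//].
by case: hcomplex => _ H; exact: H sD Fs.
Qed.

Lemma facets_neq0 : facets != set0.
Proof.
by have [s sP _] := face_in_facet hcomplex.1; apply/set0Pn; exists s.
Qed.

Lemma facets_rainbow s : s \in facets -> {in s &, injective kappa}.
Proof. by move=> /facets_face sD x y xs ys; exact: hbalanced sD xs ys. Qed.

(** Induction on the codimension. Over a ridge all distinct facets are adjacent. In higher
    codimension a path of vertices in the link of [G] joins the two facets: consecutive vertices lie
    in a common facet, and over each vertex the induction hypothesis applies. *)
Lemma facets_linked n G : d <= #|G| + n -> linked (star facets G) (ridge_adj d).
Proof.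
have [conn pur _ lkc] := hnormal; have [D0 Dsub] := hcomplex.
have cd s : s \in facets -> #|s| = d by rewrite inE; exact: pur.
elim: n G => [|n IH] G dG P clP s s' sS s'S Ps; move: (sS) (s'S);
  rewrite !inE -/(facets) => /andP[/pur cs Gs] /andP[/pur cs' Gs'].
  have E u : #|u| = d -> G \subset u -> G = u.
    by move=> cu Gu; apply/eqP; rewrite eqEcard Gu cu -[leqRHS]addn0.
  by rewrite -(E s' cs' Gs') (E s cs Gs).
have [dG'|dG'] := leqP d (#|G| + n); first exact: (IH G dG' P clP s s' sS s'S Ps).
have GD : G \in Delta.
  by apply: Dsub Gs; apply: facets_face; move: sS; rewrite inE => /andP[].
have cG : #|G| + n.+1 = d by apply/eqP; rewrite eqn_leq dG addnS dG'.
case: n IH dG dG' cG => [|n] IH dG dG' cG.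
  case: (eqVneq s s') => [<-//|n]; apply: (clP s s') => //.
  rewrite /ridge_adj eqn_leq; apply/andP; split.
    have dp : 0 < d by rewrite -cG addn1.
    rewrite -ltnS prednK // -[ltnRHS]cs.
    apply: proper_card; rewrite properEneq subsetIl andbT.
    by apply: contraNneq n => /setIidPl ss'; rewrite eqEcard ss' cs cs' /=.
  by rewrite -cG addn1 /=; apply: subset_leq_card; rewrite subsetI Gs.
have lkG : connected_complex (link Delta G).
  by apply: lkc => //; rewrite -cG addnS ltn_add2l.
have ex u : #|u| = d -> exists2 x, x \in u & x \notin G.
  move=> cu; apply/subsetPn; apply: contraL (leqnn d) => /subset_leq_card.
  by rewrite cu -ltnNge -[ltnRHS]cG => h; rewrite (leq_ltn_trans h) // -[ltnLHS]addn0 ltn_add2l.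
have [x xs xG] := ex _ cs; have [x' xs' x'G] := ex _ cs'.
have vx u z : u \in facets -> G \subset u -> z \in u -> z \notin G -> vertex (link Delta G) z.
  move=> uP Gu zu zG; have uD := facets_face uP; rewrite /vertex inE disjoints1 zG /=.
  apply/andP; split; first by apply: Dsub uD _; rewrite sub1set.
  by apply: Dsub uD _; rewrite subUset sub1set zu.
have sF : s \in facets by move: sS; rewrite inE => /andP[].
have s'F : s' \in facets by move: s'S; rewrite inE => /andP[].
have := lkG x x' (vx s x sF Gs xs xG) (vx s' x' s'F Gs' xs' x'G).
pose Pz z := [forall u in star facets (z |: G), P u].
have IHz z u v : z \notin G -> u \in star facets (z |: G) -> v \in star facets (z |: G) ->
    P u -> P v.
  move=> zG; apply: (IH (z |: G)); first by rewrite cardsU1 zG add1n addSnnS.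
  have sub w : w \in star facets (z |: G) -> w \in star facets G.
    by rewrite !inE subUset => /and3P[-> _ ->].
  by move=> a b /sub aS /sub bS; exact: clP.
have Pzx : Pz x.
  apply/forall_inP=> u uS; apply: (IHz x s u) => //.
  by rewrite inE sF subUset sub1set xs.
case/connectP=> p; elim: p x {xs xG} Pzx => [|z p IHp] x Pzx /=.
  move=> _ E; move/forall_inP: Pzx; apply.
  by rewrite inE s'F subUset sub1set -E xs'.
case/andP=> /andP[_]; rewrite inE => /and3P[_ dis xzD] pth; apply: IHp pth.
have [u uP xzu] := face_in_facet xzD.
move: xzu; rewrite !subUset !sub1set => /andP[/andP[xu zu] Gu].
have zG : z \notin G.
  apply/negP => zG; move: dis; rewrite -setI_eq0 => /eqP/setP/(_ z).
  by rewrite !inE eqxx orbT zG.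
apply/forall_inP=> v vS; apply: (IHz z u v) => //.
  by rewrite inE uP subUset sub1set zu.
by move/forall_inP: Pzx; apply; rewrite inE uP subUset sub1set xu.
Qed.

Lemma facets_pseudo : pseudo d facets.
Proof.
have [conn pur rid lkc] := hnormal; have [D0 Dsub] := hcomplex.
split.
- by move=> s; rewrite inE; exact: pur.
- move=> s R sP Rs cR; rewrite -(rid R) //; last exact: Dsub (facets_face sP) Rs.
  by apply: eq_card => G; rewrite !inE.
- by move=> G; apply: (@facets_linked d); rewrite leq_addl.
Qed.

End FromComplex.

(** * The invariant gbar_2 *)

Section Gbar.
Import GRing.Theory.
Local Open Scope ring_scope.

Lemma fnum0 (V : finType) (D : {set {set V}}) : set0 \in D -> fnum D 0 = 1%N.
Proof.
move=> D0; rewrite /fnum -(cards1 (set0 : {set V})); apply: eq_card => F.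
by rewrite !inE cards_eq0; case: eqP => [->|_]; rewrite ?D0 ?andbF.
Qed.

(** From h_1 = f_0 - d and h_2 = f_1 - (d-1) f_0 + C(d,2). *)
Lemma gbar2E (V : finType) (d : nat) (D : {set {set V}}) :
  (2 <= d)%N -> set0 \in D ->
  gbar2 d D = 2 * (fnum D 2)%:Z - 3 * (d%:Z - 1) * (fnum D 1)%:Z
              + 2 * d%:Z * (d%:Z - 1).
Proof.
case: d => [|[|n]] // _ D0; rewrite /gbar2 /hnum !big_ord_recl !big_ord0 /= fnum0 //.
rewrite /bump /= !subSS !subn0 !binn !addr0 !expr0 !expr1 !mul1r.
have b3 : 2 * ('C(n.+2, n))%:Z = n.+2%:Z * n.+1%:Z.
  have -> : 'C(n.+2, n) = 'C(n.+2, 2) by rewrite -[RHS]bin_sub // !subSS subn0.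
  rewrite -!PoszM; congr Posz.
  by have := bin_ffact n.+2 2; rewrite ffactSS ffactn1 mulnC.
rewrite !binSn.
lra.
Qed.

End Gbar.

(** * Summation over triples of colours *)

Lemma card_supersets (I : finType) (P : {set I}) k :
  #|[set T : {set I} | (P \subset T) && (#|T| == #|P| + k)]| = 'C(#|I| - #|P|, k).
Proof.
have <- : #|~: P| = #|I| - #|P| by rewrite -(cardsC P) addKn.
rewrite -cards_draws -(card_in_imset (f := fun T => T :\: P)); last first.
  move=> A B; rewrite !inE => /andP[/setDUK EA _] /andP[/setDUK EB _] E.
  by rewrite -EA -EB E.
apply: eq_card => B; rewrite [in RHS]inE; apply/imsetP/andP => [[T]|[BP /eqP cB]].
  rewrite inE => /andP[PT /eqP cT] ->; rewrite subsetDr; split=> //.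
  by rewrite -(eqn_add2l #|P|) -cT -(cardsID P T) (setIidPr PT).
have dis : [disjoint B & P] by rewrite disjoints_subset.
exists (B :|: P); last by rewrite setUDK.
by rewrite inE subsetUr card_setU_disjoint // cB addnC eqxx.
Qed.

Section ColorSums.
Variables (V : finType) (d : nat) (kappa : V -> 'I_d) (Phi : {set {set V}}).
Hypothesis rainbow : forall s, s \in Phi -> {in s &, injective kappa}.
Implicit Types (F e : {set V}) (T : {set 'I_d}).

(** A face with [j] vertices has [j] colours, which lie in C(d-j,3-j) triples. *)
Lemma sum_colored_faces j : j <= 3 ->
  \sum_(T : {set 'I_d} | #|T| == 3)
     #|[set F in dcl Phi | (#|F| == j) && (kappa @: F \subset T)]|
  = 'C(d - j, 3 - j) * fnum (dcl Phi) j.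
Proof.
move=> j3; under eq_bigr => T _ do rewrite -sum1_card.
rewrite (exchange_big_dep (fun F => F \in [set F in dcl Phi | #|F| == j])) /=; last first.
  by move=> T F _; rewrite !inE => /andP[-> /andP[-> _]].
rewrite /fnum mulnC -sum_nat_const; apply: eq_bigr => F; rewrite in_set => /andP[FP /eqP cF].
have cK : #|kappa @: F| = j.
  rewrite card_in_imset //; case/dclP: FP => s sP /subsetP Fs x y /Fs xs /Fs ys.
  exact: (rainbow sP).
have := card_supersets (kappa @: F) (3 - j); rewrite cK card_ord subnKC // => <-.
rewrite -sum1_card; apply: eq_bigl => T.
by rewrite [in RHS]in_set [F \in _]in_set FP cF eqxx /= andbC.
Qed.

Lemma pairs_trisE T : pairs (tris kappa Phi set0 T) =
  [set F in dcl Phi | (#|F| == 2) && (kappa @: F \subset T)].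
Proof.
apply/setP=> e; rewrite [in RHS]in_set; apply/pairsT/and3P => [[ce [s sS es]]|[eP /eqP ce eT]].
  move: sS es; rewrite inE subsetI => /andP[sP _] /andP[es /subsetP eC].
  split; [by apply/dclP; exists s | by rewrite ce |].
  by apply/subsetP=> _ /imsetP[x xe ->]; have := eC _ xe; rewrite inE.
split=> //; case/dclP: eP => s sP es; exists s; first by rewrite inE sP sub0set.
rewrite subsetI es; apply/subsetP=> x xe; rewrite inE; apply: (subsetP eT).
exact: imset_f.
Qed.

Lemma card_cover_tris T : #|cover (tris kappa Phi set0 T)| =
  #|[set F in dcl Phi | (#|F| == 1) && (kappa @: F \subset T)]|.
Proof.
rewrite -(card_imset _ (@set1_inj V)); apply: eq_card => F; rewrite [in RHS]in_set.
apply/imsetP/and3P => [[x /coverT[s sS [xs xT]] ->]|[FP /cards1P[x FE] FT]].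
  move: sS; rewrite inE => /andP[sP _]; rewrite cards1 imset_set1 sub1set; split=> //.
  by apply/dclP; exists s; rewrite ?sub1set.
rewrite {}FE in FP FT *; exists x => //; apply/coverT.
case/dclP: FP => s sP; rewrite sub1set => xs.
exists s; first by rewrite inE sP sub0set.
by split=> //; move: FT; rewrite imset_set1 sub1set.
Qed.

End ColorSums.

(** The equation for gbar_2 = 0 multiplied by (d-2)/2; the factor 2 is cleared before comparing
    binomials. *)
Lemma color_count_eq d f1 f2 : 3 <= d ->
  2 * f2 + 2 * (d * d.-1) = 3 * (d.-1 * f1) ->
  3 * ('C(d - 1, 2) * f1) = 'C(d - 2, 1) * f2 + 'C(d, 3) * 6.
Proof.
case: d => [|[|[|m]]] // _; rewrite !subSS !subn0 bin1 /= => H.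
have c2 : 'C(m.+2, 2) * 2 = m.+2 * m.+1.
  by have := bin_ffact m.+2 2; rewrite ffactSS ffactn1.
have c3 : 'C(m.+3, 3) * 6 = m.+3 * (m.+2 * m.+1).
  by have := bin_ffact m.+3 3; rewrite 2!ffactSS ffactn1.
apply/eqP; rewrite -(eqn_pmul2l (isT : 0 < 2)) c3; apply/eqP.
transitivity (m.+1 * (3 * (m.+2 * f1))); last by rewrite -H; clear; lia.
have -> : 2 * (3 * ('C(m.+2, 2) * f1)) = 3 * (('C(m.+2, 2) * 2) * f1) by clear; lia.
by rewrite c2; clear; lia.
Qed.

(** The lower bounds for all T add up to an equality, so each is an equality. *)
Lemma gbar2_eq0_tight (V : finType) (d : nat) (kappa : V -> 'I_d)
    (Phi : {set {set V}}) :
  3 <= d -> Phi != set0 -> pseudo d Phi ->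
  (forall s, s \in Phi -> {in s &, injective kappa}) ->
  gbar2 d (dcl Phi) = 0%R -> tight kappa Phi.
Proof.
move=> d3 /set0Pn[s0 s0P] psP rb.
have D0 : set0 \in dcl Phi by apply/dclP; exists s0; rewrite ?sub0set.
rewrite gbar2E //; last exact: ltnW.
set f2 := fnum _ 2; set f1 := fnum _ 1 => g0.
have gn : 2 * f2 + 2 * (d * d.-1) = 3 * (d.-1 * f1) by move: g0 d3; clear; nia.
pose n T := #|cover (tris kappa Phi set0 T)|; pose e T := #|pairs (tris kappa Phi set0 T)|.
have low (T : {set 'I_d}) : #|T| == 3 -> 3 * n T <= e T + 6 ?= iff (3 * n T == e T + 6).
  move=> /eqP T3; apply: leqif_eq; apply: (rigid_lower (t := s0 :&: colored_in kappa T)).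
  - exact: (rigid_tris psP rb T3 (disjoint0_colored kappa T)).
  - by apply: imset_f; rewrite inE s0P sub0set.
  - by rewrite (card_colored psP rb T s0P).
have [_ sumE] := leqif_sum low.
have : [forall (T : {set 'I_d} | #|T| == 3), 3 * n T == e T + 6].
  rewrite -sumE; apply/eqP; rewrite [RHS]big_split /= sum_nat_cond_const -big_distrr /=.
  under eq_bigr => T _ do rewrite /n card_cover_tris.
  under [X in _ = X + _]eq_bigr => T _ do rewrite /e pairs_trisE.
  rewrite !sum_colored_faces // -/f1 -/f2 (color_count_eq d3 gn); congr (_ + _ * 6).
  have := cards_draws [set: 'I_d] 3; rewrite cardsT card_ord => <-.
  by apply: eq_card => T; rewrite !inE subsetT.
move=> /forall_inP H T /eqP T3; have /eqP := H T T3; rewrite /n /e => <-.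
exact: leqnn.
Qed.

(** * Stacked spheres have gbar_2 = 0 *)

Section Converse.
Variable d : nat.

(* The second facet is what keeps a complex pure after one facet is removed. *)
Definition pure2 (V : finType) (D : {set {set V}}) : Prop :=
  [/\ simplicial_complex D, forall F, F \in D -> #|F| <= d &
      forall F, F \in D -> #|F| < d -> exists s1 s2,
        [/\ s1 != s2, s1 \in D /\ s2 \in D, #|s1| = d /\ #|s2| = d &
            F \subset s1 /\ F \subset s2]].

(** The vanishing of gbar_2 with all terms moved to their positive side, so that it can be stated in
    natural numbers. *)
Definition fcount (V : finType) (D : {set {set V}}) : Prop :=
  2 * fnum D 2 + 2 * (d * d.-1) = 3 * (d.-1 * fnum D 1).

Lemma pure2_facet (V : finType) (D : {set {set V}}) F :
  pure2 D -> facet D F -> F \in D /\ #|F| = d.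
Proof.
move=> [_ le two] /maxsetP[FD mx]; split=> //; apply/eqP; rewrite eqn_leq le //=.
rewrite leqNgt; apply/negP => lt.
have [s1 [s2 [_ [s1D _] [c1 _] [F1 _]]]] := two F FD lt.
by move: lt; rewrite -c1 (mx s1 s1D F1) ltnn.
Qed.

Section Iso.
Variables (V W : finType) (D : {set {set V}}) (f : V -> W).
Hypothesis finj : {in vertex D &, injective f}.
Hypothesis pD : pure2 D.
Let fD : {set {set W}} := [set f @: (F : {set V}) | F in D].

Let faceV (F : {set V}) : F \in D -> {subset F <= vertex D}.
Proof.
move=> FD x xF; case: pD => -[_ sub] _ _; rewrite unfold_in /vertex.
by apply: sub FD _; rewrite sub1set.
Qed.

Let fcard (F : {set V}) : F \in D -> #|f @: F| = #|F|.
Proof. by move=> FD; rewrite card_in_imset // => x y /(faceV FD) ? /(faceV FD); exact: finj. Qed.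

Let fface (F G : {set V}) : F \in D -> G \in D -> f @: F \subset f @: G -> F \subset G.
Proof.
move=> FD GD /subsetP h; apply/subsetP=> x xF.
have /imsetP[z zG E] := h _ (imset_f f xF).
by rewrite (finj (faceV FD xF) (faceV GD zG) E).
Qed.

Let finj2 : {in D &, injective (fun F : {set V} => f @: F)}.
Proof.
by move=> F G FD GD E; apply/eqP; rewrite eqEsubset !fface // E.
Qed.

Lemma pure2_imset : pure2 fD.
Proof.
have [[D0 sub] le two] := pD; split.
- split; first by apply/imsetP; exists set0; rewrite ?imset0.
  move=> _ K /imsetP[F FD ->] KF; apply/imsetP; exists (F :&: f @^-1: K).
    by apply: sub FD _; exact: subsetIl.
  apply/setP=> x; apply/idP/imsetP => [xK|[z]]; last by rewrite !inE => /andP[_ zK] ->.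
  have /imsetP[z zF E] := subsetP KF _ xK.
  by exists z; rewrite // !inE zF -E.
- by move=> _ /imsetP[F FD ->]; rewrite fcard // le.
- move=> _ /imsetP[F FD ->]; rewrite fcard // => lt.
  have [s1 [s2 [n [d1 d2] [c1 c2] [F1 F2]]]] := two F FD lt.
  exists (f @: s1), (f @: s2); split.
  + by apply: contra_neq n => /finj2 ->.
  + by split; apply: imset_f.
  + by rewrite !fcard.
  + by split; apply: imsetS.
Qed.

Lemma fnum_imset i : fnum fD i = fnum D i.
Proof.
rewrite /fnum; have inj : {in [set F in D | #|F| == i] &,
    injective (fun F : {set V} => f @: F)}.
  by move=> F G; rewrite !inE => /andP[FD _] /andP[GD _]; exact: finj2.
rewrite -(card_in_imset inj); apply: eq_card => K; rewrite in_set.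
apply/andP/imsetP => [[/imsetP[F FD ->] cF]|[F]].
  by exists F; rewrite // inE FD -(fcard FD).
by rewrite inE => /andP[FD cF] ->; rewrite fcard // imset_f.
Qed.

End Iso.

(** * Face numbers of a connected sum *)

Section Sum.
Variables (VA VB : finType) (DA : {set {set VA}}) (DB : {set {set VB}}).
Variables (FA : {set VA}) (FB : {set VB}) (phi : VB -> VA).
Hypothesis d3 : 3 <= d.
Hypotheses (pA : pure2 DA) (pB : pure2 DB).
Hypotheses (facA : facet DA FA) (facB : facet DB FB).
Hypothesis phi_inj : {in FB &, injective phi}.
Hypothesis phi_im : phi @: FB = FA.

Let gl (x : VB) : VA + VB := if x \in FB then inl (phi x) else inr x.
Let il (x : VA) : VA + VB := inl x.
Let IA := [set il @: (F : {set VA}) | F in DA].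
Let IB := [set gl @: (F : {set VB}) | F in DB].
Let SD := (IA :|: IB) :\ (il @: FA).

Let il_inj : injective il. Proof. by move=> x y []. Qed.
Let gl_inj : injective gl.
Proof.
move=> x y; rewrite /gl; case: ifP => xF; case: ifP => yF // [E] //.
exact: phi_inj.
Qed.

Let iilI : injective (fun F : {set VA} => il @: F). Proof. exact: imset_inj il_inj. Qed.
Let iglI : injective (fun F : {set VB} => gl @: F). Proof. exact: imset_inj gl_inj. Qed.

Let glF (G : {set VB}) : G \subset FB -> gl @: G = il @: (phi @: G).
Proof.
move=> /subsetP GF; rewrite -imset_comp; apply: eq_in_imset => x xG.
by rewrite /gl GF.
Qed.

Let glFB : gl @: FB = il @: FA. Proof. by rewrite glF // phi_im. Qed.

Let il_gl (F : {set VA}) (G : {set VB}) : il @: F = gl @: G -> G \subset FB /\ F = phi @: G.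
Proof.
move=> E; have GF : G \subset FB.
  apply/subsetP=> x xG; have : gl x \in il @: F by rewrite E imset_f.
  by case/imsetP=> z _; rewrite /gl; case: ifP.
by split=> //; apply: iilI; rewrite E glF.
Qed.

Let cFA : FA \in DA /\ #|FA| = d. Proof. exact: pure2_facet pA facA. Qed.
Let cFB : FB \in DB /\ #|FB| = d. Proof. exact: pure2_facet pB facB. Qed.

Let subA (G : {set VA}) : G \subset FA -> G \in DA.
Proof. by move=> GF; case: pA => -[_ sub] _ _; apply: sub GF; case: cFA. Qed.
Let subB (G : {set VB}) : G \subset FB -> G \in DB.
Proof. by move=> GF; case: pB => -[_ sub] _ _; apply: sub GF; case: cFB. Qed.

Let preim (F : {set VA}) : F \subset FA -> exists2 G : {set VB}, G \subset FB & F = phi @: G.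
Proof.
move=> FFA; exists (FB :&: phi @^-1: F); first exact: subsetIl.
apply/setP=> x; apply/idP/imsetP => [xF|[z]]; last by rewrite !inE => /andP[_ zF] ->.
have := subsetP FFA _ xF; rewrite -phi_im => /imsetP[z zF E].
by exists z; rewrite // !inE zF -E.
Qed.

Let inA (F : {set VA}) : F \in DA -> F <> FA -> il @: F \in SD.
Proof.
move=> FD Fn; rewrite in_setD1 in_setU imset_f // andbT.
by apply/eqP => /iilI.
Qed.

Let inB (F : {set VB}) : F \in DB -> F <> FB -> gl @: F \in SD.
Proof.
move=> FD Fn; rewrite in_setD1 in_setU [X in _ || X]imset_f // orbT andbT.
by rewrite -glFB; apply/eqP => /iglI.
Qed.

Let SDP K : K \in SD -> (exists2 F : {set VA}, F \in DA /\ F <> FA & K = il @: F) \/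
  (exists2 F : {set VB}, F \in DB /\ F <> FB & K = gl @: F).
Proof.
rewrite in_setD1 in_setU => /andP[Kn /orP[]/imsetP[F FD E]]; [left|right]; exists F => //;
  split=> // FE; case/eqP: Kn; rewrite E FE //.
Qed.

Lemma pure2_sum : pure2 SD.
Proof.
have [[A0 sA] leA twoA] := pA; have [[B0 sB] leB twoB] := pB.
have [FAD FAc] := cFA; have [FBD FBc] := cFB.
have maxA F : F \in DA -> FA \subset F -> F = FA by case/maxsetP: facA => _; exact.
have maxB F : F \in DB -> FB \subset F -> F = FB by case/maxsetP: facB => _; exact.
split.
- split.
    rewrite -(imset0 il); apply: inA => // E; move: FAc d3; rewrite -E cards0 => <-.
    by [].
  move=> K H /SDP[[F [FD Fn] ->]|[F [FD Fn] ->]] HK.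
    have HE : H = il @: (F :&: il @^-1: H).
      apply/setP=> x; apply/idP/imsetP => [xH|[z]]; last by rewrite !inE => /andP[_ zH] ->.
      have /imsetP[z zF E] := subsetP HK _ xH.
      by exists z; rewrite // !inE zF -E.
    rewrite HE; apply: inA; first by apply: sA FD _; exact: subsetIl.
    by move=> E; apply: Fn; apply: maxA => //; rewrite -E subsetIl.
  have HE : H = gl @: (F :&: gl @^-1: H).
    apply/setP=> x; apply/idP/imsetP => [xH|[z]]; last by rewrite !inE => /andP[_ zH] ->.
    have /imsetP[z zF E] := subsetP HK _ xH.
    by exists z; rewrite // !inE zF -E.
  rewrite HE; apply: inB; first by apply: sB FD _; exact: subsetIl.
  by move=> E; apply: Fn; apply: maxB => //; rewrite -E subsetIl.
- move=> K /SDP[[F [FD _] ->]|[F [FD _] ->]]; rewrite card_imset //; [exact: leA | exact: leB].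
have caseA F : F \in DA -> #|F| < d -> exists s1 s2,
    [/\ s1 != s2, s1 \in SD /\ s2 \in SD, #|s1| = d /\ #|s2| = d &
        il @: F \subset s1 /\ il @: F \subset s2].
  move=> FD lt.
  (* A face of the removed facet keeps a facet on each side: [s] from the first summand, and from
     the second a facet other than [FB], provided by [pure2]. *)
  have other s : s \in DA -> #|s| = d -> F \subset s -> s <> FA -> F \subset FA ->
      exists s1 s2, [/\ s1 != s2, s1 \in SD /\ s2 \in SD, #|s1| = d /\ #|s2| = d &
        il @: F \subset s1 /\ il @: F \subset s2].
    move=> sD cs Fs sn FFA; have [G GF FE] := preim FFA.
    have cG : #|G| < d.
      apply: leq_ltn_trans lt; rewrite FE card_in_imset // => x y xG yG.
      by apply: phi_inj; apply: (subsetP GF).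
    have [u un [uD [cu Gu]]] : exists2 u : {set VB}, u <> FB & u \in DB /\ #|u| = d /\ G \subset u.
      have [u1 [u2 [n [d1 d2] [c1 c2] [g1 g2]]]] := twoB G (subB GF) cG.
      case: (eqVneq u1 FB) => [E|n1]; last by exists u1 => //; apply/eqP.
      by exists u2 => //; apply/eqP; rewrite eq_sym -E.
    exists (il @: s), (gl @: u); split.
    + apply/eqP=> /il_gl[uFB _]; apply: un.
      by apply/eqP; rewrite eqEcard uFB cu FBc /=.
    + by split; [exact: inA | exact: inB].
    + by rewrite !card_imset.
    + by split; [exact: imsetS | rewrite FE -glF //; exact: imsetS].
  have [s1 [s2 [n [d1 d2] [c1 c2] [F1 F2]]]] := twoA F FD lt.
  case: (eqVneq s1 FA) => [E1|n1].
    by apply: (other s2) => //; [apply/eqP; rewrite -E1 eq_sym | rewrite -E1].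
  case: (eqVneq s2 FA) => [E2|n2].
    by apply: (other s1) => //; [apply/eqP | rewrite -E2].
  exists (il @: s1), (il @: s2); split.
  - by apply: contra_neq n => /iilI.
  - by split; apply: inA => //; apply/eqP.
  - by rewrite !card_imset.
  - by split; apply: imsetS.
move=> K /SDP[[F [FD Fn] ->]|[F [FD Fn] ->]]; rewrite card_imset // => lt.
  exact: caseA.
case: (boolP (F \subset FB)) => FF.
  rewrite glF //; apply: caseA.
    by apply: subA; rewrite -phi_im; exact: imsetS.
  by rewrite card_in_imset // => x y xF yF; apply: phi_inj; apply: (subsetP FF).
have [s1 [s2 [n [d1 d2] [c1 c2] [F1 F2]]]] := twoB F FD lt.
exists (gl @: s1), (gl @: s2); split.
- by apply: contra_neq n => /iglI.
- by split; apply: inB => // E; case/negP: FF; rewrite -E.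
- by rewrite !card_imset.
- by split; apply: imsetS.
Qed.

(** Inclusion and exclusion: the two images meet exactly in the faces of the glued facet, and its
    removal does not affect sizes below [d]. *)
Lemma fnum_sum i : i < d -> fnum SD i + 'C(d, i) = fnum DA i + fnum DB i.
Proof.
move=> id; have [FAD FAc] := cFA; have [FBD FBc] := cFB.
pose PA := [set il @: (F : {set VA}) | F in [set F in DA | #|F| == i]].
pose PB := [set gl @: (F : {set VB}) | F in [set F in DB | #|F| == i]].
have cA : fnum DA i = #|PA| by rewrite /PA card_imset.
have cB : fnum DB i = #|PB| by rewrite /PB card_imset.
rewrite cA cB -cardsUI; congr (_ + _).
  apply: eq_card => K; rewrite in_set in_setU; apply/andP/orP.
    case=> /SDP[[F [FD _] ->]|[F [FD _] ->]]; rewrite card_imset // => cF; [left|right];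
      by apply: imset_f; rewrite inE FD.
  case=> /imsetP[F]; rewrite inE => /andP[FD cF] ->; rewrite card_imset // cF; split=> //.
    by apply: inA => // E; move: id; rewrite -(eqP cF) E FAc ltnn.
  by apply: inB => // E; move: id; rewrite -(eqP cF) E FBc ltnn.
rewrite -FAc -cards_draws -(card_imset _ iilI); apply: eq_card => K; rewrite in_setI.
apply/imsetP/andP => [[F]|[/imsetP[F FD ->] /imsetP[G GD E]]].
  rewrite inE => /andP[FFA cF] ->; split.
    by apply: imset_f; rewrite inE subA.
  have [G GF FE] := preim FFA; rewrite FE -glF //; apply: imset_f.
  rewrite inE subB //= -(eqP cF) FE card_in_imset // => x y xG yG.
  by apply: phi_inj; apply: (subsetP GF).
have [GF FE] := il_gl E; exists F => //; rewrite inE.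
move: FD; rewrite inE => /andP[_ ->]; rewrite andbT FE -phi_im; exact: imsetS.
Qed.

Lemma fcount_sum : fcount DA -> fcount DB -> fcount SD.
Proof.
rewrite /fcount => eA eB.
have s2 := fnum_sum d3; have := fnum_sum (ltnW d3); rewrite bin1 => s1.
have c2 : 'C(d, 2) * 2 = d * d.-1.
  have := bin_ffact d 2; case: d d3 => // n _; by rewrite ffactSS ffactn1.
move: eA eB s2 s1 c2 d3; clear.
move: (fnum SD 1) (fnum SD 2) (fnum DA 1) (fnum DA 2) (fnum DB 1) (fnum DB 2) 'C(d, 2).
case: d => // n a b c e f g h /=; nia.
Qed.

End Sum.

End Converse.

(** * The cross-polytope and the induction over stacked spheres *)

Lemma cross_faceP d (F : {set 'I_d * bool}) :
  reflect (forall i, (i, true) \in F -> (i, false) \in F -> False)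
    (F \in faces (cross_polytope d)).
Proof.
rewrite in_set; apply: (iffP forallP) => h i.
  by move=> h1 h2; have := h i; rewrite h1 h2.
by apply/negP => /andP[]; exact: h.
Qed.

Lemma cross_face_inj d (F : {set 'I_d * bool}) : F \in faces (cross_polytope d) ->
  {in F &, injective (fun p : 'I_d * bool => p.1)}.
Proof.
move=> /cross_faceP h [i b] [j c] h1 h2 /= ij; rewrite -{j}ij in h2 *.
by move: h1 h2; case: b; case: c => // h1 h2; case: (h i).
Qed.

Lemma cross_pure2 d : pure2 d (faces (cross_polytope d)).
Proof.
split.
- split; first by apply/cross_faceP => i; rewrite inE.
  move=> F G /cross_faceP h /subsetP GF; apply/cross_faceP => i /GF h1 /GF.
  exact: h h1.
- move=> F FP; rewrite -(card_in_imset (cross_face_inj FP)) -[leqRHS]card_ord.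
  exact: max_card.
move=> F FP lt.
have [i iF] : exists i, i \notin [set p.1 | p in F].
  have : [set p.1 | p in F] != [set: 'I_d].
    apply: contraTneq lt => E; rewrite -(card_in_imset (cross_face_inj FP)) E.
    by rewrite cardsT card_ord ltnn.
  by rewrite -properT => /properP[_ [i _]]; exists i.
(* Colours absent from [F] get the vertex v_k, except [i], where [b] is free and yields the two
   facets. *)
pose q b k := if k == i then b else (k, true) \in F.
pose s b := [set (k, q b k) | k : 'I_d].
have mem b k c : ((k, c) \in s b) = (c == q b k).
  by apply/imsetP/eqP => [[k' _ [-> ->]]|->] //; exists k.
have sF b : s b \in faces (cross_polytope d).
  by apply/cross_faceP => k; rewrite !mem => /eqP <-.
have cs b : #|s b| = d by rewrite card_imset ?card_ord // => k k' [].
have Fs b : F \subset s b.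
  apply/subsetP=> -[k c] kF; rewrite mem /q.
  have -> : (k == i) = false.
    by apply: contraNF iF => /eqP <-; apply/imsetP; exists (k, c).
  move/cross_faceP: FP => h; case: c kF => kF; first by rewrite kF.
  by apply/eqP/esym/negP => kT; exact: h kT kF.
exists (s true), (s false); split=> //.
by apply/eqP => /setP/(_ (i, true)); rewrite !mem /q eqxx.
Qed.

(** There are 2d vertices, and all pairs of them are edges except the d antipodal ones. *)
Lemma cross_fcount d : fcount d (faces (cross_polytope d)).
Proof.
have f1 : fnum (faces (cross_polytope d)) 1 = d * 2.
  rewrite -[d in RHS]card_ord -card_bool -card_prod -cardsT.
  rewrite -(card_imset _ (@set1_inj _)); apply: eq_card => F; rewrite in_set.
  apply/andP/imsetP => [[_ /cards1P[p ->]]|[p _ ->]]; first by exists p.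
  by rewrite cards1; split=> //; apply/cross_faceP => i; rewrite !inE => /eqP <- /eqP.
pose anti (i : 'I_d) := [set (i, true); (i, false)].
have anti_inj : injective anti.
  by move=> i j /setP/(_ (i, true)); rewrite !inE eqxx => /esym/orP[]/eqP[].
have f2 : fnum (faces (cross_polytope d)) 2 + d = 'C(d * 2, 2).
  rewrite -[X in 'C(X, _)](_ : #|[set: 'I_d * bool]| = _); last first.
    by rewrite cardsT card_prod card_ord card_bool.
  rewrite -cards_draws -(cardsID (faces (cross_polytope d))); congr (_ + _).
    by apply: eq_card => F; rewrite !in_set subsetT andbC.
  rewrite -[LHS]card_ord -cardsT -(card_imset _ anti_inj); apply: eq_card => F.
  apply/imsetP/setDP => [[i _ ->]|[]].
    split; first by rewrite in_set subsetT cards2 xpair_eqE andbF.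
    by apply/negP => /cross_faceP/(_ i); rewrite !in_set2 !eqxx orbT; exact.
  rewrite in_set => /andP[_ /eqP cF]; rewrite in_set negb_forall => /existsP[i].
  rewrite negbK => /andP[h1 h2].
  exists i => //; apply/esym/eqP; rewrite eqEcard subUset !sub1set h1 h2 cF.
  by rewrite cards2 xpair_eqE andbF.
have := bin_ffact (d * 2) 2; rewrite /fcount f1 -f2.
move: (fnum _ 2); clear; case: d => [|n] b.
  by rewrite ffact0n => /eqP; rewrite muln_eq0 orbF addn0 => /eqP ->.
by rewrite mulSn ffactSS ffactn1 (_ : 2`! = 2) //= => h; nia.
Qed.

Lemma stacked_fcount d (C : colored_complex d) : 3 <= d ->
  stacked_cross_polytopal C -> pure2 d (faces C) /\ fcount d (faces C).
Proof.
move=> d3; elim=> {C} [C [f [finj _ fE]]|A B C _ [pA cA] _ [pB cB]].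
  rewrite -fE /fcount !(fnum_imset finj (cross_pure2 d)); split.
    exact: pure2_imset (cross_pure2 d).
  exact: cross_fcount.
case=> FA [FB [phi [facA facB [phi_inj phi_im _] [f [finj _ fE]]]]].
have pS := pure2_sum d3 pA pB facA facB phi_inj phi_im.
have cS := fcount_sum d3 pA pB facA facB phi_inj phi_im cA cB.
rewrite -fE /fcount !(fnum_imset finj pS); split=> //.
exact: pure2_imset pS.
Qed.

Theorem theorem4p1 (d : nat) (V : finType) (Delta : {set {set V}})
    (kappa : V -> 'I_d) (hd : 4 <= d)
    (hcomplex : simplicial_complex Delta)
    (hbalanced : balanced kappa Delta)
    (hnormal : normal_pseudomanifold d Delta) :
  gbar2 d Delta = 0%R <->
  stacked_cross_polytopal (ColoredComplex Delta kappa).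
Proof.
split=> [g0|/(stacked_fcount (ltnW hd))[_ /=]].
  rewrite -(dcl_facets hcomplex) in g0 *.
  have ps := facets_pseudo hcomplex hnormal.
  have ne := facets_neq0 hcomplex.
  have rb := facets_rainbow hbalanced.
  apply: tight_stacked => //; exact: (gbar2_eq0_tight (ltnW hd)).
rewrite gbar2E; [|exact: ltnW (ltnW hd)|exact: hcomplex.1].
by rewrite /fcount; move: (fnum _ 1) (fnum _ 2) hd; clear; case: d => // n a b; nia.
Qed.
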